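(* Let $(S,g)$ be a Damek-Ricci space with $k=\dim\mathfrak{v}$, $m=\dim\mathfrak{z}$ and $n=\dim S=k+m+1$, and let its metric be rescaled by a positive constant so that $\mathrm{Ric}=-(n-1)\tilde g$ for the rescaled metric $\tilde g$. Let $Q$ be the volume entropy of $(S,\tilde g)$. Then $Q=\frac{2\sqrt2}{3}(n-1)$ holds in exactly four cases, namely $k=2m$ with $m=1,2,4,8$ (and each of these four cases does occur for some Damek-Ricci space).
   Context: A generalized Heisenberg algebra is a $2$-step nilpotent real Lie algebra $\mathfrak{n}$ with an inner product $\langle\cdot,\cdot\rangle$ and an orthogonal decomposition $\mathfrak{n}=\mathfrak{v}\oplus\mathfrak{z}$, where $\mathfrak{z}$ is the center of $\mathfrak{n}$ (both $\mathfrak{v}$ and $\mathfrak{z}$ nonzero), $[\mathfrak{v},\mathfrak{v}]\subset\mathfrak{z}$, and the maps $J_Z:\mathfrak{v}\to\mathfrak{v}$ defined for $Z\in\mathfrak{z}$ by $\langle J_ZU,V\rangle=\langle Z,[U,V]\rangle$ satisfy $J_Z^2=-\langle Z,Z\rangle\,\mathrm{id}_{\mathfrak{v}}$; thus $\mathfrak{v}$ is a Clifford module over $Cl(\mathfrak{z},q)$ with $q(Z)=-\langle Z,Z\rangle$. The associated Damek-Ricci space is the simply connected Lie group $S$ with Lie algebra $\mathfrak{s}=\mathfrak{v}\oplus\mathfrak{z}\oplus\mathbb{R}A$, whose bracket extends that of $\mathfrak{n}$ by $[A,U]=\frac12U$ for $U\in\mathfrak{v}$ and $[A,Z]=Z$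 for $Z\in\mathfrak{z}$, equipped with the left-invariant metric $g$ induced by the inner product on $\mathfrak{s}$ extending that of $\mathfrak{n}$ with $A$ a unit vector orthogonal to $\mathfrak{n}$. The volume entropy of a Riemannian manifold is $Q=\lim_{r\to\infty}\frac1r\log\mathrm{Vol}\,B(p;r)$, where $B(p;r)$ is the closed ball of radius $r$ about $p$. *)

(* Defs.v *)
From HB Require Import structures.
From mathcomp Require Import all_boot all_order all_algebra.
From mathcomp Require Import all_classical all_reals all_analysis.
From mathcomp Require Import lra.
Set Implicit Arguments.
Unset Strict Implicit.
Unset Printing Implicit Defensive.
Import Order.TTheory GRing.Theory Num.Theory.
Import numFieldNormedType.Exports.
Local Open Scope classical_set_scope.
Local Open Scope ring_scope.

(* The n-dimensional Lebesgue measure, on n.-tuple R with the product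
   sigma-algebra: the n-fold product of the Lebesgue measure on R, transported
   along (x, t) |-> x :: t at each step.                                      *)
Section lebesgue_tuple.
Variable R : realType.
Notation mR := (measurableTypeR R).

Definition tcons n (p : mR * n.-tuple mR) : n.+1.-tuple mR :=
  [the n.+1.-tuple mR of p.1 :: p.2].

Definition tuncons n (t : n.+1.-tuple mR) : mR * n.-tuple mR :=
  (thead t, [tuple of behead t]).

Lemma tconsK n : cancel (@tcons n) (@tuncons n).
Proof. by case=> x t; congr (_, _); apply/val_inj. Qed.

Lemma measurable_tcons n : measurable_fun [set: mR * n.-tuple mR] (@tcons n).
Proof. exact: measurable_cons. Qed.

Lemma measurable_tuncons n :
  measurable_fun [set: n.+1.-tuple mR] (@tuncons n).
Proof.
apply/measurable_fun_pairP; split; first exact: measurable_tnth.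
exact: measurable_behead.
Qed.

Section step.
Variables (n : nat) (mu : {sigma_finite_measure set (n.-tuple mR) -> \bar R}).

Definition lebesgue_step : set (n.+1.-tuple mR) -> \bar R :=
  pushforward (@lebesgue_measure R \x mu)%E (@tcons n).

Let lebesgue_step0 : lebesgue_step set0 = 0%E.
Proof. by rewrite /lebesgue_step /pushforward preimage_set0 measure0. Qed.

Let lebesgue_step_ge0 A : (0 <= lebesgue_step A)%E.
Proof. by rewrite /lebesgue_step /pushforward; exact: measure_ge0. Qed.

Let lebesgue_step_sigma_additive : semi_sigma_additive lebesgue_step.
Proof.
pose m := measure_function_pushforward__canonical__measure_function_Measure
  (@lebesgue_measure R \x mu)%E (@measurable_tcons n).
exact: (@measure_semi_sigma_additive _ _ _ m).
Qed.

HB.instance Definition _ := isMeasure.Build _ _ _ lebesgue_step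
  lebesgue_step0 lebesgue_step_ge0 lebesgue_step_sigma_additive.

Let lebesgue_step_sigma_finite : sigma_finite setT lebesgue_step.
Proof.
have /sigma_finiteP[F [FT ndF Foo]] := sigma_finiteT (@lebesgue_measure R).
have /sigma_finiteP[G [GT ndG Goo]] := sigma_finiteT mu.
exists (fun i => @tuncons n @^-1` (F i `*` G i)).
  apply/esym; rewrite -subTset => t _.
  have [i _ Fi] : (\bigcup_i F i) (tuncons t).1 by rewrite -FT.
  have [j _ Gj] : (\bigcup_j G j) (tuncons t).2 by rewrite -GT.
  exists (maxn i j) => //; split.
  - by move: Fi; exact/subsetPset/ndF/leq_maxl.
  - by move: Gj; exact/subsetPset/ndG/leq_maxr.
move=> i; have [mF Fi] := Foo i; have [mG Gi] := Goo i; split.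
  rewrite -[X in measurable X]setTI; apply: measurable_tuncons => //.
  exact: measurableX.
rewrite /lebesgue_step /pushforward -comp_preimage.
have -> : @tuncons n \o @tcons n = id by apply/funext => p; exact: tconsK.
rewrite preimage_id product_measure1E//.
by rewrite lte_mul_pinfty// ge0_fin_numE.
Qed.

HB.instance Definition _ := Measure_isSigmaFinite.Build _ _ _ lebesgue_step
  lebesgue_step_sigma_finite.

End step.

Fixpoint lebesgue_tuple n : {sigma_finite_measure set (n.-tuple mR) -> \bar R} :=
  match n with
  | 0 => \d_ ([tuple] : 0.-tuple mR)
  | n'.+1 => lebesgue_step (lebesgue_tuple n')
  end.

End lebesgue_tuple.

(* Riemannian geometry of R^n in its global chart 'rV[R]_n: a metric is the
   field G of its Gram matrices in the coordinate frame.                      *)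
Section riemannian_chart.
Variables (R : realType) (n : nat).
Notation E := 'rV[R]_n.
Implicit Types (G : E -> 'M[R]_n) (p q : E).

Definition partial (i : 'I_n) (f : E -> R) (p : E) : R :=
  'D_(delta_mx 0 i : E) f p.

(* Gamma^l_ij *)
Definition christoffel G (l i j : 'I_n) (p : E) : R :=
  2^-1 * \sum_(h < n) invmx (G p) l h *
    (partial i (fun x => G x j h) p + partial j (fun x => G x i h) p
     - partial h (fun x => G x i j) p).

Definition ricci G (p : E) : 'M[R]_n := \matrix_(j, h) \sum_(i < n)
  (partial i (christoffel G i j h) p - partial j (christoffel G i i h) p
   + \sum_(l < n) (christoffel G i i l p * christoffel G l j h p
                   - christoffel G i j l p * christoffel G l i h p)).

Definition metric_norm G (p u : E) : R :=
  Num.sqrt ((u *m G p *m u^T) 0 0).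

Definition C1_curve (c : R -> E) :=
  (forall t, derivable c t 1) /\ continuous (derive1 c).

(* [curve_length G p q l]: l is the length of a piecewise C^1 curve from p to
   q, i.e. of a finite concatenation of C^1 arcs.                             *)
Inductive curve_length G : E -> E -> R -> Prop :=
| length_arc (c : R -> E) : C1_curve c ->
    curve_length G (c 0) (c 1)
      (\int[lebesgue_measure]_(t in `[0, 1]) metric_norm G (c t) (derive1 c t))
| length_cat p q q' l l' : curve_length G p q l -> curve_length G q q' l' ->
    curve_length G p q' (l + l').

Definition riemannian_dist G p q : R := inf [set l | curve_length G p q l].

Definition closed_geodesic_ball G p (r : R) : set E :=
  [set q | riemannian_dist G p q <= r].

Definition row_of_tuple (t : n.-tuple (measurableTypeR R)) : E :=
  \row_i tnth t i.

Definition volume G (A : set E) : \bar R :=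
  (\int[lebesgue_tuple R n]_(t in row_of_tuple @^-1` A)
     (Num.sqrt (\det (G (row_of_tuple t))))%:E)%E.

Definition is_volume_entropy G (Q : R) := forall p,
  ((r^-1)%:E * lne (volume G (closed_geodesic_ball G p r)))%E @[r --> +oo]
    --> Q%:E.

Definition rescale (c : R) G : E -> 'M[R]_n := fun p => c *: G p.

Definition einstein (k : R) G := forall p, ricci G p = k *: G p.

End riemannian_chart.

Record generalized_heisenberg (R : realType) (L : vectType R) := GenHeisenberg {
  gh_bracket : {bilinear L -> L -> L};
  gh_inner : {dot L for idfun};
  gh_v : {vspace L};
  gh_z : {vspace L};
  gh_J : L -> L -> L;
  gh_alternating : forall X, gh_bracket X X = 0;
  gh_jacobi : forall X Y W, gh_bracket X (gh_bracket Y W)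
    + gh_bracket Y (gh_bracket W X) + gh_bracket W (gh_bracket X Y) = 0;
  gh_nilpotent : forall X Y W, gh_bracket (gh_bracket X Y) W = 0;
  gh_nonabelian : exists X Y, gh_bracket X Y != 0;
  gh_v_neq0 : gh_v != 0%VS;
  gh_z_neq0 : gh_z != 0%VS;
  gh_sum : (gh_v + gh_z)%VS = fullv;
  gh_orthogonal : forall U Z, U \in gh_v -> Z \in gh_z -> gh_inner U Z = 0;
  gh_center : forall Z, Z \in gh_z <-> (forall X, gh_bracket Z X = 0);
  gh_bracket_vv : forall U V, U \in gh_v -> V \in gh_v ->
    gh_bracket U V \in gh_z;
  (* J is only relevant on z x v, where it is determined by the next two lines *)
  gh_J_in : forall Z U, Z \in gh_z -> U \in gh_v -> gh_J Z U \in gh_v;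
  gh_J_inner : forall Z U V, Z \in gh_z -> U \in gh_v -> V \in gh_v ->
    gh_inner (gh_J Z U) V = gh_inner Z (gh_bracket U V);
  gh_J_sqr : forall Z U, Z \in gh_z -> U \in gh_v ->
    gh_J Z (gh_J Z U) = - gh_inner Z Z *: U
}.

Section damek_ricci.
Variables (R : realType) (L : vectType R) (H : generalized_heisenberg L).

Notation br := (gh_bracket H).
Notation ip := (gh_inner H).
Notation v := (gh_v H).
Notation z := (gh_z H).

Definition proj_v (X : L) : L := daddv_pi v z X.
Definition proj_z (X : L) : L := daddv_pi z v X.

(* The Lie algebra s = n + RA; (X, t) stands for X + tA. *)
Definition solv : vectType R := (L * R^o)%type.

Definition adA (X : L) : L := 2^-1 *: proj_v X + proj_z X.

Definition solv_bracket (x y : solv) : solv :=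
  (br x.1 y.1 + x.2 *: adA y.1 - y.2 *: adA x.1, 0).

Definition solv_inner (x y : solv) : R := ip x.1 y.1 + x.2 * y.2.

(* The simply connected group S, realized on the vector space s by
   (X, t) |-> exp X exp (tA): exp X exp Y = exp (X + Y + [X, Y]/2) since n is
   2-step nilpotent, and exp (tA) acts on n by exp (t ad A).  That s is its Lie
   algebra is [lie_algebra_DR] below. *)
Definition exp_adA (t : R) (X : L) : L :=
  expR (t / 2) *: proj_v X + expR t *: proj_z X.

Definition solv_mul (x y : solv) : solv :=
  let Y := exp_adA x.2 y.1 in
  (x.1 + Y + 2^-1 *: br x.1 Y, x.2 + y.2).

Definition solv_inv (x : solv) : solv := (- exp_adA (- x.2) x.1, - x.2).

(* A basis of s adapted to s = v + z + RA, and the linear chart it defines. *)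
Definition dimS : nat := (\dim v + \dim z + 1)%N.

Definition frame : dimS.-tuple solv :=
  [tuple of [tuple of [seq (X, 0) : solv | X <- vbasis v]
                   ++ [seq (Z, 0) : solv | Z <- vbasis z]]
         ++ [:: (0, 1) : solv]].

Definition of_chart (x : 'rV[R]_dimS) : solv :=
  \sum_(i < dimS) x 0 i *: tnth frame i.

Definition to_chart (x : solv) : 'rV[R]_dimS := \row_i coord frame i x.

Definition DR_mul (x y : 'rV[R]_dimS) : 'rV[R]_dimS :=
  to_chart (solv_mul (of_chart x) (of_chart y)).

Definition DR_inv (x : 'rV[R]_dimS) : 'rV[R]_dimS :=
  to_chart (solv_inv (of_chart x)).

Definition frame_gram : 'M[R]_dimS :=
  \matrix_(i, j) solv_inner (tnth frame i) (tnth frame j).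

(* The left-invariant vector field with value x at the identity. *)
Definition left_field (x p : 'rV[R]_dimS) : 'rV[R]_dimS := 'D_x (DR_mul p) 0.

(* The left-invariant metric: the pullback at p of the inner product of
   s = T_0 S by the differential of left translation by the inverse of p.     *)
Definition DR_metric (p : 'rV[R]_dimS) : 'M[R]_dimS :=
  let J := jacobian (DR_mul (DR_inv p)) p in J *m frame_gram *m J^T.

End damek_ricci.

Arguments of_chart {R L} H x.
Arguments DR_mul {R L} H x y.
Arguments DR_inv {R L} H x.
Arguments left_field {R L} H x p.
Arguments DR_metric {R L} H p.

Section damek_ricci_theory.
Variables (R : realType) (L : vectType R) (H : generalized_heisenberg L).

Notation br := (gh_bracket H).
Notation ip := (gh_inner H).
Notation v := (gh_v H).
Notation z := (gh_z H).
Notation pv := (proj_v H).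
Notation pz := (proj_z H).
Notation exA := (exp_adA H).

Lemma gh_cap0 : (v :&: z)%VS = 0%VS.
Proof.
apply/eqP; rewrite -subv0; apply/subvP => w /memv_capP[wv wz].
rewrite memv0; apply/negPn/negP => w0.
have : 0 < ip w w by exact: neq0_dnorm_gt0.
by rewrite gh_orthogonal// ltxx.
Qed.

Lemma gh_split X : pv X + pz X = X.
Proof. by rewrite daddv_pi_add ?gh_cap0// gh_sum memvf. Qed.

Lemma pvE U Z : U \in v -> Z \in z -> pv (U + Z) = U.
Proof.
move=> Uv Zz; rewrite /proj_v linearD/= (daddv_pi_id gh_cap0 Uv).
suff -> : daddv_pi v z Z = 0 by rewrite addr0.
have := gh_split Z; rewrite /proj_v /proj_z (@daddv_pi_id _ _ z v)//; last first.
  by rewrite capvC gh_cap0.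
by move=> /(canRL (addrK _)); rewrite subrr.
Qed.

Lemma pzE U Z : U \in v -> Z \in z -> pz (U + Z) = Z.
Proof.
move=> Uv Zz; have := gh_split (U + Z); rewrite pvE//.
exact: addrI.
Qed.

Lemma pv_in X : pv X \in v. Proof. exact: memv_pi. Qed.
Lemma pz_in X : pz X \in z. Proof. exact: memv_pi. Qed.
Hint Resolve pv_in pz_in : core.

Lemma exA_in t X : exA t X = expR (t / 2) *: pv X + expR t *: pz X.
Proof. by []. Qed.

Lemma br_anti X Y : br X Y = - br Y X.
Proof.
apply/eqP; rewrite -addr_eq0; apply/eqP.
have := gh_alternating H (X + Y).
by rewrite linearDl/= !linearDr/= !gh_alternating add0r addr0.
Qed.

Lemma br_zl Z X : Z \in z -> br Z X = 0.
Proof. by move=> /gh_center. Qed.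

Lemma br_zr Z X : Z \in z -> br X Z = 0.
Proof. by move=> Zz; rewrite br_anti br_zl// oppr0. Qed.

Lemma br_pv X Y : br X Y = br (pv X) (pv Y).
Proof.
rewrite -{1}(gh_split X) -{1}(gh_split Y) linearDl/= !linearDr/=.
by rewrite (br_zl _ (pz_in X)) (br_zl _ (pz_in X)) (br_zr _ (pz_in Y)) !addr0.
Qed.

Lemma br_in X Y : br X Y \in z.
Proof. by rewrite br_pv gh_bracket_vv. Qed.

Lemma pv_exA t X : pv (exA t X) = expR (t / 2) *: pv X.
Proof. by rewrite /exp_adA pvE// memvZ. Qed.

Lemma pz_exA t X : pz (exA t X) = expR t *: pz X.
Proof. by rewrite /exp_adA pzE// memvZ. Qed.

Lemma exAD t X Y : exA t (X + Y) = exA t X + exA t Y.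
Proof. by rewrite /exp_adA /proj_v /proj_z !linearD/= addrACA. Qed.

Lemma exAZ t a X : exA t (a *: X) = a *: exA t X.
Proof.
rewrite /exp_adA /proj_v /proj_z !linearZ/= scalerDr !scalerA.
by congr (_ *: _ + _ *: _); exact: mulrC.
Qed.

Lemma exAA s t X : exA s (exA t X) = exA (s + t) X.
Proof.
by rewrite {1}/exp_adA pv_exA pz_exA !scalerA -!expRD -mulrDl.
Qed.

Lemma exA0 X : exA 0 X = X.
Proof. by rewrite /exp_adA mul0r expR0 !scale1r gh_split. Qed.

Lemma exA_br t X Y : exA t (br X Y) = br (exA t X) (exA t Y).
Proof.
have := br_in X Y => bz.
rewrite [RHS]br_pv !pv_exA linearZl_LR/= linearZr_LR/= scalerA -expRD -br_pv.
have -> : t / 2 + t / 2 = t by lra.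
have pzb : pz (br X Y) = br X Y by rewrite -{1}[br X Y]add0r pzE// mem0v.
have pvb : pv (br X Y) = 0 by rewrite -{1}[br X Y]add0r pvE// mem0v.
by rewrite /exp_adA pzb pvb scaler0 add0r.
Qed.

Lemma br_brl X Y W : br (br X Y) W = 0. Proof. exact: gh_nilpotent. Qed.
Lemma br_brr X Y W : br X (br Y W) = 0.
Proof. by rewrite br_anti br_brl oppr0. Qed.

Notation mul := (solv_mul H).
Notation inv := (solv_inv H).

Lemma solv_mulA : associative mul.
Proof.
move=> [X r] [Y s] [W t]; rewrite /solv_mul/=; congr (_, _); last exact: addrA.
rewrite exAD exAD exAZ exA_br exAA.
move: (exA r Y) (exA (r + s) W) => B C.
rewrite !(linearDl, linearDr, linearZl_LR, linearZr_LR)/= !br_brl !br_brr.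
rewrite !scaler0 !addr0 !scalerDr -!addrA.
congr (_ + (_ + _)); rewrite [RHS]addrCA; congr (_ + _).
by rewrite addrC -addrA.
Qed.

Lemma solv_mul0l : left_id 0 mul.
Proof.
move=> [X r]; rewrite /solv_mul/= exA0 linear0l/= scaler0 addr0 !add0r.
by [].
Qed.

Lemma solv_mulNl x : mul (inv x) x = 0.
Proof.
case: x => X r; rewrite /solv_mul/= addNr addNr linearNl/=.
by rewrite gh_alternating oppr0 scaler0 addr0.
Qed.

Lemma solv_mulNr x : mul x (inv x) = 0.
Proof.
case: x => X r; rewrite /solv_mul/=.
have -> : exA r (- exA (- r) X) = - X.
  by rewrite -scaleN1r exAZ exAA subrr exA0 scaleN1r.
by rewrite linearNr/= gh_alternating oppr0 scaler0 addr0 !subrr.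
Qed.

Lemma frame_basis : basis_of fullv (frame H).
Proof.
have dimL : (\dim v + \dim z)%N = dim L.
  by have := dimv_sum_cap v z; rewrite gh_cap0 dimv0 addn0 gh_sum dimvf.
rewrite basisEdim size_tuple andbC; apply/andP; split.
  by rewrite dimvf /dimS dimL.
apply/subvP => -[X t] _.
have inl (U : {vspace L}) w : w \in U ->
    {subset [seq (y, 0) : solv L | y <- vbasis U] <= frame H} ->
    ((w, 0) : solv L) \in <<frame H>>%VS.
  move=> wU sub; rewrite (coord_vbasis wU).
  have -> : (\sum_(i < \dim U) coord (vbasis U) i w *: (vbasis U)`_i, 0) =
      \sum_(i < \dim U) coord (vbasis U) i w *: (((vbasis U)`_i, 0) : solv L).
    elim/big_rec2: _ => // i y1 y2 _ <-; congr (_, _) => /=.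
    by rewrite scaler0 addr0.
  apply: memv_suml => i _; apply/memvZ/memv_span/sub/map_f.
  by rewrite mem_nth// size_tuple.
have -> : ((X, t) : solv L) = (pv X, 0) + (pz X, 0) + t *: (0, 1).
  congr (_, _) => /=; first by rewrite scaler0 addr0 gh_split.
  by rewrite !add0r; exact/esym/mulr1.
apply: memvD; [apply: memvD|].
- by apply: (inl v) => // w wv; rewrite /frame/= !mem_cat wv.
- by apply: (inl z) => // w wv; rewrite /frame/= !mem_cat wv orbT.
- by apply/memvZ/memv_span; rewrite /frame/= !mem_cat mem_seq1 eqxx !orbT.
Qed.

Lemma of_chartK : cancel (of_chart H) (to_chart H).
Proof.
move=> x; apply/rowP => j; rewrite mxE /of_chart.
under eq_bigr do rewrite (tnth_nth 0).
by rewrite coord_sum_free// (basis_free frame_basis).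
Qed.

Lemma to_chartK : cancel (to_chart H) (of_chart H).
Proof.
move=> x; rewrite [RHS](coord_basis frame_basis (memvf x)).
by apply: eq_bigr => i _; rewrite mxE (tnth_nth 0).
Qed.


Lemma DR_mulA : associative (DR_mul H).
Proof. by move=> x y w; rewrite /DR_mul !to_chartK solv_mulA. Qed.

Lemma to_chart0 : to_chart H 0 = 0.
Proof. by apply/rowP => i; rewrite !mxE linear0. Qed.

Lemma of_chart0 : of_chart H 0 = 0.
Proof. by rewrite -to_chart0 to_chartK. Qed.

Lemma DR_mul0l : left_id 0 (DR_mul H).
Proof. by move=> x; rewrite /DR_mul of_chart0 solv_mul0l of_chartK. Qed.

Lemma DR_mulNl x : DR_mul H (DR_inv H x) x = 0.
Proof. by rewrite /DR_mul !to_chartK solv_mulNl to_chart0. Qed.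

Lemma DR_mulNr x : DR_mul H x (DR_inv H x) = 0.
Proof. by rewrite /DR_mul !to_chartK solv_mulNr to_chart0. Qed.

Lemma DR_mul0r : right_id 0 (DR_mul H).
Proof. by move=> x; rewrite -(DR_mulNl x) DR_mulA DR_mulNr DR_mul0l. Qed.

Lemma to_chartD x y : to_chart H (x + y) = to_chart H x + to_chart H y.
Proof. by apply/rowP => i; rewrite !mxE linearD. Qed.

Lemma to_chartZ a x : to_chart H (a *: x) = a *: to_chart H x.
Proof. by apply/rowP => i; rewrite !mxE linearZ. Qed.

Lemma of_chartZ a x : of_chart H (a *: x) = a *: of_chart H x.
Proof. by rewrite -[x in LHS]of_chartK -to_chartZ to_chartK. Qed.

Lemma left_fieldE x p : left_field H x p =
  let P := of_chart H p in let X := of_chart H x in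
  to_chart H (exA P.2 X.1 + 2^-1 *: br P.1 (exA P.2 X.1), X.2).
Proof.
rewrite /left_field /derive.
set w := (X in _ = X).
suff E h : h != 0 -> h^-1 *: ((DR_mul H p \o shift 0) (h *: x) - DR_mul H p 0) = w.
  apply: lim_near_cst => //; near=> h; apply: E.
  by near: h; exact: nbhs_dnbhs_neq.
move=> h0; rewrite /= addr0 DR_mul0r /DR_mul of_chartZ.
rewrite -[X in _ - X](of_chartK p).
rewrite /w; case: (of_chart H p) (of_chart H x) => [P s] [X t].
rewrite -scaleN1r -to_chartZ -to_chartD -to_chartZ; congr (to_chart H _).
rewrite /solv_mul/= exAZ; move: (exA _ _) => Y; congr (_, _) => /=.
  rewrite scaleN1r linearZr_LR/= scalerA mulrC -scalerA.
  rewrite -(addrA P) -scalerDr addrAC subrr add0r scalerA.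
  by rewrite mulVf// scale1r.
rewrite scaleN1r addrAC subrr add0r.
by apply: mulKf.
Unshelve. all: by end_near. Qed.


Lemma derive_left_field x y : let X := of_chart H x in let Y := of_chart H y in
  'D_x (left_field H y) 0 =
  to_chart H (X.2 *: adA H Y.1 + 2^-1 *: br X.1 Y.1, 0).
Proof.
move=> X Y.
pose a := to_chart H (pv Y.1, 0); pose b := to_chart H (pz Y.1, 0).
pose c := to_chart H (br X.1 Y.1, 0); pose d := to_chart H (0, Y.2).
pose r : R := X.2.
pose f (h : R) := expR (h * r / 2) *: a + expR (h * r) *: b
  + (h / 2 * expR (h * r / 2)) *: c + d.
have fE h : left_field H y (h *: x) = f h.
  rewrite left_fieldE /= of_chartZ -/X -/Y /f /a /b /c /d.
  rewrite -!to_chartZ -!to_chartD; congr (to_chart H _); congr (_, _) => /=.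
    rewrite addr0 linearZl_LR/= scalerA br_pv pv_exA linearZr_LR/= scalerA -br_pv.
    by rewrite [2^-1 * h]mulrC.
  by rewrite !scaler0 !add0r.
have dZ (g : R -> R) dg (u : 'rV[R]_(dimS H)) : is_derive (0 : R) 1 g dg ->
    is_derive (0 : R) 1 (fun h => g h *: u) (dg *: u).
  move=> gd.
  have D i j : is_derive (0 : R) 1 (fun h => (g h *: u) i j) (dg * u i j).
    rewrite (_ : (fun h => _) = u i j *: g); last first.
      by apply/funext => h; rewrite mxE mulrC.
    by rewrite mulrC; exact: is_deriveZ.
  have dd : derivable (fun h => g h *: u) 0 1.
    by apply/derivable_mxP => i j; have [] := D i j.
  apply: DeriveDef => //; rewrite derive_mx//.
  by apply/matrixP => i j; rewrite !mxE; have [_ ->] := D i j.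
have eD (q : R) : is_derive (0 : R) 1 (fun h => expR (h * q)) q.
  have : is_derive (0 : R) 1 (expR \o (fun h : R => h * q)) (expR (0 * q) * q).
    apply: is_derive1_comp.
    have -> : (fun h : R => h * q) = q *: id.
      by apply/funext => h; rewrite /= mulrC.
    by rewrite -[X in is_derive _ _ _ X]mulr1; exact: is_deriveZ.
  by rewrite mul0r expR0 mul1r.
have fD : is_derive (0 : R) 1 f
    ((r / 2) *: a + r *: b + 2^-1 *: c + 0).
  have D1 : is_derive (0 : R) 1 (fun h => expR (h * r / 2)) (r / 2).
    rewrite (_ : (fun h : R => _) = fun h => expR (h * (r / 2))) //.
    by apply/funext => h; rewrite mulrA.
  have D3 : is_derive (0 : R) 1 (fun h => h / 2 * expR (h * r / 2)) 2^-1.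
    rewrite (_ : (fun h : R => _) =
      (2^-1 *: id) * (fun h => expR (h * r / 2))); last first.
      by apply/funext => h; rewrite !fctE [2^-1 *: _]mulrC.
    have D0 : is_derive (0 : R) 1 (2^-1 *: id : R -> R) (2^-1 *: 1).
      exact: is_deriveZ.
    apply: (is_derive_eq (is_deriveM D0 D1)).
    rewrite !mul0r expR0 scale1r.
    have -> : (2^-1 *: id : R -> R) 0 = 0 by exact: mulr0.
    by rewrite scale0r add0r; exact: mulr1.
  have := is_deriveD (is_deriveD (is_deriveD (dZ _ _ a D1) (dZ _ _ b (eD r)))
    (dZ _ _ c D3)) (is_derive_cst d (0 : R) 1).
  by [].
rewrite /derive.
under eq_fun => h do rewrite /= addr0 fE -(scale0r x) fE.
have [_] := fD; rewrite /derive.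
under eq_fun => h do rewrite /= addr0 [h *: 1]mulr1.
move=> ->; rewrite addr0 /a /b /c -!to_chartZ -!to_chartD; congr (to_chart H _).
rewrite /adA; congr (_, _) => /=.
  by rewrite scalerDr scalerA.
by rewrite !scaler0 !addr0.
Qed.

(* s is the Lie algebra of S: the bracket at the identity of the left-invariant
   vector fields extending x and y. *)
Lemma lie_algebra_DR x y :
  'D_x (left_field H y) 0 - 'D_y (left_field H x) 0 =
  to_chart H (solv_bracket H (of_chart H x) (of_chart H y)).
Proof.
rewrite !derive_left_field -scaleN1r -to_chartZ -to_chartD.
congr (to_chart H _); rewrite /solv_bracket; congr (_, _) => /=; last first.
  by rewrite scaler0 addr0.
rewrite [br (of_chart H y).1 _]br_anti scaleN1r scalerN.
move: (br _ _) => B.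
rewrite opprB addrA -[X in X - _]addrA -scalerDl.
have -> : 2^-1 + 2^-1 = 1 :> R by lra.
by rewrite scale1r [X in X - _]addrC.
Qed.

End damek_ricci_theory.

(* Main.v *)
Require Import Defs.
From HB Require Import structures.
From mathcomp Require Import all_boot all_order all_algebra.
From mathcomp Require Import all_classical all_reals all_analysis.
From mathcomp Require Import measurable_realfun ring lra zify.
From mathcomp.real_closed Require Import complex.
Set Implicit Arguments.
Unset Strict Implicit.
Unset Printing Implicit Defensive.
Import Order.TTheory GRing.Theory Num.Theory.
Import numFieldNormedType.Exports.
Local Open Scope classical_set_scope.
Local Open Scope ring_scope.

(* In the global chart left translations are affine, so that the Christoffel
   symbols of g are explicit, and Ric = -(k/4 + m) g; hence Ric = -(n - 1)
   for c g exactly when c = (k/4 + m) / (k + m). At height t (the coordinate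
   along A) the volume density is proportional to exp (- h t), with h = k/2 +
   m. A curve of length l in c g moves t by at most l / sqrt c, and its
   displacement in v and z is at most polynomial in l times exp (T/2), exp T,
   where T is the largest height that it reaches; as it must come back from T
   to the height of its end point, the points at height t in the ball of
   radius r lie in a box whose weighted volume is at most polynomial in r
   times exp (h r / sqrt c). Conversely this ball contains a unit box at
   height about - r / sqrt c. Hence Q = (k/2 + m) / sqrt c, and Q takes the
   value of the theorem iff (k - 2m)^2 = 0.

   If k = 2m, the operators J_Z form a Clifford system on a space of
   dimension 2m, so that 2^(m./2) divides 2m, and 4 divides 2m if m >= 2:
   only m = 1, 2, 4, 8 remain. Conversely a composition algebra of dimension
   m makes R^m + R^m a Clifford module over R^m. *)

(** * Orthonormal bases *)

(** Because left translations are affine, the coordinate derivative of the chart restricts to a flat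
    torsion-free connection on left-invariant fields, [theta]; [gamma] is its difference with the
    Levi-Civita connection. This turns the curvature at every point into algebra on s.

    No formula for the distance is available, only bounds on lengths, and these must not lose
    anything in the exponent. Write rho for the radius divided by sqrt c. Bounding the coordinates
    of a curve by its length alone would allow exp (rho / 2) in v and exp rho in z at every height,
    which is too much at the bottom of the ball, where the density is largest. A point at height t
    is instead reached below T <= (rho + t) / 2, so that v and z together contribute exp (h (rho +
    t) / 2) up to a polynomial; against the density exp (- h t) this leaves exp (h (rho - t) / 2),
    which is largest at t = - rho and equals exp (h rho) there, the rate of the lower bound.

    Balls are never shown to be measurable: integrals over them are compared with integrals over
    boxes through the definition of the integral as a supremum. *)

Section inner_product.
Variables (R : realType) (L : vectType R) (ip : {dot L for idfun}).
Implicit Types (x y : L) (a : R).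

Lemma ipC x y : ip x y = ip y x.
Proof. by rewrite hermC mul1r. Qed.

Lemma ipDl x x' y : ip (x + x') y = ip x y + ip x' y.
Proof. exact: linearDl. Qed.

Lemma ipZl a x y : ip (a *: x) y = a * ip x y.
Proof. exact: linearZl_LR. Qed.

Lemma ipDr x y y' : ip x (y + y') = ip x y + ip x y'.
Proof. exact: linearDr. Qed.

Lemma ipZr a x y : ip x (a *: y) = a * ip x y.
Proof. by rewrite ipC ipZl ipC. Qed.

Lemma ipNl x y : ip (- x) y = - ip x y.
Proof. exact: linearNl. Qed.

Lemma ipNr x y : ip x (- y) = - ip x y.
Proof. exact: linearNr. Qed.

Lemma ip0l y : ip 0 y = 0. Proof. exact: linear0l. Qed.

Lemma ip0r x : ip x 0 = 0. Proof. exact: linear0r. Qed.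

Lemma ip_suml I r (P : pred I) (F : I -> L) y :
  ip (\sum_(i <- r | P i) F i) y = \sum_(i <- r | P i) ip (F i) y.
Proof. exact: linear_sumlz. Qed.

Lemma ip_ge0 x : 0 <= ip x x.
Proof.
by have [->|/neq0_dnorm_gt0/ltW//] := eqVneq x 0; rewrite ip0l.
Qed.

Lemma ip_eq0 x : (ip x x == 0) = (x == 0).
Proof.
have [->|x0] := eqVneq x 0; first by rewrite ip0l eqxx.
by apply/negbTE; rewrite gt_eqF// neq0_dnorm_gt0.
Qed.

Definition orthonormal_fam n (e : 'I_n -> L) :=
  forall i j, ip (e i) (e j) = (i == j)%:R.

Lemma nth_mktuple0 n (e : 'I_n -> L) (i : 'I_n) : [tuple e i | i < n]`_i = e i.
Proof. by have := tnth_nth 0 [tuple e i | i < n] i; rewrite tnth_mktuple. Qed.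

Lemma orthonormal_free n (e : 'I_n -> L) :
  orthonormal_fam e -> free [tuple e i | i < n].
Proof.
move=> oe; apply/freeP => c c0 i.
have := congr1 (ip^~ (e i)) c0; rewrite /= ip_suml ip0l (bigD1 i)//=.
rewrite nth_mktuple0 ipZl oe eqxx mulr1 big1 ?addr0// => j ji.
by rewrite nth_mktuple0 ipZl oe (negbTE ji) mulr0.
Qed.

(** One step of the Gram-Schmidt process; a vector of [U] outside the span of [e] exists because
    that span has dimension at most [n]. *)
Lemma orthonormal_step (U : {vspace L}) n (e : 'I_n -> L) :
  orthonormal_fam e -> (forall i, e i \in U) -> (n < \dim U)%N ->
  exists e' : 'I_n.+1 -> L, orthonormal_fam e' /\ forall i, e' i \in U.
Proof.
move=> oe eU nU.
have : ~~ (U <= <<[tuple e i | i < n]>>)%VS.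
  apply: contraTN nU => /dimvS/leq_trans/(_ (dim_span _)).
  by rewrite size_tuple leqNgt.
move=> /subvPn[x xU xe].
pose y := x - \sum_i ip x (e i) *: e i.
have y0 : y != 0.
  apply: contraNN xe; rewrite subr_eq0 => /eqP ->.
  apply: memv_suml => i _; apply/memvZ/memv_span.
  by apply/tnthP; exists i; rewrite tnth_mktuple.
have ye i : ip y (e i) = 0.
  rewrite ipDl ipNl ip_suml (bigD1 i)//= ipZl oe eqxx mulr1 big1 ?addr0 ?subrr//.
  by move=> j ji; rewrite ipZl oe (negbTE ji) mulr0.
have yU : y \in U by rewrite rpredB// memv_suml// => i _; exact: memvZ.
pose f := (Num.sqrt (ip y y))^-1 *: y.
have fU : f \in U by exact: memvZ.
have fe i : ip f (e i) = 0 by rewrite ipZl ye mulr0.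
have ff : ip f f = 1.
  rewrite ipZl ipZr mulrA -expr2 exprVn sqr_sqrtr ?ip_ge0// mulVf//.
  by rewrite ip_eq0.
exists (fun i => if unlift ord_max i is Some j then e j else f); split.
  move=> i j; case: (unliftP ord_max i) => [i'|] ->;
    case: (unliftP ord_max j) => [j'|] ->.
  - by rewrite oe (inj_eq (@lift_inj _ _)).
  - by rewrite ipC fe eq_sym eq_liftF.
  - by rewrite fe eq_liftF.
  - by rewrite ff eqxx.
by move=> i; case: unliftP => [j|] _.
Qed.

Lemma orthonormal_basis (U : {vspace L}) :
  exists e : 'I_(\dim U) -> L, orthonormal_fam e /\ forall i, e i \in U.
Proof.
suff H n : (n <= \dim U)%N ->
    exists e : 'I_n -> L, orthonormal_fam e /\ forall i, e i \in U by exact: H.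
elim: n => [_|n IH nU]; first by exists (fun i => 0); split => -[].
have [e [oe eU]] := IH (ltnW nU).
exact: orthonormal_step oe eU nU.
Qed.

Lemma orthonormal_expand (U : {vspace L}) (e : 'I_(\dim U) -> L) x :
  orthonormal_fam e -> (forall i, e i \in U) -> x \in U ->
  x = \sum_i ip x (e i) *: e i.
Proof.
move=> oe eU xU.
have eb : basis_of U [tuple e i | i < \dim U].
  rewrite basisEfree orthonormal_free// size_tuple leqnn andbT.
  by apply/span_subvP => w /tnthP[i ->]; rewrite tnth_mktuple.
have xE := coord_basis eb xU.
rewrite {1}xE; apply: eq_bigr => i _; rewrite nth_mktuple0.
congr (_ *: _); rewrite [in RHS]xE ip_suml (bigD1 i)//= nth_mktuple0 ipZl oe.
rewrite eqxx mulr1 big1 ?addr0// => j ji.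
by rewrite nth_mktuple0 ipZl oe (negbTE ji) mulr0.
Qed.

Lemma orthonormal_parseval (U : {vspace L}) (e : 'I_(\dim U) -> L) x y :
  orthonormal_fam e -> (forall i, e i \in U) -> x \in U ->
  ip x y = \sum_i ip x (e i) * ip (e i) y.
Proof.
move=> oe eU xU; rewrite {1}(orthonormal_expand oe eU xU) ip_suml.
by apply: eq_bigr => i _; rewrite ipZl.
Qed.

(** Expanding the square of <y, y> x - <x, y> y gives <y, y> times the claim, without any
    division. *)
Lemma cauchy_schwarz x y : ip x y ^+ 2 <= ip x x * ip y y.
Proof.
have [->|y0] := eqVneq y 0; first by rewrite !ip0r mulr0 expr0n.
have y2 : 0 < ip y y by exact: neq0_dnorm_gt0.
have := ip_ge0 (ip y y *: x - ip x y *: y).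
rewrite !(ipDl, ipDr, ipNl, ipNr, ipZl, ipZr) (ipC y x).
move: (ip x x) (ip y y) (ip x y) y2 => a b c b0 H.
rewrite -(ler_pM2l b0) -subr_ge0; apply: le_trans H _.
by rewrite le_eqVlt; apply/orP; left; apply/eqP; ring.
Qed.

End inner_product.

(** * Clifford modules *)

Section anticommuting.
Variable F : fieldType.
Hypothesis two_neq0 : 2 != 0 :> F.

Section halving.
Variables (n : nat) (A B : 'M[F]_n) (l b : F).
Hypotheses (l0 : l != 0) (b0 : b != 0).
Hypotheses (AA : A *m A = (l ^+ 2)%:M) (BB : B *m B = b%:M).
Hypothesis AB : A *m B = - (B *m A).

Lemma anticomm_eigen : B *m (A - l%:M) = - ((A + l%:M) *m B).
Proof.
by rewrite mulmxBr mulmxDl AB mul_scalar_mx mul_mx_scalar opprD opprK.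
Qed.

(** [B] is invertible, since its square is a nonzero scalar, and [anticomm_eigen] makes it
    intertwine [A - l] and [- (A + l)]. *)
Lemma rank_eigen_anticomm : \rank (A - l%:M)%R = \rank (A + l%:M)%R.
Proof.
have /mulmx1_unit[Bu _] : B *m (b^-1 *: B) = 1%:M.
  by rewrite -scalemxAr BB scale_scalar_mx mulVf.
have /(congr1 mxrank) := anticomm_eigen.
rewrite mxrank_opp (mxrankMfree _ (_ : row_free B)) ?row_free_unit// => <-.
apply/eqP; rewrite eqn_leq mxrankM_maxr andbT.
by rewrite -{1}[A - _](mulKmx Bu) mxrankM_maxr.
Qed.

(** The product of [A + l] and [A - l] vanishes, so their ranks add up to at most [n]; their
    difference is the invertible scalar 2 l, so they add up to at least [n]. *)
Lemma rank_eigen_half : n = (\rank (A + l%:M)%R + \rank (A + l%:M)%R)%N.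
Proof.
apply/eqP; rewrite eqn_leq -{4}rank_eigen_anticomm mulmx0_rank_max ?andbT.
  have := mxrank_add (A + l%:M) (- (A - l%:M)).
  rewrite mxrank_opp rank_eigen_anticomm opprB [A + _]addrC addrACA subrr addr0.
  rewrite -mulr2n -scaler_nat -scalemx1 scalerA mxrank_scale_nz ?mxrank1//.
  by rewrite mulf_neq0.
rewrite mulmxBr !mulmxDl AA mul_scalar_mx mul_mx_scalar.
by rewrite mul_scalar_mx scale_scalar_mx -expr2 [X in _ - X]addrC subrr.
Qed.

End halving.

(* The operators f 0 f 1 f j for j >= 2 commute with f 0 and anticommute with one
   another: the induction hypothesis applies to their restrictions to an
   eigenspace of f 0, which has dimension n / 2 because f 1 exchanges the two. *)
Lemma pow2_dvd_anticomm (i : F) (ii : i ^+ 2 = -1) a n (f : nat -> 'M[F]_n)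
    (s : nat -> nat) :
  (forall j, (j < a.*2)%N -> f j *m f j = ((-1) ^+ s j)%:M) ->
  (forall j l, (j < l < a.*2)%N -> f j *m f l = - (f l *m f j)) ->
  (2 ^ a %| n)%N.
Proof.
have i0 : i != 0.
  by apply: contra_eq_neq ii => ->; rewrite expr0n eq_sym oppr_eq0 oner_eq0.
elim: a n f s => [|a IH] n f s ff fA; first exact: dvd1n.
have f01 := fA 0 1 isT.
(* Both signs of the squares are allowed because f 0 f 1 f j changes them: from squares -1 the next
   family has squares 1. The root [i] supplies an eigenvalue of f 0 in either case. *)
pose l := i ^+ s 0.
have lE : l ^+ 2 = (-1) ^+ s 0%N by rewrite /l exprAC ii.
have l0 : l != 0 by rewrite expf_neq0.
have AA : f 0 *m f 0 = (l ^+ 2)%:M by rewrite lE ff.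
have BB : f 1 *m f 1 = ((-1) ^+ s 1%N)%:M by rewrite ff.
rewrite (rank_eigen_half l0 _ AA BB f01) ?signr_eq0//.
rewrite addnn -muln2 expnSr dvdn_pmul2r//.
set V := f 0 + _; pose U := row_base V.
pose h j := f 0 *m f 1 *m f j.+2.
have sgn j : (j < a.*2)%N -> (j.+2 < a.+1.*2)%N by rewrite doubleS !ltnS.
have h1 j : (j < a.*2)%N -> f j.+2 *m (f 0 *m f 1) = h j.
  move=> /sgn ja; rewrite /h mulmxA -[f j.+2 *m f 0]opprK -fA// mulNmx.
  by rewrite -!mulmxA [f 1 *m _]fA ?ja// mulmxN.
have h0 j : (j < a.*2)%N -> h j *m f 0 = f 0 *m h j.
  move=> /sgn ja; rewrite /h -!mulmxA -[f j.+2 *m f 0]opprK -fA// !mulmxN.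
  by rewrite [f 1 *m (f 0 *m _)]mulmxA -[f 1 *m f 0]opprK -f01 mulNmx mulmxN opprK -mulmxA.
(* The matrix of [h j] on the eigenspace in the basis [U]; [gU] expresses stability, which holds
   because [h j] commutes with f 0. *)
pose g j := U *m h j *m pinvmx U.
have gU j : (j < a.*2)%N -> g j *m U = U *m h j.
  move=> ja; rewrite mulmxKpV// (submx_trans (submxMr _ (_ : _ <= V)%MS))//.
    by rewrite eq_row_base.
  rewrite eq_row_base mulmxDl -h0// mul_scalar_mx -mul_mx_scalar -mulmxDr.
  exact: submxMl.
have ggU j k : (j < a.*2)%N -> (k < a.*2)%N -> g j *m g k *m U = U *m (h j *m h k).
  by move=> ja ka; rewrite -mulmxA gU// mulmxA gU// mulmxA.
have hh j k : (j < a.*2)%N -> (k < a.*2)%N ->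
    h j *m h k = (- (-1) ^+ s 0%N * (-1) ^+ s 1%N) *: (f j.+2 *m f k.+2).
  move=> ja ka; rewrite -{1}h1// /h -mulmxA [X in _ *m X]mulmxA.
  have -> : f 0 *m f 1 *m (f 0 *m f 1) = (- (-1) ^+ s 0%N * (-1) ^+ s 1%N)%:M.
    rewrite -mulmxA [f 1 *m _]mulmxA -[f 1 *m f 0]opprK -f01 mulNmx -mulmxA BB.
    rewrite mulmxN mul_mx_scalar -scalemxAr AA lE scale_scalar_mx -scaleN1r.
    by rewrite scale_scalar_mx mulrA mulrC mulrA [_ * -1]mulrC mulN1r.
  by rewrite mul_scalar_mx -scalemxAr.
have Ufree : row_free U by exact: row_base_free.
apply: (IH _ g (fun j => (s 0%N + s 1%N + s j.+2).+1)).
  move=> j ja; apply: (row_free_inj Ufree).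
  rewrite ggU// hh// ff ?sgn// scale_scalar_mx mul_mx_scalar mul_scalar_mx.
  by rewrite exprS !exprD mulN1r !mulNr.
move=> j k /andP[jk ka]; have ja := ltn_trans jk ka.
apply: (row_free_inj Ufree).
rewrite mulNmx !ggU// !hh// fA ?sgn ?andbT ?ltnS//.
by rewrite scalerN mulmxN.
Qed.
End anticommuting.

Section quaternionic.
Variables (R : realType) (n : nat) (A B : 'M[R]_n).
Hypotheses (AA : A *m A = - 1%:M) (BB : B *m B = - 1%:M).
Hypothesis AB : A *m B = - (B *m A).

(* The eigenspace of A for -i over the complex numbers has dimension n / 2 and
   carries the antilinear map u |-> conj(u) B of square -1, hence a matrix M
   with M conj(M) = -1; taking determinants, its dimension is even. *)
Lemma quaternionic_dim : (4 %| n)%N.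
Proof.
pose toC := map_mx (real_complex R).
pose cj p q (M : 'M[R[i]]_(p, q)) := map_mx conjc M.
have cjK p q (M : 'M[R[i]]_(p, q)) : cj _ _ (cj _ _ M) = M.
  by apply/matrixP => i j; rewrite !mxE conjcK.
have cjC p q (M : 'M[R]_(p, q)) : cj _ _ (toC _ _ M) = toC _ _ M.
  by apply/matrixP => i j; rewrite !mxE /= oppr0.
have two0 : 2 != 0 :> R[i] by rewrite pnatr_eq0.
have i0 : 'i%C != 0 :> R[i] by rewrite eq_complex/= oner_eq0 andbF.
have ii : 'i%C ^+ 2 = -1 :> R[i] by rewrite sqr_i.
have CC M : M *m M = - 1%:M -> toC n n M *m toC n n M = (-1)%:M.
  by move=> MM; rewrite -map_mxM MM map_mxN map_mx1 -scaleN1r scale_scalar_mx mulr1.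
have CAB : toC _ _ A *m toC _ _ B = - (toC _ _ B *m toC _ _ A).
  by rewrite -!map_mxM AB map_mxN.
pose V := toC _ _ A + ('i%C)%:M.
pose U := row_base V; pose U' := cj _ _ U.
have nr : n = (\rank V + \rank V)%N.
  apply: rank_eigen_half CAB => //; last exact: CC.
    by rewrite ?oppr_eq0 ?oner_neq0.
  by rewrite ii CC.
have Ufree : row_free U by exact: row_base_free.
have U'free : row_free U' by rewrite row_free_map.
have cjV : cj _ _ V = toC _ _ A - ('i%C)%:M.
  rewrite /cj map_mxD -/(cj _ _ _) cjC; congr (_ + _).
  by rewrite map_scalar_mx -scaleN1r scale_scalar_mx; congr _%:M; apply/eqP;
  rewrite eq_complex /= ?(mul0r, mul1r, mulr0, mulr1, mulN1r, oppr0, subr0, addr0, add0r) !eqxx.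
(* Conjugation maps the row space of A + i to that of A - i, and B maps it back because it
   anticommutes with A. *)
have U'V : (U' *m toC _ _ B <= U)%MS.
  rewrite eq_row_base.
  have : (U' <= cj _ _ V)%MS by rewrite map_submx eq_row_base.
  move=> /submxMr-/(_ _ (toC _ _ B))/submx_trans; apply.
  rewrite cjV (_ : _ *m _ = (- toC _ _ B) *m V) ?submxMl//.
  by rewrite mulmxBl CAB mulNmx mulmxDr opprD mul_scalar_mx mul_mx_scalar.
have [M UM] := submxP U'V.
have MM : M *m cj _ _ M = - 1%:M.
  apply: (row_free_inj U'free).
  have := congr1 (cj _ _) UM.
  rewrite /cj (map_mxM _ U') (map_mxM _ M) -!/(cj _ _ _) cjK cjC -/U' => UM'.
  rewrite /= -mulmxA -/U' -UM' mulmxA -UM -mulmxA /toC -map_mxM BB.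
  by rewrite map_mxN map_mx1 mulmxN mulmx1 mulNmx mul1mx.
have dM : \det M * conjc (\det M) = (-1) ^+ \rank V.
  by rewrite -det_map_mx -det_mulmx MM -scaleN1r detZ det1 mulr1.
suff r2 : ~~ odd (\rank V).
  by rewrite [X in (_ %| X)%N]nr addnn -muln2 (_ : 4 = 2 * 2)%N// dvdn_pmul2r// dvdn2.
apply/negP => rodd; move: dM.
rewrite -signr_odd rodd expr1 => /eqP.
case: (\det M) => a b; rewrite eq_complex /= => /andP[/eqP H _].
have : 0 <= a ^+ 2 + b ^+ 2 by rewrite addr_ge0 ?sqr_ge0.
move: H; lra.
Qed.

End quaternionic.

Section clifford_dimension.
Variables (R : realType) (m n : nat) (f : nat -> 'M[R]_n).
Hypothesis nE : n = (2 * m)%N.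
Hypothesis f_sqr : forall j, (j < m)%N -> f j *m f j = - 1%:M.
Hypothesis f_anticomm :
  forall j l, (j < l < m)%N -> f j *m f l = - (f l *m f j).

Lemma clifford_half_dim : (2 ^ m./2 %| n)%N.
Proof.
have le : ((m./2).*2 <= m)%N by rewrite -[leqRHS](odd_double_half m) leq_addl.
have two0 : 2 != 0 :> R[i] by rewrite pnatr_eq0.
pose C := map_mx (real_complex R).
apply: (pow2_dvd_anticomm two0 (sqr_i R) (f := fun j => C _ _ (f j))
  (s := fun=> 1%N)) => [j jm|j l /andP[jl lm]].
  rewrite -map_mxM f_sqr ?(leq_trans jm)// map_mxN map_mx1.
  by rewrite expr1 -scaleN1r scale_scalar_mx mulr1.
by rewrite -!map_mxM f_anticomm ?map_mxN// jl (leq_trans lm).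
Qed.

(** For odd m, divisibility of 2m by 2^(m./2) leaves 1 and 3, and divisibility by 4 excludes 3. For
    m = 2a it reads 2^a | 4a, which fails at a = 3 and, since 4a < 2^a, for all a >= 5. *)
Lemma clifford_dim_double : (0 < m)%N -> m \in [:: 1; 2; 4; 8]%N.
Proof.
move=> m0; have := clifford_half_dim.
have [m2|] := ltnP 1 m; last by case: m m0 => [|[|]].
have : (4 %| n)%N.
  apply: (quaternionic_dim (A := f 0) (B := f 1)).
  - by apply: f_sqr; exact: ltnW.
  - exact: f_sqr.
  - by apply: f_anticomm.
rewrite nE (_ : 4 = 2 * 2)%N// dvdn_pmul2l// => /dvdnP[a mE]; move: m0 m2.
rewrite mE muln2 doubleK -mul2n mulnA; case: a {mE} => [|[|[|[|[|a]]]]]//= _ _.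
have -> : a.+4.+1 = (a + 5)%N by lia.
have lt : (2 * 2 * (a + 5) < 2 ^ (a + 5))%N.
  elim: a => // a IH; rewrite addSn expnS; move: (2 ^ _)%N IH => t; lia.
by move=> /dvdn_leq le; move: lt; rewrite ltnNge le// muln_gt0 addnS.
Qed.
End clifford_dimension.

(** * The Clifford module of a generalized Heisenberg algebra *)

Section heisenberg_type.
Variables (R : realType) (L : vectType R) (H : generalized_heisenberg L).

Notation ip := (gh_inner H).
Notation v := (gh_v H).
Notation z := (gh_z H).
Notation J := (gh_J H).

Lemma J_skew Z U V : Z \in z -> U \in v -> V \in v ->
  ip (J Z U) V = - ip U (J Z V).
Proof.
move=> Zz Uv Vv; rewrite (gh_J_inner Zz)// br_anti ipNr -(gh_J_inner Zz)//.
by rewrite ipC.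
Qed.

Lemma J_norm Z U V : Z \in z -> U \in v -> V \in v ->
  ip (J Z U) (J Z V) = ip Z Z * ip U V.
Proof.
move=> Zz Uv Vv; rewrite J_skew ?gh_J_in// gh_J_sqr// ipZr.
by rewrite mulNr opprK.
Qed.

(** Polarization of [J_norm] in [Z]. As [gh_J] is a bare function, its additivity in [Z] must first
    be derived from [gh_J_inner]. *)
Lemma J_polar Z W U V : Z \in z -> W \in z -> U \in v -> V \in v ->
  ip (J Z U) (J W V) + ip (J W U) (J Z V) = 2 * ip Z W * ip U V.
Proof.
move=> Zz Wz Uv Vv.
have ZWz : Z + W \in z by exact: rpredD.
have JD X : X \in v -> J (Z + W) X = J Z X + J W X.
  move=> Xv; apply/eqP; rewrite -subr_eq0 -(ip_eq0 ip).
  set Y := _ - _; have Yv : Y \in v by rewrite rpredB ?rpredD// gh_J_in.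
  rewrite {1}/Y ipDl ipNl ipDl !gh_J_inner// -ipDl.
  by rewrite subrr.
have := J_norm ZWz Uv Vv.
rewrite !JD// !(ipDl, ipDr) (ipC ip W Z).
have := J_norm Zz Uv Vv; have := J_norm Wz Uv Vv => -> ->.
lra.
Qed.

Lemma J_ip_orthogonal Z U : Z \in z -> U \in v -> ip U (J Z U) = 0.
Proof.
by move=> Zz Uv; have := J_skew Zz Uv Uv; rewrite (ipC _ (J _ _)) => h; lra.
Qed.

Lemma J_polarl Z W U : Z \in z -> W \in z -> U \in v ->
  ip (J Z U) (J W U) = ip Z W * ip U U.
Proof.
by move=> Zz Wz Uv; have := J_polar Zz Wz Uv Uv; rewrite (ipC _ (J W U)); lra.
Qed.

Lemma dim_z_gt0 : (0 < \dim z)%N.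
Proof. by rewrite lt0n dimv_eq0 gh_z_neq0. Qed.

Theorem heisenberg_double_dim : \dim v = (2 * \dim z)%N ->
  \dim z \in [:: 1; 2; 4; 8]%N.
Proof.
have [e [oe ez]] := orthonormal_basis ip z.
have [u [ou uv]] := orthonormal_basis ip v.
move=> kE.
(* [clifford_dim_double] takes a family indexed by nat; 0 fills it beyond the dimension of z. *)
pose E i := if insub i is Some j then e j else 0.
have EE (i : 'I_(\dim z)) : E i = e i by rewrite /E valK.
pose f b : 'M[R]_(\dim v) := \matrix_(i, j) ip (J (E b) (u i)) (u j).
(* Parseval and skewness of J; with this formula [J_norm] and [J_polar] become the Clifford
   relations. *)
have ff (b c : 'I_(\dim z)) i j : (f b *m f c) i j = - ip (J (e b) (u i)) (J (e c) (u j)).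
  rewrite mxE (orthonormal_parseval _ ou uv) ?gh_J_in// -sumrN.
  by apply: eq_bigr => l _; rewrite !mxE !EE (J_skew (Z := e c))// mulrN.
apply: (clifford_dim_double (f := f) kE); last exact: dim_z_gt0.
  move=> j jm; apply/matrixP => a b; have := ff (Ordinal jm) (Ordinal jm) a b.
  by move=> ->; rewrite J_norm// oe ou eqxx mul1r !mxE.
move=> j l /andP[jl lm]; have jm := ltn_trans jl lm.
apply/matrixP => a b; rewrite (ff (Ordinal jm) (Ordinal lm)) mxE.
rewrite (ff (Ordinal lm) (Ordinal jm)) opprK.
have := J_polar (ez (Ordinal jm)) (ez (Ordinal lm)) (uv a) (uv b).
rewrite oe (_ : _ == _ = false); last by apply/negbTE; rewrite -val_eqE/= ltn_eqF.
by rewrite mulr0 mul0r => h; lra.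
Qed.

End heisenberg_type.

(** * Composition algebras *)

Section row_dot.
Variables (R : realType) (m : nat).
Implicit Types (x y : 'rV[R]_m) (a : R).

Definition rdot x y : R := (x *m y^T) 0 0.

Lemma rdotE x y : rdot x y = \sum_i x 0 i * y 0 i.
Proof. by rewrite /rdot mxE; apply: eq_bigr => i _; rewrite mxE. Qed.

Lemma rdotC x y : rdot x y = rdot y x.
Proof. by rewrite !rdotE; apply: eq_bigr => i _; rewrite mulrC. Qed.

Lemma rdotDl x x' y : rdot (x + x') y = rdot x y + rdot x' y.
Proof. by rewrite /rdot mulmxDl mxE. Qed.

Lemma rdotZl a x y : rdot (a *: x) y = a * rdot x y.
Proof. by rewrite /rdot -scalemxAl mxE. Qed.

Lemma rdotDr x y y' : rdot x (y + y') = rdot x y + rdot x y'.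
Proof. by rewrite rdotC rdotDl !(rdotC x). Qed.

Lemma rdotZr a x y : rdot x (a *: y) = a * rdot x y.
Proof. by rewrite rdotC rdotZl rdotC. Qed.

Lemma rdot_mull (M : 'M[R]_m) x y : rdot (x *m M) y = rdot x (y *m M^T).
Proof. by rewrite /rdot trmx_mul trmxK mulmxA. Qed.

Lemma rdot_ge0 x : 0 <= rdot x x.
Proof. by rewrite rdotE sumr_ge0// => i _; rewrite -expr2 sqr_ge0. Qed.

Lemma rdot_gt0 x : x != 0 -> 0 < rdot x x.
Proof.
move=> x0; rewrite lt_neqAle rdot_ge0 andbT eq_sym; apply: contraNN x0.
rewrite rdotE psumr_eq0; last by move=> i _; rewrite -expr2 sqr_ge0.
move=> /allP h; apply/eqP/rowP => i; rewrite mxE.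
by have := h i (mem_index_enum i); rewrite /= -expr2 sqrf_eq0 => /eqP.
Qed.

Lemma rdotNl x y : rdot (- x) y = - rdot x y.
Proof. by rewrite -scaleN1r rdotZl mulN1r. Qed.

Lemma rdot0l y : rdot 0 y = 0. Proof. by rewrite /rdot mul0mx mxE. Qed.

End row_dot.

(** * Generalized Heisenberg algebras from normed bilinear products *)

Section heisenberg_of_composition.
Variables (R : realType) (m : nat).
Notation rV := 'rV[R]_m.+1.
Variable F : {linear rV -> 'M[R]_m.+1}.
Hypothesis F_norm : forall Z, F Z *m (F Z)^T = (rdot Z Z)%:M.

Let F_norm' Z : (F Z)^T *m F Z = (rdot Z Z)%:M.
Proof.
have [->|Z0] := eqVneq Z 0; first by rewrite linear0 mulmx0 rdot0l raddf0.
have d0 : rdot Z Z != 0 by rewrite gt_eqF// rdot_gt0.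
have : F Z *m ((rdot Z Z)^-1 *: (F Z)^T) = 1%:M.
  by rewrite -scalemxAr F_norm scale_scalar_mx mulVf.
move=> /mulmx1C; rewrite -scalemxAl => /(congr1 (fun M => rdot Z Z *: M)).
by rewrite scalerA divff// scale1r scale_scalar_mx mulr1.
Qed.

Definition comp_space : vectType R := (rV * rV * rV)%type.
Implicit Types p q : comp_space.

Definition comp_form p q : R := rdot p.1.1 q.1.1 + rdot p.1.2 q.1.2 + rdot p.2 q.2.

(** Dictated by [comp_J]: its component along e_i is the inner product of J_(e_i) p with q. *)
Definition comp_bracket p q : comp_space := (0, 0,
  \row_i (rdot (p.1.1 *m F 'e_i) q.1.2 - rdot (q.1.1 *m F 'e_i) p.1.2)).

(** On R^m + R^m this is the block matrix with F and - F^T off the diagonal, whose square is - F F^T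
    and - F^T F, that is - <Z, Z>. *)
Definition comp_J p q : comp_space :=
  (- (q.1.2 *m (F p.2)^T), q.1.1 *m F p.2, 0).

Lemma comp_formC p q : comp_form p q = comp_form q p.
Proof. by rewrite /comp_form !(rdotC q.1.1, rdotC q.1.2, rdotC q.2). Qed.

Lemma comp_form_hermitian p q : comp_form p q = (-1) ^+ false * idfun (comp_form q p).
Proof. by rewrite expr0 mul1r comp_formC. Qed.

Lemma comp_form_bilinear : bilinear_for
  (GRing.Scale.Law.clone _ _ ( *%R ) _) (GRing.Scale.Law.clone _ _ (idfun \; *%R ) _)
  (comp_form : comp_space -> comp_space -> R).
Proof.
split=> [p|p] a x y /=; rewrite /comp_form /= !(rdotDl, rdotDr, rdotZl, rdotZr).
  by ring.
by ring.
Qed.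

HB.instance Definition _ := bilinear_isBilinear.Build R comp_space comp_space R _ _
  comp_form comp_form_bilinear.
HB.instance Definition _ := isHermitianSesquilinear.Build R comp_space false idfun
  comp_form comp_form_hermitian.

Lemma comp_form_gt0 p : p != 0 -> 0 < comp_form p p.
Proof.
move=> p0; have p1 := rdot_ge0 p.1.1; have p2 := rdot_ge0 p.1.2; have p3 := rdot_ge0 p.2.
rewrite lt_neqAle eq_sym !addr_ge0// andbT; apply: contraNN p0.
have z (x : rV) : rdot x x = 0 -> x = 0.
  by move=> h; apply/eqP; apply: contra_eqT h => /rdot_gt0; rewrite lt0r => /andP[].
rewrite /comp_form => /eqP h; apply/eqP; case: p p1 p2 p3 h => -[a b] c /= p1 p2 p3 h.
by congr (_, _, _); apply: z; lra.
Qed.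

HB.instance Definition _ := isDotProduct.Build R comp_space comp_form comp_form_gt0.

Lemma comp_bracket_bilinear : bilinear_for
  (GRing.Scale.Law.clone _ _ *:%R _) (GRing.Scale.Law.clone _ _ *:%R _)
  (comp_bracket : comp_space -> comp_space -> comp_space).
Proof.
split=> [p|p] a x y /=; rewrite /comp_bracket; congr (_, _, _) => /=;
  rewrite ?scaler0 ?addr0//; apply/rowP => i; rewrite !mxE /= 
    !(mulmxDl, rdotDl, rdotDr, rdotZl, rdotZr, =^~ scalemxAl); ring.
Qed.

HB.instance Definition _ := bilinear_isBilinear.Build R comp_space comp_space comp_space
  _ _ comp_bracket comp_bracket_bilinear.

Definition comp_inv (u : (rV * rV)%type) : comp_space := (u, 0).
Definition comp_inz (u : rV) : comp_space := (0, u).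

Lemma comp_inv_linear : linear comp_inv.
Proof. by move=> a x y; congr (_, _); rewrite /= scaler0 addr0. Qed.

Lemma comp_inz_linear : linear comp_inz.
Proof. by move=> a x y; congr (_, _) => /=; rewrite scaler0 addr0. Qed.

HB.instance Definition _ := GRing.isLinear.Build R _ _ _ comp_inv comp_inv_linear.
HB.instance Definition _ := GRing.isLinear.Build R _ _ _ comp_inz comp_inz_linear.

Definition comp_v : {vspace comp_space} := limg (linfun comp_inv).
Definition comp_z : {vspace comp_space} := limg (linfun comp_inz).

Lemma mem_comp_v p : p \in comp_v <-> p.2 = 0.
Proof.
split=> [/memv_imgP[u _ ->]|p0]; first by rewrite lfunE.
apply/memv_imgP; exists p.1; rewrite ?memvf// lfunE/= /comp_inv -p0.
by case: p {p0}.
Qed.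

Lemma mem_comp_z p : p \in comp_z <-> p.1 = 0.
Proof.
split=> [/memv_imgP[u _ ->]|p0]; first by rewrite lfunE.
apply/memv_imgP; exists p.2; rewrite ?memvf// lfunE/= /comp_inz -p0.
by case: p {p0}.
Qed.

Lemma dim_comp_v : \dim comp_v = (2 * m.+1)%N.
Proof.
rewrite limg_dim_eq; first rewrite dimvf.
  change (1 * m.+1 + 1 * m.+1 = 2 * m.+1)%N; by rewrite !mul1n mul2n addnn.
apply/eqP; rewrite capfv; apply/lker0P => x y; rewrite !lfunE.
by move=> /(congr1 fst).
Qed.

Lemma dim_comp_z : \dim comp_z = m.+1.
Proof.
rewrite limg_dim_eq; first by rewrite dimvf; change (1 * m.+1 = m.+1)%N; rewrite mul1n.
by apply/eqP; rewrite capfv; apply/lker0P => x y; rewrite !lfunE => /(congr1 snd).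
Qed.

Lemma comp_form_bracket Z p q :
  rdot Z (comp_bracket p q).2 = rdot (p.1.1 *m F Z) q.1.2 - rdot (q.1.1 *m F Z) p.1.2.
Proof.
have sumF (x y : rV) : rdot (x *m F Z) y = \sum_i Z 0 i * rdot (x *m F 'e_i) y.
  rewrite {1}[Z]row_sum_delta linear_sum mulmx_sumr /rdot mulmx_suml summxE.
  by apply: eq_bigr => i _; rewrite linearZ /= -scalemxAr -scalemxAl !mxE.
rewrite !sumF -sumrB rdotE; apply: eq_bigr => i _.
by rewrite mxE mulrBr.
Qed.

Lemma comp_J_sqr Z U : Z \in comp_z -> U \in comp_v ->
  comp_J Z (comp_J Z U) = - comp_form Z Z *: U.
Proof.
move=> /mem_comp_z Z0 /mem_comp_v U0.
rewrite /comp_J /comp_form Z0 /= rdot0l !add0r -!mulmxA F_norm.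
case: U U0 => -[x y] w /= ->.
by congr (_, _, _) => /=; rewrite ?scaler0// ?mulNmx -?mulmxA ?F_norm' ?F_norm
  mul_mx_scalar scaleNr.
Qed.

(** Closed with [Defined]: its subspaces must reduce to [comp_v] and [comp_z] for the dimension
    count. *)
Definition comp_heisenberg : generalized_heisenberg comp_space.
Proof.
apply: (@GenHeisenberg R comp_space comp_bracket comp_form comp_v comp_z comp_J).
- move=> [[x y] w]; rewrite /comp_bracket; congr (_, _, _); apply/rowP => i.
  by rewrite !mxE /= subrr.
- move=> p q w; have b0 (a b c : comp_space) : comp_bracket a (comp_bracket b c) = 0.
    rewrite /comp_bracket; congr (_, _, _); apply/rowP => i; rewrite !mxE /=.
    by rewrite mul0mx rdotC !rdot0l subrr.
  by rewrite /= !b0 !addr0.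
- move=> p q w; rewrite /comp_bracket; congr (_, _, _); apply/rowP => i; rewrite !mxE /=.
  by rewrite mul0mx rdot0l rdotC rdot0l subrr.
(* The coordinate 0 of this bracket is the squared norm of e_0 F(e_0), which is <e_0, e_0>^2. *)
- exists (('e_0, 0), 0), ((0, 'e_0 *m F 'e_0), 0); apply/eqP => /(congr1 snd)/rowP/(_ 0).
  rewrite !mxE /= mul0mx rdot0l subr0 rdot_mull -mulmxA F_norm mul_mx_scalar rdotZr.
  have : 0 < rdot ('e_0 : rV) 'e_0.
    rewrite rdot_gt0//; apply/eqP => /rowP/(_ 0); rewrite !mxE eqxx/= => /eqP.
    by rewrite oner_eq0.
  by move=> d; have := mulr_gt0 d d => + h; rewrite h ltxx.
- by rewrite -dimv_eq0 dim_comp_v.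
- by rewrite -dimv_eq0 dim_comp_z.
- apply/eqP; rewrite eqEsubv subvf; apply/subvP => -[p w] _.
  have -> : ((p, w) : comp_space) = (p, 0) + (0, w).
    by congr (_, _); rewrite /= ?addr0 ?add0r.
  by apply: memv_add; [apply/mem_comp_v|apply/mem_comp_z].
- move=> U Z /mem_comp_v U0 /mem_comp_z Z0.
  by rewrite /= /comp_form U0 Z0 /= rdot0l rdotC rdot0l rdotC rdot0l !addr0.
- move=> Z; split.
    move=> /mem_comp_z Z0 X; rewrite /= /comp_bracket Z0 /=; congr (_, _, _).
    by apply/rowP => i; rewrite !mxE mul0mx rdot0l rdotC rdot0l subrr.
  move=> h; apply/mem_comp_z.
  (* Bracketing a central element (x, y, w) with its own image under J_(e_0) gives <e_0, e_0> (|x|^2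
     + |y|^2) = 0 along e_0. *)
  pose W : comp_space := (0, 'e_0).
  have := h (comp_J W Z) => /(congr1 snd)/(congr1 (rdot 'e_0)).
  rewrite comp_form_bracket /= [RHS]rdotC rdot0l !mulNmx !rdotNl opprK.
  rewrite -mulmxA F_norm' !rdot_mull -mulmxA F_norm
    !mul_mx_scalar !rdotZr tr_scalar_mx mul_mx_scalar rdotZr.
  have e0 : 0 < rdot ('e_0 : rV) 'e_0.
    rewrite rdot_gt0//; apply/eqP => /rowP/(_ 0); rewrite !mxE eqxx/= => /eqP.
    by rewrite oner_eq0.
  rewrite -mulrDr => /eqP; rewrite mulf_eq0 gt_eqF//=.
  rewrite paddr_eq0 ?rdot_ge0// => /andP[x0 y0].
  have z (x : rV) : rdot x x == 0 -> x = 0.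
    by move=> /eqP h'; apply/eqP; apply: contra_eqT h' => /rdot_gt0; rewrite lt0r => /andP[].
  by rewrite [LHS]surjective_pairing (z _ x0) (z _ y0).
- by move=> U V _ _; apply/mem_comp_z.
- by move=> Z U _ _; apply/mem_comp_v.
- move=> Z U V /mem_comp_z Z0 /mem_comp_v U0 /mem_comp_v V0.
  rewrite /= {1 2}/comp_form Z0 V0 /= !rdot0l !add0r addr0 comp_form_bracket.
  by rewrite rdotNl addrC (rdot_mull (F Z.2)^T) trmxK (rdotC U.1.2).
- exact: comp_J_sqr.
Defined.

End heisenberg_of_composition.

(* The octonions as a twisted group algebra of (Z/2)^3: e_i e_j is the basis
   element of index i xor j, with the sign (-1)^(cd_sign i j) given by the
   Cayley-Dickson construction.  The first 1, 2, 4 basis elements span the real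
   numbers, the complex numbers and the quaternions. *)
Definition cd_sign (i j : nat) : bool :=
  nth 0%N (nth [::]
   [:: [:: 0; 0; 0; 0; 0; 0; 0; 0];
       [:: 0; 1; 0; 1; 0; 1; 1; 0];
       [:: 0; 1; 1; 0; 0; 0; 1; 1];
       [:: 0; 0; 1; 1; 0; 1; 0; 1];
       [:: 0; 1; 1; 1; 1; 0; 0; 0];
       [:: 0; 0; 1; 0; 1; 1; 1; 0];
       [:: 0; 0; 0; 1; 1; 0; 1; 1];
       [:: 0; 1; 0; 0; 1; 1; 0; 1]] i)%N j == 1%N.

Definition cd_index (i j : nat) : nat :=
  nth 0%N (nth [::]
   [:: [:: 0; 1; 2; 3; 4; 5; 6; 7];
       [:: 1; 0; 3; 2; 5; 4; 7; 6];
       [:: 2; 3; 0; 1; 6; 7; 4; 5];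
       [:: 3; 2; 1; 0; 7; 6; 5; 4];
       [:: 4; 5; 6; 7; 0; 1; 2; 3];
       [:: 5; 4; 7; 6; 1; 0; 3; 2];
       [:: 6; 7; 4; 5; 2; 3; 0; 1];
       [:: 7; 6; 5; 4; 3; 2; 1; 0]] i)%N j.

(** The identity F F^T = |Z|^2 on basis elements. In the entry (a, b), the coefficient of Z_i Z_j
    for i != j is a sum of two terms: they must occur together and with opposite signs. For i = j a
    term occurs only if a = b. The products must also stay among the first m elements. *)
Definition cd_normed (m : nat) : bool :=
  let r := iota 0 m in
  all (fun i => all (fun a => (cd_index i a < m)%N && all (fun j => all (fun b =>
    [&& (cd_index i a == cd_index j b) == (cd_index j a == cd_index i b),
        (cd_index i a == cd_index i b) == (a == b) &
        (i != j) && (cd_index i a == cd_index j b) ==>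
          (cd_sign i a (+) cd_sign j b (+) cd_sign j a (+) cd_sign i b)])
    r) r) r) r.

Section composition_algebra.
Variables (R : realType) (m : nat).
Hypothesis normed : cd_normed m.+1.
Notation rV := 'rV[R]_m.+1.

Definition cd_left (Z : rV) : 'M[R]_m.+1 := \matrix_(a, c)
  \sum_i Z 0 i * (if c == cd_index i a :> nat then (-1) ^+ cd_sign i a else 0).

Lemma cd_left_linear : linear cd_left.
Proof.
move=> t x y; apply/matrixP => a c; rewrite !mxE mulr_sumr -big_split /=.
by apply: eq_bigr => i _; rewrite !mxE mulrDl mulrA.
Qed.

HB.instance Definition _ := GRing.isLinear.Build R _ _ _ cd_left cd_left_linear.

Lemma cd_left_norm Z : cd_left Z *m (cd_left Z)^T = (rdot Z Z)%:M.
Proof.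
have P (i a j b : 'I_m.+1) : [&& (cd_index i a < m.+1)%N,
    (cd_index i a == cd_index j b) == (cd_index j a == cd_index i b),
    (cd_index i a == cd_index i b) == (a == b) &
    (i != j) && (cd_index i a == cd_index j b) ==>
      (cd_sign i a (+) cd_sign j b (+) cd_sign j a (+) cd_sign i b)].
  have ir (k : 'I_m.+1) : (k : nat) \in iota 0 m.+1 by rewrite mem_iota/=.
  have /allP Qi := normed; have /allP Qa := Qi _ (ir i).
  have /andP[-> /allP Qj] := Qa _ (ir a); have /allP Qb := Qj _ (ir j).
  exact: Qb _ (ir b).
apply/matrixP => a b; rewrite !mxE.
pose e (i x c : 'I_m.+1) : R :=
  if c == cd_index i x :> nat then (-1) ^+ cd_sign i x else 0.
pose t (i j : 'I_m.+1) := \sum_c e i a c * e j b c.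
have tE i j : t i j = if cd_index i a == cd_index j b
    then (-1) ^+ (cd_sign i a (+) cd_sign j b) else 0.
  have /and4P[lt _ _ _] := P i a j b.
  rewrite /t (bigD1 (Ordinal lt))//= big1 ?addr0 => [|c /negbTE cN]; last first.
    by rewrite /e -val_eqE/= in cN *; rewrite cN mul0r.
  by rewrite /e eqxx/=; case: eqP => _; rewrite ?mulr0// signr_addb.
have tt i j : t i j + t j i = 2 * (i == j)%:R * (a == b)%:R.
  rewrite !tE; have /and4P[_ /eqP E1 /eqP E2 E3] := P i a j b.
  have [ij|ij] := eqVneq i j.
    rewrite -ij E2; have [->|_] := eqVneq a b; last by rewrite mulr0 addr0.
    by rewrite addbb expr0 !mulr1.
  rewrite mulr0 mul0r -E1; move: E3; rewrite ij/=.
  case: ifP => [_|_ _]; last by rewrite addr0.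
  by rewrite implyTb; case: cd_sign; case: cd_sign; case: cd_sign; case: cd_sign => //= _;
    rewrite ?expr0 ?expr1 ?subrr// addrC subrr.
pose s := \sum_i \sum_j Z 0 i * Z 0 j * t i j.
have -> : \sum_j cd_left Z a j * (cd_left Z)^T j b = s.
  rewrite /s; under eq_bigr => c _ do rewrite !mxE mulr_suml.
  rewrite exchange_big; apply: eq_bigr => i _.
  under eq_bigr => c _ do rewrite mulr_sumr.
  rewrite exchange_big; apply: eq_bigr => j _.
  by rewrite /t mulr_sumr; apply: eq_bigr => c _; rewrite mulrACA.
(* Only the sums t i j + t j i are known, so the double sum is added to its transpose. *)
have ss : s + s = 2 * (rdot Z Z * (a == b)%:R).
  rewrite {2}/s exchange_big -big_split rdotE mulr_suml mulr_sumr.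
  apply: eq_bigr => i _; rewrite -big_split (bigD1 i)//= big1 ?addr0.
    have := tt i i; rewrite eqxx mulr1 => h.
    by rewrite -mulrDr h; ring.
  move=> j /negbTE ji; rewrite [Z 0 j * _]mulrC -mulrDr tt eq_sym ji.
  by rewrite mulr0 mul0r mulr0.
rewrite -mulr_natr; lra.
Qed.

End composition_algebra.

Theorem heisenberg_double_exists (R : realType) m : m \in [:: 1; 2; 4; 8]%N ->
  exists (L : vectType R) (H : generalized_heisenberg L),
    \dim (gh_z H) = m /\ \dim (gh_v H) = (2 * m)%N.
Proof.
move=> mm; have : cd_normed m.
  by move: mm; rewrite !inE => /or4P[] /eqP ->; vm_compute.
have : (0 < m)%N by move: mm; rewrite !inE => /or4P[] /eqP ->.
case: m {mm} => // m _ nm.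
exists (comp_space R m), (comp_heisenberg (@cd_left_norm R m nm)).
by split; [exact: dim_comp_z|exact: dim_comp_v].
Qed.

(** * The Levi-Civita connection of a left-invariant metric *)

Section levi_civita.
Variables (R : realType) (L : vectType R) (H : generalized_heisenberg L).

Notation br := (gh_bracket H).
Notation ip := (gh_inner H).
Notation v := (gh_v H).
Notation z := (gh_z H).
Notation J := (gh_J H).
Notation pv := (proj_v H).
Notation pz := (proj_z H).
Notation S := (solv L).
Notation si := (solv_inner H).
Hint Extern 0 (is_true (proj_v _ _ \in _)) => apply: pv_in : core.
Hint Extern 0 (is_true (proj_z _ _ \in _)) => apply: pz_in : core.
Hint Extern 0 (is_true (br _ _ \in _)) => apply: br_in : core.

Lemma ip_vanish (U : {vspace L}) X : X \in U ->
  (forall Y, Y \in U -> ip X Y = 0) -> X = 0.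
Proof. by move=> XU h; apply/eqP; rewrite -(ip_eq0 ip) h. Qed.

Lemma JDl Z W U : Z \in z -> W \in z -> U \in v -> J (Z + W) U = J Z U + J W U.
Proof.
move=> Zz Wz Uv; apply/eqP; rewrite -subr_eq0; apply/eqP/(@ip_vanish v).
  by rewrite rpredB ?rpredD// gh_J_in// rpredD.
move=> Y Yv; rewrite ipDl ipNl ipDl !gh_J_inner ?rpredD//.
by rewrite -ipDl subrr.
Qed.

Lemma JDr Z U V : Z \in z -> U \in v -> V \in v -> J Z (U + V) = J Z U + J Z V.
Proof.
move=> Zz Uv Vv; apply/eqP; rewrite -subr_eq0; apply/eqP/(@ip_vanish v).
  by rewrite rpredB ?rpredD// gh_J_in// rpredD.
move=> Y Yv; rewrite ipDl ipNl ipDl !gh_J_inner ?rpredD// linearDl ipDr.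
by rewrite subrr.
Qed.

Lemma JZl a Z U : Z \in z -> U \in v -> J (a *: Z) U = a *: J Z U.
Proof.
move=> Zz Uv; apply/eqP; rewrite -subr_eq0; apply/eqP/(@ip_vanish v).
  by rewrite rpredB ?rpredZ// gh_J_in// rpredZ.
move=> Y Yv; rewrite ipDl ipNl ipZl !gh_J_inner ?rpredZ// ipZl.
by rewrite subrr.
Qed.

Lemma JZr a Z U : Z \in z -> U \in v -> J Z (a *: U) = a *: J Z U.
Proof.
move=> Zz Uv; apply/eqP; rewrite -subr_eq0; apply/eqP/(@ip_vanish v).
  by rewrite rpredB ?rpredZ// gh_J_in// rpredZ.
move=> Y Yv; rewrite ipDl ipNl ipZl !gh_J_inner ?rpredZ//.
by rewrite linearZl_LR ipZr subrr.
Qed.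

Lemma brDl X Y W : br (X + Y) W = br X W + br Y W. Proof. exact: linearDl. Qed.
Lemma brDr X Y W : br W (X + Y) = br W X + br W Y. Proof. exact: linearDr. Qed.
Lemma brZl a X W : br (a *: X) W = a *: br X W. Proof. exact: linearZl_LR. Qed.
Lemma brZr a X W : br W (a *: X) = a *: br W X. Proof. exact: linearZr_LR. Qed.
Lemma brNl X W : br (- X) W = - br X W. Proof. exact: linearNl. Qed.
Lemma br0l W : br 0 W = 0. Proof. exact: linear0l. Qed.
Lemma br0r W : br W 0 = 0. Proof. exact: linear0r. Qed.

Lemma pvD X Y : pv (X + Y) = pv X + pv Y. Proof. exact: linearD. Qed.
Lemma pzD X Y : pz (X + Y) = pz X + pz Y. Proof. exact: linearD. Qed.
Lemma pvZ a X : pv (a *: X) = a *: pv X. Proof. exact: linearZ. Qed.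
Lemma pzZ a X : pz (a *: X) = a *: pz X. Proof. exact: linearZ. Qed.

Lemma pv_id X : X \in v -> pv X = X.
Proof. by move=> Xv; rewrite -{1}[X]addr0 pvE// mem0v. Qed.
Lemma pz_id X : X \in z -> pz X = X.
Proof. by move=> Xz; rewrite -{1}[X]add0r pzE// mem0v. Qed.
Lemma pv_z X : X \in z -> pv X = 0.
Proof. by move=> Xz; rewrite -{1}[X]add0r pvE// mem0v. Qed.
Lemma pz_v X : X \in v -> pz X = 0.
Proof. by move=> Xv; rewrite -{1}[X]addr0 pzE// mem0v. Qed.

Lemma ip_split X Y : ip X Y = ip (pv X) (pv Y) + ip (pz X) (pz Y).
Proof.
rewrite -{1}(gh_split H X) -{1}(gh_split H Y) ipDl !ipDr.
rewrite (gh_orthogonal (pv_in H X) (pz_in H Y)) addr0.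
by rewrite (ipC _ (pz X)) (gh_orthogonal (pv_in H Y) (pz_in H X)) add0r.
Qed.

Lemma ip_br U V Z : Z \in z -> ip Z (br U V) = ip (J Z (pv U)) (pv V).
Proof. by move=> Zz; rewrite br_pv gh_J_inner. Qed.

(* At the identity, theta x y is the derivative in the direction x of the
   left-invariant field of y, nabla is the Levi-Civita connection, and gamma is
   made of the Christoffel symbols of the chart. *)
Definition theta (x y : S) : S := (x.2 *: adA H y.1 + 2^-1 *: br x.1 y.1, 0).

Definition nablav (x y : S) : L :=
  - 2^-1 *: (J (pz y.1) (pv x.1) + J (pz x.1) (pv y.1) + y.2 *: pv x.1).
Definition nablaz (x y : S) : L := - 2^-1 *: br y.1 x.1 - y.2 *: pz x.1.
Definition nablaA (x y : S) : R := 2^-1 * ip (pv y.1) (pv x.1) + ip (pz y.1) (pz x.1).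

Definition nabla (x y : S) : S := (nablav x y + nablaz x y, nablaA x y).

Lemma nablav_in x y : nablav x y \in v.
Proof. by apply/memvZ/memvD; [apply/memvD; apply/gh_J_in|apply/memvZ]. Qed.
Lemma nablaz_in x y : nablaz x y \in z.
Proof. apply: memvB; apply: memvZ; [exact: br_in|exact: pz_in]. Qed.
Hint Extern 0 (is_true (nablav _ _ \in _)) => apply: nablav_in : core.
Hint Extern 0 (is_true (nablaz _ _ \in _)) => apply: nablaz_in : core.

Lemma pv_nabla x y : pv (nabla x y).1 = nablav x y. Proof. exact: pvE. Qed.
Lemma pz_nabla x y : pz (nabla x y).1 = nablaz x y. Proof. exact: pzE. Qed.

Lemma pv_theta x y : pv (theta x y).1 = (x.2 / 2) *: pv y.1.
Proof.
rewrite /= pvD !pvZ (pv_z (br_in H _ _)) scaler0 addr0 /adA pvE ?rpredZ//.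
by rewrite scalerA.
Qed.

Lemma pz_theta x y : pz (theta x y).1 = x.2 *: pz y.1 + 2^-1 *: br x.1 y.1.
Proof. by rewrite /= pzD !pzZ (pz_id (br_in H _ _)) /adA pzE ?rpredZ. Qed.

Lemma siE x y : si x y = ip (pv x.1) (pv y.1) + ip (pz x.1) (pz y.1) + x.2 * y.2.
Proof. by rewrite /solv_inner ip_split. Qed.

Lemma siC x y : si x y = si y x.
Proof. by rewrite /solv_inner ipC mulrC. Qed.
Lemma siDl x x' y : si (x + x') y = si x y + si x' y.
Proof. by rewrite /solv_inner /= ipDl mulrDl addrACA. Qed.
Lemma siZl a x y : si (a *: x) y = a * si x y.
Proof. by rewrite /solv_inner /= ipZl mulrDr mulrA. Qed.
Lemma siNl x y : si (- x) y = - si x y.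
Proof. by rewrite -scaleN1r siZl mulN1r. Qed.

Lemma J_skewC Z U V : Z \in z -> U \in v -> V \in v ->
  ip (J Z U) V = - ip (J Z V) U.
Proof. by move=> Zz Uv Vv; rewrite J_skew// ipC. Qed.

Definition gamma (x y : S) : S := nabla x y - theta x y.

(** Inner products of left-invariant fields are constant, so metric compatibility means that nabla x
    is skew; it comes down to three instances of the skewness of J. *)
Lemma nabla_metric x y w : si (nabla x y) w = - si y (nabla x w).
Proof.
rewrite (siC y) !siE !pv_nabla !pz_nabla /= /nablav /nablaz /nablaA.
rewrite !(ipDl, ipNl, ipZl) !(ipC _ (br _ _)) !ip_br//.
have := J_skewC (pz_in H x.1) (pv_in H w.1) (pv_in H y.1).
have := J_skewC (pz_in H y.1) (pv_in H w.1) (pv_in H x.1).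
have := J_skewC (pz_in H w.1) (pv_in H y.1) (pv_in H x.1).
rewrite (ipC _ (pv x.1) (pv y.1)) (ipC _ (pv x.1) (pv w.1)).
rewrite (ipC _ (pz x.1) (pz y.1)) (ipC _ (pz x.1) (pz w.1)).
move=> e1 e2 e3; rewrite e1 e2 e3; by field.
Qed.

(** The derivative at the identity of the metric on coordinate fields y, w in the direction x is -
    <theta x y, w> - <y, theta x w>. The right-hand side is therefore the usual combination of three
    partial derivatives that defines the Christoffel symbols. *)
Lemma gamma_koszul x y w : 2 * si (gamma x y) w =
  - si (theta x y) w - si y (theta x w) - si (theta y x) w - si x (theta y w)
  + si (theta w x) y + si x (theta w y).
Proof.
rewrite /gamma siDl siNl (siC y) (siC x) (siC x (theta w y)).
rewrite !siE !pv_nabla !pz_nabla !pv_theta !pz_theta /= /nablav /nablaz /nablaA.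
rewrite !(ipDl, ipNl, ipZl) !(ipC _ (br _ _)) !ip_br//.
have := J_skewC (pz_in H x.1) (pv_in H w.1) (pv_in H y.1).
have := J_skewC (pz_in H y.1) (pv_in H w.1) (pv_in H x.1).
have := J_skewC (pz_in H w.1) (pv_in H y.1) (pv_in H x.1).
rewrite (ipC _ (pv x.1) (pv y.1)) (ipC _ (pv x.1) (pv w.1)) (ipC _ (pv w.1) (pv y.1)).
rewrite (ipC _ (pz x.1) (pz y.1)) (ipC _ (pz x.1) (pz w.1)) (ipC _ (pz w.1) (pz y.1)).
move=> e1 e2 e3; rewrite e1 e2 e3; by field.
Qed.

Lemma si_ext x y : (forall w, si x w = si y w) -> x = y.
Proof.
move=> h; have {h} : si (x - y) (x - y) = 0 by rewrite siDl siNl h subrr.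
rewrite /solv_inner => h.
have n1 := ip_ge0 ip (x - y).1; have n2 := sqr_ge0 (x - y).2.
have /eqP : ip (x - y).1 (x - y).1 = 0 by move: h n1 n2; rewrite expr2; lra.
have /eqP : (x - y).2 ^+ 2 = 0 by move: h n1 n2; rewrite expr2; lra.
rewrite sqrf_eq0 ip_eq0 !subr_eq0 => /eqP e2 /eqP e1.
by rewrite [LHS]surjective_pairing e1 e2 -surjective_pairing.
Qed.

(** Flatness of the coordinate connection, seen on left-invariant fields; [solv_bracket_theta] is
    the vanishing of its torsion. *)
Lemma theta_bracket x y w :
  theta x (theta y w) - theta y (theta x w) = theta (solv_bracket H x y) w.
Proof.
apply: si_ext => u; rewrite siDl siNl !siE !pv_theta !pz_theta /=.
have b1 p q r s (X Y : L) : ip (br p (q *: adA H X + r *: br Y s)) (pz u.1) =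
    q / 2 * ip (br p X) (pz u.1).
  rewrite linearDr linearZr_LR /= linearZr_LR /= br_brr.
  rewrite ipDl !ipZl ip0l mulr0 addr0.
  rewrite /adA linearDr linearZr_LR /= (br_zr _ (pz_in H X)) ipDl ipZl ip0l addr0 mulrA.
  by rewrite br_pv [pv (pv _)]pv_id// -br_pv.
have b2 (X : L) : ip (br (adA H X) w.1) (pz u.1) = 2^-1 * ip (br X w.1) (pz u.1).
  rewrite /adA linearDl linearZl_LR /= (br_zl _ (pz_in H X)) ipDl ipZl ip0l addr0.
  by rewrite br_pv [pv (pv _)]pv_id// -br_pv.
have b3 (P Q T : L) a b : br (P + a *: Q - b *: T) w.1 =
    br P w.1 + a *: br Q w.1 - b *: br T w.1.
  by rewrite linearDl linearNl linearDl !linearZl_LR.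
rewrite b3 !(ipDl, ipNl, ipZl, ip0l) !b1 !b2 br_brl ip0l.
by field.
Qed.

Lemma solv_bracket_theta x y : solv_bracket H x y = theta x y - theta y x.
Proof.
congr (_, _); last by rewrite /= subrr.
rewrite /= (br_anti H y.1) scalerN opprD opprK addrACA -scalerDl.
have -> : 2^-1 + 2^-1 = 1 :> R by lra.
by rewrite scale1r addrC addrA.
Qed.

Lemma nablaDr x y y' : nabla x (y + y') = nabla x y + nabla x y'.
Proof.
apply: si_ext => w; rewrite siDl !siE !pv_nabla !pz_nabla /=.
rewrite /nablav /nablaz /nablaA /= !pvD !pzD JDl// JDr// brDl.
rewrite !(ipDl, ipNl, ipZl); ring.
Qed.

Lemma nablaZr a x y : nabla x (a *: y) = a *: nabla x y.
Proof.
apply: si_ext => w; rewrite siZl !siE !pv_nabla !pz_nabla /=.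
rewrite /nablav /nablaz /nablaA /= !pvZ !pzZ JZl// JZr// brZl.
rewrite !(ipDl, ipNl, ipZl) -?[a *: y.2]/(a * y.2); ring.
Qed.

Lemma nablaDl x x' y : nabla (x + x') y = nabla x y + nabla x' y.
Proof.
apply: si_ext => w; rewrite siDl !siE !pv_nabla !pz_nabla /=.
rewrite /nablav /nablaz /nablaA /= !pvD !pzD JDl// JDr// brDr.
rewrite !(ipDl, ipDr, ipNl, ipZl); ring.
Qed.

Lemma nablaZl a x y : nabla (a *: x) y = a *: nabla x y.
Proof.
apply: si_ext => w; rewrite siZl !siE !pv_nabla !pz_nabla /=.
rewrite /nablav /nablaz /nablaA /= !pvZ !pzZ JZl// JZr// brZr.
rewrite !(ipDl, ipNl, ipZl, ipZr); ring.
Qed.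

Definition curvature w x y : S :=
  nabla w (nabla x y) - nabla x (nabla w y) - nabla (solv_bracket H w x) y.

(** * The Ricci form as a trace *)

Section ricci_trace.
Variables (e : 'I_(\dim z) -> L) (u : 'I_(\dim v) -> L).
Hypotheses (oe : orthonormal_fam ip e) (ez : forall i, e i \in z).
Hypotheses (ou : orthonormal_fam ip u) (uv : forall i, u i \in v).

Let parse (X Y : L) : X \in z -> \sum_i ip X (e i) * ip Y (e i) = ip X Y.
Proof.
move=> Xz; rewrite (orthonormal_parseval _ oe ez)//.
by apply: eq_bigr => i _; rewrite (ipC _ Y).
Qed.

Let parsu (X Y : L) : X \in v -> \sum_i ip X (u i) * ip Y (u i) = ip X Y.
Proof.
move=> Xz; rewrite (orthonormal_parseval _ ou uv)//.
by apply: eq_bigr => i _; rewrite (ipC _ Y).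
Qed.



Lemma solv_orthonormal_expand (x : S) : x =
  \sum_i si x (u i, 0) *: ((u i, 0) : S) + \sum_i si x (e i, 0) *: ((e i, 0) : S)
  + si x (0, 1) *: ((0, 1) : S).
Proof.
have suml n (c : 'I_n -> R) (w : 'I_n -> L) :
    \sum_i c i *: ((w i, 0) : S) = (\sum_i c i *: w i, 0).
  elim/big_rec2: _ => // i y1 y2 _ ->; congr (_, _) => /=.
  by rewrite scaler0 addr0.
rewrite !suml; case: x => X t; congr (_, _) => /=.
  rewrite scaler0 addr0 -{1}(gh_split H X); congr (_ + _).
    rewrite {1}(orthonormal_expand ou uv (pv_in H X)); apply: eq_bigr => i _.
    by rewrite siE /= (pv_id (uv i)) (pz_v (uv i)) ip0r mulr0 !addr0.
  rewrite {1}(orthonormal_expand oe ez (pz_in H X)); apply: eq_bigr => i _.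
  by rewrite siE /= (pz_id (ez i)) (pv_z (ez i)) ip0r mulr0 addr0 add0r.
by rewrite !add0r /solv_inner /= ip0r add0r mulr1 [RHS]mulr1.
Qed.

(** The frame of the chart need not be orthonormal; basis independence of the trace allows the
    curvature to be evaluated in a basis that is. *)
Lemma trace_frame (F : S -> S) : linear F ->
  \sum_(i < dimS H) coord (frame H) i (F (tnth (frame H) i)) =
  \sum_i si (F (u i, 0)) (u i, 0) + \sum_i si (F (e i, 0)) (e i, 0)
  + si (F (0, 1)) (0, 1).
Proof.
move=> linF.
have FD x y : F (x + y) = F x + F y by have := linF 1 x y; rewrite !scale1r.
have F0 : F 0 = 0 by have := FD 0 0; rewrite addr0 -[X in X = _]addr0 => /addrI.
have FZ a x : F (a *: x) = a *: F x by have := linF a x 0; rewrite F0 !addr0.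
have Fsum n (h : 'I_n -> S) : F (\sum_i h i) = \sum_i F (h i).
  by elim/big_rec2: _ => // i y1 y2 _ <-; rewrite FD.
(* The trace of the rank one map x -> <x, w> F w is <F w, w>. *)
have key w : \sum_(i < dimS H) coord (frame H) i (si (tnth (frame H) i) w *: F w) =
    si (F w) w.
  rewrite {2}(coord_basis (frame_basis H) (memvf (F w))).
  have sisum n (h : 'I_n -> S) : si (\sum_i h i) w = \sum_i si (h i) w.
    elim/big_rec2: _ => [|i y1 y2 _ <-]; last by rewrite siDl.
    by rewrite /solv_inner /= ip0l mul0r addr0.
  rewrite sisum; apply: eq_bigr => i _.
  by rewrite linearZ /= siZl -tnth_nth mulrC.
under eq_bigr => i _.
  rewrite (solv_orthonormal_expand (tnth (frame H) i)) !FD !Fsum FZ !linearD !linear_sum /=.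
  under eq_bigr => j _ do rewrite FZ.
  under [X in _ + X + _]eq_bigr => j _ do rewrite FZ.
  over.
rewrite /= [LHS]big_split [X in X + _ = _]big_split /= key.
by congr (_ + _ + _); rewrite exchange_big; apply: eq_bigr => j _; rewrite key.
Qed.

Let Jz0 (U : L) : U \in v -> J 0 U = 0.
Proof. by move=> Uv; rewrite -(scale0r (0 : L)) JZl ?mem0v// !scale0r. Qed.
Let Jv0 (Z : L) : Z \in z -> J Z 0 = 0.
Proof. by move=> Zz; rewrite -(scale0r (0 : L)) JZr ?mem0v// !scale0r. Qed.

Let pv0 : pv 0 = 0. Proof. exact: linear0. Qed.
Let pz0 : pz 0 = 0. Proof. exact: linear0. Qed.

(** The trace only involves these diagonal terms, and [nabla_metric] moves one nabla to the other
    side, so that second covariant derivatives never have to be expanded. *)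
Lemma curvature_inner w x y : si (curvature w x y) w =
  - si (nabla x y) (nabla w w) + si (nabla w y) (nabla x w)
  - si (nabla (solv_bracket H w x) y) w.
Proof.
rewrite /curvature !siDl !siNl nabla_metric (nabla_metric x (nabla w y)).
by rewrite opprK.
Qed.

Let bru (x y : S) i := ip (br x.1 (u i)) (br y.1 (u i)).

Let bracket1 X x : pv (solv_bracket H (X, 0) x).1 = - (x.2 / 2) *: pv X /\
  pz (solv_bracket H (X, 0) x).1 = br X x.1 - x.2 *: pz X.
Proof.
rewrite /= scale0r addr0 /adA scalerDr opprD scalerA -scaleNr addrCA.
have e1 : - (x.2 / 2) *: pv X \in v by apply/memvZ.
have e2 : br X x.1 - x.2 *: pz X \in z by apply: memvB; [exact: br_in|apply/memvZ].
by rewrite pvE ?pzE.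
Qed.

Let curvature_v x y i : si (curvature (u i, 0) x y) (u i, 0) =
  - (1 / 4) * ip (pv x.1) (pv y.1) - (1 / 4) * ip (pz x.1) (pz y.1)
  - (3 / 4) * bru x y i + (1 / 4) * (ip (pv x.1) (u i) * ip (pv y.1) (u i))
  - (1 / 4) * (x.2 * y.2).
Proof.
rewrite curvature_inner.
have uu : ip (u i) (u i) = 1 by rewrite ou eqxx.
have pvu : pv (u i) = u i by exact: pv_id.
have pzu : pz (u i) = 0 by exact: pz_v.
have [b1 b2] := bracket1 (u i) x; rewrite pvu pzu scaler0 subr0 in b1 b2.
have -> : si (nabla x y) (nabla (u i, 0) (u i, 0)) = 2^-1 * nablaA x y.
  rewrite siE /nabla /= pvE// pzE// [pv (_ + _)]pvE// [pz (_ + _)]pzE//.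
  rewrite /nablav /nablaz /= pvu pzu !Jz0// gh_alternating !scaler0 !scale0r.
  rewrite !addr0 scaler0 subr0 !ip0r !add0r /nablaA /= pvu pzu uu ip0l.
  by rewrite addr0 mulr1 mulrC.
have -> : si (nabla (u i, 0) y) (nabla x (u i, 0)) =
    (1 / 4) * ip (pz x.1) (pz y.1) - (1 / 4) * bru x y i
    + (1 / 4) * (ip (pv x.1) (u i) * ip (pv y.1) (u i)).
  rewrite siE !pv_nabla !pz_nabla /= /nablav /nablaz /nablaA /= pvu pzu.
  rewrite !Jz0// !scaler0 !scale0r !subr0 !addr0 add0r !(ipDl, ipZl, ipZr).
  rewrite (J_polarl (pz_in H y.1) (pz_in H x.1) (uv i)) J_ip_orthogonal//.
  rewrite (br_anti H (u i) x.1) ipNr uu !ip0l /bru (ipC _ (br y.1 _)) (ipC _ (pz y.1)).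
  rewrite ?(ipC _ (u i) (pv _)) ?ip0r; by field.
have -> : si (nabla (solv_bracket H (u i, 0) x) y) (u i, 0) =
    (1 / 2) * bru x y i + (1 / 4) * (x.2 * y.2).
  rewrite siE pv_nabla /= mulr0 pzu ip0r !addr0 pvu /nablav b1 b2 JZr//.
  rewrite !(ipZl, ipDl) uu (ipC _ (J _ (u i))) J_ip_orthogonal//.
  rewrite gh_J_inner ?br_in// /bru (br_anti H x.1) ipNl [br y.1 _]br_pv pvu.
  by field.
rewrite /nablaA (ipC ip (pv y.1)) (ipC ip (pz y.1)); by field.
Qed.

Let curvature_z x y i : si (curvature (e i, 0) x y) (e i, 0) =
  - (1 / 4) * ip (pv x.1) (pv y.1) - ip (pz x.1) (pz y.1)
  + ip (pz x.1) (e i) * ip (pz y.1) (e i) - (x.2 * y.2).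
Proof.
rewrite curvature_inner.
have uu : ip (e i) (e i) = 1 by rewrite oe eqxx.
have pvu : pv (e i) = 0 by exact: pv_z.
have pzu : pz (e i) = e i by exact: pz_id.
have [b1 b2] := bracket1 (e i) x; rewrite pvu pzu scaler0 (br_zl _ (ez i)) sub0r in b1 b2.
have -> : si (nabla x y) (nabla (e i, 0) (e i, 0)) = nablaA x y.
  rewrite siE /nabla /= pvE// pzE// [pv (_ + _)]pvE// [pz (_ + _)]pzE//.
  rewrite /nablav /nablaz /= pvu pzu !Jv0// gh_alternating !scaler0 !scale0r.
  rewrite !addr0 scaler0 subr0 !ip0r !add0r /nablaA /= pvu pzu uu ip0l.
  by rewrite mulr0 add0r mulr1.
have -> : si (nabla (e i, 0) y) (nabla x (e i, 0)) =
    (1 / 4) * ip (pv x.1) (pv y.1) + ip (pz x.1) (e i) * ip (pz y.1) (e i).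
  rewrite siE !pv_nabla !pz_nabla /= /nablav /nablaz /nablaA /= pvu pzu.
  rewrite (br_zl _ (ez i)) !Jv0// !scaler0 !scale0r !subr0 !addr0 !add0r !(ipDl, ipZl, ipZr).
  rewrite J_norm// uu !ip0l !ip0r (ipC _ (pv y.1)) (ipC _ (e i)).
  by field.
have -> : si (nabla (solv_bracket H (e i, 0) x) y) (e i, 0) = x.2 * y.2.
  rewrite siE pz_nabla /= mulr0 pvu ip0r add0r addr0 pzu /nablaz b2 br_zr.
    by rewrite scaler0 sub0r scalerN opprK !ipZl uu mulr1 mulrC.
  rewrite /= scale0r addr0 (br_zl _ (ez i)) sub0r memvN memvZ//.
  by rewrite /adA memvD// memvZ// pv_z ?mem0v.
rewrite /nablaA (ipC ip (pv y.1)) (ipC ip (pz y.1)); by field.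
Qed.

Let curvature_A x y : si (curvature (0, 1) x y) (0, 1) =
  - (1 / 4) * ip (pv x.1) (pv y.1) - ip (pz x.1) (pz y.1).
Proof.
rewrite curvature_inner.
have nA w : nabla (0, 1) w = 0.
  rewrite /nabla /nablav /nablaz /nablaA /= pv0 pz0 !Jz0// Jv0// br0r.
  rewrite !ip0r !scaler0 !addr0 scaler0 subr0 mulr0.
  by congr (_, _); rewrite addr0.
rewrite !nA [si _ 0]/solv_inner [si 0 _]/solv_inner /= !ip0l !ip0r !mulr0 !mul0r.
have -> : solv_bracket H (0, 1) x = (adA H x.1, 0).
  rewrite /solv_bracket /= br0l add0r scale1r [adA H 0]/adA pv0 pz0.
  by rewrite scaler0 addr0 scaler0 subr0.
rewrite /solv_inner /= ip0r mulr1 /nablaA /= /adA.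
rewrite pvE ?memvZ// pzE ?memvZ// ipZr (ipC ip (pv y.1)) (ipC ip (pz y.1)).
by field.
Qed.

(** Parseval in z and then in v turns the sum into that of <J_(e_j) x, J_(e_j) y> over j, on the v
    components; each term is <x, y> by [J_norm]. *)
Let sum_bru x y : \sum_i bru x y i = (\dim z)%:R * ip (pv x.1) (pv y.1).
Proof.
rewrite /bru.
under eq_bigr => i _.
  rewrite -(parse _ (br_in H _ _)).
  under eq_bigr => j _.
    rewrite !(ipC _ (br _ _)) !ip_br// (pv_id (uv i)).
    over.
  over.
rewrite /= exchange_big /=.
under eq_bigr => j _ do rewrite parsu ?gh_J_in// J_norm// oe eqxx mul1r.
by rewrite sumr_const card_ord mulr_natl.
Qed.

(** On v the basis vectors of v contribute 1/4 - k/4 - 3m/4, those of z contribute - m/4 and A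
    contributes - 1/4; on z the contributions are - k/4, 1 - m and -1; on A they are - k/4, - m and
    0. Each total is -(k/4 + m). *)
Theorem ricci_trace x y :
  \sum_i si (curvature (u i, 0) x y) (u i, 0)
  + \sum_i si (curvature (e i, 0) x y) (e i, 0)
  + si (curvature (0, 1) x y) (0, 1) =
  - ((\dim v)%:R / 4 + (\dim z)%:R) * si x y.
Proof.
under eq_bigr => i _ do rewrite curvature_v.
under [X in _ + X + _]eq_bigr => i _ do rewrite curvature_z.
rewrite curvature_A siE.
rewrite !big_split /= -!mulr_sumr !sumrN -!mulr_sumr !sum_bru !parsu// !parse//.
have sum_cst n (c : R) : \sum_(i < n) c = n%:R * c.
  by rewrite sumr_const card_ord mulr_natl.
rewrite !sum_cst; by field.
Qed.

End ricci_trace.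

End levi_civita.

(** * Ricci curvature in the chart *)

Section matrix_calculus.
Variables (R : realType) (n : nat).
Notation E := 'rV[R]_n.

Lemma is_derive_line (f : E -> R) (p w : E) (d : R) :
  is_derive (0 : R) 1 (fun h => f (p + h *: w)) d -> is_derive p w f d.
Proof.
move=> [der val].
have eqf : (fun h : R => h^-1 *: ((f \o shift p) (h *: w) - f p)) =
    (fun h : R => h^-1 *: (((fun h => f (p + h *: w)) \o shift 0) (h *: 1)
      - (fun h => f (p + h *: w)) 0)).
  apply/funext => h /=; rewrite addr0 scale0r addr0 [h *: 1]mulr1.
  by rewrite [p + _]addrC.
by split; rewrite /derivable /derive eqf.
Qed.

Lemma is_derive_expR_affine (a b : R) :
  is_derive (0 : R) 1 (fun h => expR (a + h * b)) (expR a * b).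
Proof.
have : is_derive (0 : R) 1 (expR \o (fun h : R => a + h * b)) (expR (a + 0 * b) * b).
  apply: is_derive1_comp.
  have -> : (fun h : R => a + h * b) = cst a + b *: id.
    by apply/funext => h; rewrite !fctE mulrC.
  apply: is_derive_eq; rewrite add0r; exact: mulr1.
by rewrite mul0r addr0.
Qed.

(** Entry by entry, because [partial] differentiates scalar functions. *)
Definition is_dmx a b (p w : E) (F : E -> 'M[R]_(a, b)) (D : 'M[R]_(a, b)) :=
  forall i j, is_derive p w (fun q => F q i j) (D i j).

Lemma is_dmx_eq a b p w (F : E -> 'M[R]_(a, b)) D D' :
  is_dmx p w F D -> D = D' -> is_dmx p w F D'.
Proof. by move=> ? <-. Qed.

Lemma is_dmx_cst a b p w (M : 'M[R]_(a, b)) : is_dmx p w (fun=> M) 0.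
Proof. by move=> i j; rewrite mxE; exact: is_derive_cst. Qed.

Lemma is_dmx_mul a b c p w (F : E -> 'M[R]_(a, b)) (G : E -> 'M[R]_(b, c)) DF DG :
  is_dmx p w F DF -> is_dmx p w G DG ->
  is_dmx p w (fun q => F q *m G q) (DF *m G p + F p *m DG).
Proof.
move=> dF dG i j.
have -> : (fun q => (F q *m G q) i j) =
    \sum_(k < b) ((fun q => F q i k) * (fun q => G q k j)).
  by apply/funext => q; rewrite mxE fct_sumE.
apply: is_derive_eq; first by apply: is_derive_sum => k; exact: is_deriveM.
rewrite !mxE -big_split; apply: eq_bigr => k _ /=.
by rewrite addrC; congr (_ + _); rewrite [LHS]mulrC.
Qed.

Lemma is_dmx_tr a b p w (F : E -> 'M[R]_(a, b)) DF :
  is_dmx p w F DF -> is_dmx p w (fun q => (F q)^T) DF^T.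
Proof.
move=> dF i j; rewrite mxE (_ : (fun _ => _) = fun q => F q j i)//.
by apply/funext => q; rewrite mxE.
Qed.

Lemma is_dmx_linear a b p w (F : E -> E) DF (G : E -> 'M[R]_(a, b)) :
  linear G -> is_dmx p w F DF -> is_dmx p w (fun q => G (F q)) (G DF).
Proof.
move=> linG dF i j.
have GE x : G x = \sum_k x 0 k *: G 'e_k.
  pose g := HB.pack_for {linear E -> 'M[R]_(a, b)} G
    (GRing.isLinear.Build _ _ _ _ G linG).
  rewrite -[G]/(g : E -> _) {1}[x]row_sum_delta linear_sum.
  by apply: eq_bigr => k _; rewrite linearZ.
have -> : (fun q => G (F q) i j) =
    \sum_(k < n) (G 'e_k i j \*: (fun q => F q 0 k)).
  apply/funext => q; rewrite GE summxE fct_sumE; apply: eq_bigr => k _.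
  by rewrite mxE mulrC.
apply: is_derive_eq; first by apply: is_derive_sum => k; exact: is_deriveZ.
rewrite GE summxE; apply: eq_bigr => k _; rewrite mxE mulrC.
by [].
Qed.

Lemma affine_differentiable (c : E) (M : 'M[R]_n) (p : E) :
  differentiable (fun x : E => c + x *m M) p.
Proof.
have -> : (fun x : E => c + x *m M) =
    cst c + \sum_(k < n) (fun x : E => x 0 k *: row k M).
  by apply/funext => x; rewrite fctE fct_sumE mulmx_sum_row.
apply: differentiableD; first exact: differentiable_cst.
apply: differentiable_sum => k; apply: differentiableZl.
exact: differentiable_coord.
Qed.

Lemma jacobian_affine (c : E) (M : 'M[R]_n) (p : E) :
  jacobian (fun x : E => c + x *m M) p = M.
Proof.
apply/row_matrixP => i; rewrite !rowE -deriveEjacobian; last exact: affine_differentiable.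
rewrite /derive; apply: lim_near_cst => //; near=> h.
have h0 : h != 0 by near: h; exact: nbhs_dnbhs_neq.
rewrite /= mulmxDl -scalemxAl (addrC _ (p *m M)) addrA (addrC (c + _)) addrK.
by rewrite scalerA mulVf// scale1r.
Unshelve. all: by end_near. Qed.

Lemma mul_lin1_linear m (f : E -> 'rV[R]_m) x : linear f -> x *m lin1_mx f = f x.
Proof.
move=> linf; pose g := HB.pack_for {linear E -> 'rV[R]_m} f
  (GRing.isLinear.Build _ _ _ _ f linf).
exact: (mul_rV_lin1 g).
Qed.

Lemma mx_eq_row a (M N : 'M[R]_(n, a)) : (forall x : E, x *m M = x *m N) -> M = N.
Proof. by move=> h; apply/row_matrixP => i; rewrite !rowE h. Qed.

End matrix_calculus.

(* A left-invariant metric in a chart in which left translations are affine: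
   B p is the matrix of the differential of the left translation by p^-1, and
   T w the derivative of its inverse A at the identity in the direction w. *)
Section left_invariant.
Variables (R : realType) (n : nat).
Notation E := 'rV[R]_n.
Notation ee i := (delta_mx 0 i : E).
Variables (A B T C : E -> 'M[R]_n) (K Kinv : 'M[R]_n).
Hypothesis T_linear : linear T.
Hypothesis C_linear : linear C.
Hypothesis K_sym : K^T = K.
Hypothesis KKinv : K *m Kinv = 1%:M.
Hypothesis BA : forall p, B p *m A p = 1%:M.
Hypothesis dB : forall p w, is_dmx p w B (- (B p *m T (w *m B p))).
Hypothesis dA : forall p w, is_dmx p w A (T (w *m B p) *m A p).

Let kf (x y : E) : R := (x *m K *m y^T) 0 0.

Hypothesis koszul : forall x y w, 2 * kf (y *m C x) w =
  - kf (y *m T x) w - kf y (w *m T x) - kf (x *m T y) w - kf x (w *m T y)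
  + kf (x *m T w) y + kf x (y *m T w).

Let G p := B p *m K *m (B p)^T.

Let rowcol (M : 'M[R]_n) i j : M i j = ((ee i) *m M *m (ee j)^T) 0 0.
Proof.
rewrite -rowE mxE (bigD1 j)//= big1 ?addr0.
  by rewrite !mxE !eqxx mulr1.
by move=> k kj; rewrite !mxE (negbTE kj) andbF mulr0.
Qed.

Let invG p : invmx (G p) = (A p)^T *m Kinv *m A p.
Proof.
have GI : G p *m ((A p)^T *m Kinv *m A p) = 1%:M.
  rewrite /G -!mulmxA [(B p)^T *m _]mulmxA -trmx_mul (mulmx1C (BA p)) trmx1 mul1mx.
  by rewrite [K *m _]mulmxA KKinv mul1mx BA.
have /mulmx1_unit[Gu _] := GI.
by rewrite -[LHS]mulmx1 -GI (mulmxA (invmx _)) mulVmx// mul1mx.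
Qed.

Let Kinv_sym : Kinv^T = Kinv.
Proof.
have : Kinv^T *m K = 1%:M by rewrite -{1}K_sym -trmx_mul KKinv trmx1.
move=> /(congr1 (mulmx^~ Kinv)); by rewrite -mulmxA KKinv mulmx1 mul1mx.
Qed.

Let dG p w : is_dmx p w G
  (- (B p *m T (w *m B p) *m K *m (B p)^T) - B p *m K *m (B p *m T (w *m B p))^T).
Proof.
apply: is_dmx_eq.
  apply: is_dmx_mul; last exact: is_dmx_tr (dB p w).
  by apply: is_dmx_mul; [exact: dB|exact: is_dmx_cst].
by rewrite mulmx0 addr0 !mulNmx linearN /= mulmxN.
Qed.

Let partialG i j h p : partial i (fun x => G x j h) p =
  - kf ((ee j) *m B p *m T ((ee i) *m B p)) ((ee h) *m B p)
  - kf ((ee j) *m B p) ((ee h) *m B p *m T ((ee i) *m B p)).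
Proof.
have := dG p (ee i) j h => D; rewrite /partial derive_val 2!mxE [X in _ + X]mxE.
by rewrite !rowcol /kf !trmx_mul !mulmxA.
Qed.

(** By [partialG] the three partial derivatives form the right-hand side of [koszul] at the
    translated vectors; [invG] then cancels the metric against its inverse. *)
Lemma christoffel_left_invariant l i j p : christoffel G l i j p =
  ((ee j) *m B p *m C ((ee i) *m B p) *m A p) 0 l.
Proof.
rewrite /christoffel.
under eq_bigr => h _.
  rewrite !partialG.
  set s := (X in _ * X).
  have -> : s = 2 * ((ee j) *m B p *m C ((ee i) *m B p) *m K *m (B p)^T) 0 h.
    transitivity (2 * kf ((ee j) *m B p *m C ((ee i) *m B p)) ((ee h) *m B p)).
      by rewrite koszul /s; ring.
    congr (_ * _); rewrite /kf trmx_mul !mulmxA.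
    set N := _ *m (B p)^T; rewrite mxE (bigD1 h)//= big1 ?addr0.
      by rewrite !mxE !eqxx mulr1.
    by move=> k kh; rewrite !mxE (negbTE kh) mulr0.
  over.
rewrite /= mulr_sumr.
have -> : (ee j) *m B p *m C ((ee i) *m B p) *m A p =
    (ee j) *m B p *m C ((ee i) *m B p) *m K *m (B p)^T *m (invmx (G p))^T.
  rewrite invG !trmx_mul trmxK Kinv_sym -!mulmxA [(B p)^T *m _]mulmxA -trmx_mul.
  by rewrite (mulmx1C (BA p)) trmx1 mul1mx [K *m _]mulmxA KKinv mul1mx.
rewrite mxE; apply: eq_bigr => h _; rewrite [(invmx _)^T _ _]mxE.
move: (_ 0 h) (invmx _ _ _) => a b; by field.
Qed.

(** The first line is the derivative along w of the Christoffel term of x and y: the three factors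
    that depend on the point, A, B and C, each give one product with T. The second line exchanges w
    and x, and the third is the quadratic part of the curvature. *)
Definition curv_mx (w x y : E) : E :=
  y *m C x *m T w - y *m T w *m C x - y *m C (x *m T w)
  - (y *m C w *m T x - y *m T x *m C w - y *m C (w *m T x))
  + y *m C x *m C w - y *m C w *m C x.

Lemma ricci_left_invariant j h p : ricci G p j h =
  \sum_i curv_mx (ee i) ((ee j) *m B p) ((ee h) *m B p) 0 i.
Proof.
have christE l i k : christoffel G l i k = fun q =>
    ((ee k) *m B q *m C ((ee i) *m B q) *m A q) 0 l.
  by apply/funext => q; exact: christoffel_left_invariant.
pose Chr (x y : E) := y *m B p *m C (x *m B p) *m A p.
have dChr w i k : is_dmx p w (fun q => (ee k) *m B q *m C ((ee i) *m B q) *m A q)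
  (((ee k) *m B p *m C ((ee i) *m B p) *m T (w *m B p)
    - (ee k) *m B p *m T (w *m B p) *m C ((ee i) *m B p)
    - (ee k) *m B p *m C ((ee i) *m B p *m T (w *m B p))) *m A p).
  have d1 r : is_dmx p w (fun q => (ee r) *m B q) (- ((ee r) *m B p *m T (w *m B p))).
    apply: is_dmx_eq; first by apply: is_dmx_mul; [exact: is_dmx_cst|exact: dB].
    by rewrite mul0mx add0r mulmxN mulmxA.
  apply: is_dmx_eq.
    apply: is_dmx_mul; last exact: dA.
    apply: is_dmx_mul; first exact: d1.
    exact: (is_dmx_linear C_linear (d1 i)).
  have C0 : C 0 = 0.
    by have := C_linear (-1) 0 0; rewrite !scaleN1r oppr0 addr0 addNr.
  have CN x : C (- x) = - C x.
    by have := C_linear (-1) x 0; rewrite addr0 !scaleN1r C0 addr0.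
  rewrite CN mulNmx mulmxN !mulmxBl !mulNmx !mulmxA.
  by rewrite addrC addrA.
pose x := (ee j) *m B p; pose y := (ee h) *m B p.
have AB : A p *m B p = 1%:M by exact: mulmx1C.
have sumC i k : \sum_l (christoffel G i k l p * christoffel G l j h p) =
    (y *m C x *m C (ee k *m B p) *m A p) 0 i.
  transitivity (((y *m C x *m A p) *m (B p *m C (ee k *m B p) *m A p)) 0 i).
    rewrite [RHS]mxE; apply: eq_bigr => l _.
    rewrite !christoffel_left_invariant mulrC; congr (_ * _).
    by rewrite -!mulmxA -rowE mxE.
  by rewrite -!mulmxA [A p *m _]mulmxA AB mul1mx.
have sumC' i k : \sum_l (christoffel G i j l p * christoffel G l k h p) =
    (y *m C (ee k *m B p) *m C x *m A p) 0 i.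
  transitivity (((y *m C (ee k *m B p) *m A p) *m (B p *m C x *m A p)) 0 i).
    rewrite [RHS]mxE; apply: eq_bigr => l _.
    rewrite !christoffel_left_invariant mulrC; congr (_ * _).
    by rewrite -!mulmxA -rowE mxE.
  by rewrite -!mulmxA [A p *m _]mulmxA AB mul1mx.
have curv_linear : linear (fun w => curv_mx w x y).
  have CD a u w : C (a *: u + w) = a *: C u + C w by exact: C_linear.
  have TD a u w : T (a *: u + w) = a *: T u + T w by exact: T_linear.
  have LD m (M : 'M[R]_n) (u w : 'M[R]_(m, n)) a :
      (a *: u + w) *m M = a *: (u *m M) + w *m M.
    by rewrite mulmxDl scalemxAl.
  have RD (u : E) (M N : 'M[R]_n) a : u *m (a *: M + N) = a *: (u *m M) + u *m N.
    by rewrite mulmxDr -scalemxAr.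
  move=> a u w; rewrite /curv_mx !(CD, TD, RD, LD).
  apply/rowP => k; rewrite !mxE; ring.
transitivity (\sum_i (curv_mx (ee i *m B p) x y *m A p) 0 i).
  rewrite mxE; apply: eq_bigr => i _; rewrite sumrB sumC sumC' /partial !christE.
  have D1 := dChr (ee i) j h 0 i; have D2 := dChr (ee j) i h 0 i.
  rewrite (derive_val (is_derive := D1)) (derive_val (is_derive := D2)).
  by rewrite /curv_mx !mulmxDl !mulNmx !mulmxDl !mulNmx !mxE -/x -/y; ring.
(* The translations [B p] and [A p] are inverse to each other, so they cancel in the trace and only
   the value at the identity remains. *)
have -> : \sum_i (curv_mx (ee i *m B p) x y *m A p) 0 i =
    \tr (B p *m lin1_mx (fun w => curv_mx w x y) *m A p).
  apply: eq_bigr => i _.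
  by rewrite -(mul_lin1_linear _ curv_linear) -!mulmxA -rowE [LHS]mxE.
rewrite mxtrace_mulC mulmxA AB mul1mx; apply: eq_bigr => i _.
by rewrite mxE.
Qed.

End left_invariant.

(** * The metric of a Damek-Ricci space in its chart *)

Section chart.
Variables (R : realType) (L : vectType R) (H : generalized_heisenberg L).

Notation br := (gh_bracket H).
Notation ip := (gh_inner H).
Notation v := (gh_v H).
Notation z := (gh_z H).
Notation pv := (proj_v H).
Notation pz := (proj_z H).
Notation S := (solv L).
Notation si := (solv_inner H).
Notation n := (dimS H).
Notation E := 'rV[R]_n.
Notation oc := (of_chart H).
Notation tc := (to_chart H).
Notation exA := (exp_adA H).
Hint Extern 0 (is_true (proj_v _ _ \in _)) => apply: pv_in : core.
Hint Extern 0 (is_true (proj_z _ _ \in _)) => apply: pz_in : core.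

Lemma of_chartD x y : oc (x + y) = oc x + oc y.
Proof. by rewrite -[x in LHS]of_chartK -[y in LHS]of_chartK -to_chartD to_chartK. Qed.

Lemma to_chartN x : tc (- x) = - tc x.
Proof. by rewrite -scaleN1r to_chartZ scaleN1r. Qed.

(** The differential of left translation by P, the same at every point: [DR_mulE] shows that the
    translation is affine with this linear part. [pullS P] is its inverse. *)
Definition pushS (P y : S) : S :=
  (exA P.2 y.1 + 2^-1 *: br P.1 (exA P.2 y.1), y.2).
Definition pullS (P y : S) : S := (exA (- P.2) (y.1 - 2^-1 *: br P.1 y.1), y.2).

Lemma pushSP P a x y : pushS P (a *: x + y) = a *: pushS P x + pushS P y.
Proof.
congr (_, _) => /=; rewrite exAD exAZ brDr brZr !scalerDr !scalerA (mulrC 2^-1) addrACA.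
by [].
Qed.

Lemma pullSP P a x y : pullS P (a *: x + y) = a *: pullS P x + pullS P y.
Proof.
congr (_, _) => /=; rewrite -exAZ -exAD; congr exA.
by rewrite brDr brZr !scalerDr scalerN !scalerA (mulrC 2^-1) opprD addrACA.
Qed.

Lemma pullSK P y : pushS P (pullS P y) = y.
Proof.
case: y => Y s; congr (_, _); rewrite /= exAA subrr exA0 -scaleN1r scalerA brDr brZr.
by rewrite br_brr scaler0 addr0 mulN1r -addrA -scalerDl addNr scale0r addr0.
Qed.

Lemma pushS_inv P y : pushS (solv_inv H P) y = pullS P y.
Proof.
congr (_, _) => /=; by rewrite exAD brNl -exA_br scalerN -[in RHS]scaleNr exAZ scaleNr.
Qed.

Definition pushM (p : E) : 'M[R]_n := lin1_mx (fun y => tc (pushS (oc p) (oc y))).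
Definition pullM (p : E) : 'M[R]_n := lin1_mx (fun y => tc (pullS (oc p) (oc y))).
Definition thetaM (w : E) : 'M[R]_n := lin1_mx (fun y => tc (theta H (oc w) (oc y))).
Definition gammaM (w : E) : 'M[R]_n := lin1_mx (fun y => tc (gamma H (oc w) (oc y))).

Lemma mul_pushM y p : y *m pushM p = tc (pushS (oc p) (oc y)).
Proof.
apply: (mul_lin1_linear (f := fun y => tc (pushS (oc p) (oc y)))) => a x x'.
by rewrite of_chartD of_chartZ pushSP to_chartD to_chartZ.
Qed.

Lemma mul_pullM y p : y *m pullM p = tc (pullS (oc p) (oc y)).
Proof.
apply: (mul_lin1_linear (f := fun y => tc (pullS (oc p) (oc y)))) => a x x'.
by rewrite of_chartD of_chartZ pullSP to_chartD to_chartZ.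
Qed.

Lemma thetaPr w a x y : theta H w (a *: x + y) = a *: theta H w x + theta H w y.
Proof.
apply: (si_ext (H := H)) => u; rewrite siDl siZl !siE !pv_theta !pz_theta /=.
rewrite !pvD !pzD !pvZ !pzZ brDr brZr !(ipDl, ipZl); ring.
Qed.

Lemma thetaPl a w w' y : theta H (a *: w + w') y = a *: theta H w y + theta H w' y.
Proof.
apply: (si_ext (H := H)) => u; rewrite siDl siZl !siE !pv_theta !pz_theta /=.
rewrite brDl brZl !(ipDl, ipZl) -?[a *: w.2]/(a * w.2); ring.
Qed.

Lemma gammaPr w a x y : gamma H w (a *: x + y) = a *: gamma H w x + gamma H w y.
Proof.
by rewrite /gamma thetaPr nablaDr nablaZr opprD addrACA -scalerN -scalerDr.
Qed.

Lemma gammaPl a w w' y : gamma H (a *: w + w') y = a *: gamma H w y + gamma H w' y.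
Proof.
by rewrite /gamma thetaPl nablaDl nablaZl opprD addrACA -scalerN -scalerDr.
Qed.

Lemma mul_thetaM y w : y *m thetaM w = tc (theta H (oc w) (oc y)).
Proof.
apply: (mul_lin1_linear (f := fun y => tc (theta H (oc w) (oc y)))) => a x x'.
by rewrite of_chartD of_chartZ thetaPr to_chartD to_chartZ.
Qed.

Lemma mul_gammaM y w : y *m gammaM w = tc (gamma H (oc w) (oc y)).
Proof.
apply: (mul_lin1_linear (f := fun y => tc (gamma H (oc w) (oc y)))) => a x x'.
by rewrite of_chartD of_chartZ gammaPr to_chartD to_chartZ.
Qed.

Lemma thetaM_linear : linear thetaM.
Proof.
move=> a w w'; apply: mx_eq_row => y.
rewrite mulmxDr -scalemxAr !mul_thetaM of_chartD of_chartZ thetaPl.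
by rewrite to_chartD to_chartZ.
Qed.

Lemma gammaM_linear : linear gammaM.
Proof.
move=> a w w'; apply: mx_eq_row => y.
rewrite mulmxDr -scalemxAr !mul_gammaM of_chartD of_chartZ gammaPl.
by rewrite to_chartD to_chartZ.
Qed.

Lemma pullM_pushM p : pullM p *m pushM p = 1%:M.
Proof.
apply: mx_eq_row => y.
by rewrite mulmxA mul_pushM mul_pullM to_chartK pullSK of_chartK mulmx1.
Qed.

Lemma DR_mulE q y : DR_mul H q y = q + y *m pushM q.
Proof.
rewrite mul_pushM /DR_mul -[q in RHS]of_chartK -to_chartD to_chartK; congr tc.
by congr (_, _); rewrite /= -addrA.
Qed.

Lemma DR_metricE p : DR_metric H p = pullM p *m frame_gram H *m (pullM p)^T.
Proof.
rewrite /DR_metric.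
have -> : jacobian (DR_mul H (DR_inv H p)) p = pullM p; last by [].
have -> : DR_mul H (DR_inv H p) = fun y => DR_inv H p + y *m pushM (DR_inv H p).
  by apply/funext => y; rewrite DR_mulE.
rewrite jacobian_affine; apply: mx_eq_row => y.
by rewrite mul_pushM mul_pullM /DR_inv to_chartK pushS_inv.
Qed.

Lemma form_gram (x y : E) : (x *m frame_gram H *m y^T) 0 0 = si (oc x) (oc y).
Proof.
have sisuml I r (F : I -> S) w : si (\sum_(i <- r) F i) w = \sum_(i <- r) si (F i) w.
  elim/big_rec2: _ => [|i y1 y2 _ <-]; last by rewrite siDl.
  by rewrite /solv_inner /= ip0l mul0r addr0.
rewrite /of_chart sisuml mxE.
under eq_bigr => j _ do rewrite !mxE mulr_suml.
rewrite exchange_big; apply: eq_bigr => i _ /=.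
rewrite siZl siC sisuml mulr_sumr; apply: eq_bigr => j _.
by rewrite siZl !mxE siC; ring.
Qed.

Lemma frame_gram_sym : (frame_gram H)^T = frame_gram H.
Proof. by apply/matrixP => i j; rewrite !mxE siC. Qed.

Lemma frame_gram_unit : frame_gram H \in unitmx.
Proof.
rewrite -row_free_unit -kermx_eq0; apply/rowV0P => x /sub_kermxP x0.
have := form_gram x x; rewrite x0 mul0mx mxE => /esym h.
have : oc x = 0.
  apply: (si_ext (H := H)) => w; rewrite -(to_chartK H w) -form_gram x0 mul0mx mxE.
  by rewrite /solv_inner /= ip0l mul0r addr0.
by move=> /(congr1 tc); rewrite of_chartK to_chart0.
Qed.

(** The common shape of the entries of [pullM] and [pushM] along a line: two exponential rates, for
    v and z, and one term with a linear factor, which comes from the bracket. *)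
Lemma is_derive_exp_comb (a b a' b' x y w d : R) :
  is_derive (0 : R) 1
    (fun h => expR (a + h * b) * x + expR (a' + h * b') * y
              + h * expR (a' + h * b') * w + d)
    (expR a * b * x + expR a' * b' * y + expR a' * w).
Proof.
have D c c' k : is_derive (0 : R) 1 (fun h => expR (c + h * c') * k) (expR c * c' * k).
  rewrite (_ : (fun h => _) = k *: (fun h => expR (c + h * c'))); last first.
    by apply/funext => h; rewrite fctE mulrC.
  have := is_derive_expR_affine c c' => D.
  by apply: is_derive_eq; rewrite [RHS]mulrC.
have Dw : is_derive (0 : R) 1 (fun h => h * expR (a' + h * b') * w) (expR a' * w).
  rewrite (_ : (fun h => _) = id * (fun h => expR (a' + h * b') * w)); last first.
    by apply/funext => h; rewrite !fctE mulrA.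
  have := D a' b' w => D'; apply: is_derive_eq.
  rewrite scale0r add0r mul0r addr0; exact: mulr1.
rewrite -[X in is_derive _ _ _ X]addr0.
exact: (is_deriveD (is_deriveD (is_deriveD (D _ _ _) (D _ _ _)) Dw) (is_derive_cst d _ _)).
Qed.

Lemma pullS_affine (P W y : S) (h : R) : pullS (P + h *: W) y =
  expR (- (P.2 / 2) + h * (- (W.2 / 2))) *: ((pv y.1, 0) : S)
  + expR (- P.2 + h * (- W.2)) *: ((pz y.1 - 2^-1 *: br P.1 y.1, 0) : S)
  + (h * expR (- P.2 + h * (- W.2))) *: ((- 2^-1 *: br W.1 y.1, 0) : S)
  + (0, y.2).
Proof.
congr (_, _) => /=; last by rewrite !scaler0 !add0r.
rewrite addr0 /exp_adA -[h *: W.2]/(h * W.2) opprD brDl brZl.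
set b := 2^-1 *: _.
have bz : b \in z by rewrite memvZ// memvD ?memvZ// br_in.
have -> : pv (y.1 - b) = pv y.1 by rewrite pvD (pv_z (_ : - b \in z)) ?memvN ?addr0.
have -> : pz (y.1 - b) = pz y.1 - b by rewrite pzD (pz_id (_ : - b \in z)) ?memvN.
rewrite -addrA; congr (_ *: _ + _); first by congr expR; field.
rewrite mulrN [h * expR _]mulrC -scalerA -scalerDr; congr (_ *: _).
by rewrite /b scalerDr opprD addrA !scalerA mulrN scaleNr (mulrC h).
Qed.

Lemma pushS_affine (P W y : S) (h : R) : pushS (P + h *: W) y =
  expR (P.2 / 2 + h * (W.2 / 2)) *: ((pv y.1 + 2^-1 *: br P.1 y.1, 0) : S)
  + expR (P.2 + h * W.2) *: ((pz y.1, 0) : S)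
  + (h * expR (P.2 / 2 + h * (W.2 / 2))) *: ((2^-1 *: br W.1 y.1, 0) : S)
  + (0, y.2).
Proof.
congr (_, _) => /=; last by rewrite !scaler0 !add0r.
rewrite addr0 -[h *: W.2]/(h * W.2).
have -> : br (P.1 + h *: W.1) (exA (P.2 + h * W.2) y.1) =
    expR ((P.2 + h * W.2) / 2) *: (br P.1 y.1 + h *: br W.1 y.1).
  rewrite br_pv pv_exA brZr; congr (_ *: _).
  by rewrite -br_pv brDl brZl.
rewrite /exp_adA scalerDr scalerDr !scalerA.
have -> : (P.2 + h * W.2) / 2 = P.2 / 2 + h * (W.2 / 2) by field.
rewrite addrA scalerDr scalerA; congr (_ + _); last by congr (_ *: _); ring.
by rewrite addrAC (mulrC 2^-1).
Qed.

Lemma br_exA t X Y : br (exA t X) (exA t Y) = expR t *: br X Y.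
Proof. by rewrite -exA_br /exp_adA pv_z ?br_in// pz_id ?br_in// scaler0 add0r. Qed.

(** The right-hand side is minus the derivative at h = 0 of [pullS_affine]; that of [push_theta] is
    the derivative of [pushS_affine]. *)
Lemma theta_pull (P W y : S) : theta H (pullS P W) (pullS P y) =
  (expR (- (P.2 / 2)) * (W.2 / 2)) *: ((pv y.1, 0) : S)
  + (expR (- P.2) * W.2) *: ((pz y.1 - 2^-1 *: br P.1 y.1, 0) : S)
  - expR (- P.2) *: ((- 2^-1 *: br W.1 y.1, 0) : S).
Proof.
congr (_, _) => /=; last by rewrite !scaler0 oppr0 !addr0.
have b0 X (b b' : L) : b \in z -> b' \in z -> br (X - b) (y.1 - b') = br X y.1.
  move=> bz bz'; have nb : - b \in z by rewrite memvN.
  have nb' : - b' \in z by rewrite memvN.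
  by rewrite brDl (br_zl _ nb) addr0 brDr (br_zr _ nb') addr0.
rewrite br_exA b0 ?memvZ ?br_in//.
set b := 2^-1 *: br P.1 y.1; have bz : b \in z by rewrite memvZ// br_in.
have e1 : pv (y.1 - b) = pv y.1 by rewrite pvD (pv_z (_ : - b \in z)) ?memvN ?addr0.
have e2 : pz (y.1 - b) = pz y.1 - b by rewrite pzD (pz_id (_ : - b \in z)) ?memvN.
rewrite /adA pv_exA pz_exA e1 e2 scaleNr scalerN opprK scalerDr !scalerA.
rewrite mulNr (mulrC 2^-1 (expR _)) (mulrC W.2 (expR _)).
by congr (_ *: _ + _ + _); ring.
Qed.

Lemma push_theta (P W y : S) : pushS P (theta H (pullS P W) y) =
  (expR (P.2 / 2) * (W.2 / 2)) *: ((pv y.1 + 2^-1 *: br P.1 y.1, 0) : S)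
  + (expR P.2 * W.2) *: ((pz y.1, 0) : S)
  + expR (P.2 / 2) *: ((2^-1 *: br W.1 y.1, 0) : S).
Proof.
congr (_, _) => /=; last by rewrite !scaler0 !addr0.
have e0 : br (exA (- P.2) (W.1 - 2^-1 *: br P.1 W.1)) y.1 =
    expR (- (P.2 / 2)) *: br W.1 y.1.
  have nb : - (2^-1 *: br P.1 W.1) \in z by rewrite memvN memvZ// br_in.
  rewrite br_pv pv_exA brZl -br_pv brDl (br_zl _ nb) addr0 mulNr; congr (_ *: _).
set Q := _ *: adA H y.1 + _.
have e1 : pv Q = (W.2 / 2) *: pv y.1.
  by rewrite /Q e0 /adA pvD !pvZ pvE ?memvZ// (pv_z (br_in H _ _)) !scaler0 addr0 scalerA.
have e2 : pz Q = W.2 *: pz y.1 + (2^-1 * expR (- (P.2 / 2))) *: br W.1 y.1.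
  by rewrite /Q e0 /adA pzD !pzZ pzE ?memvZ// (pz_id (br_in H _ _)) scalerA.
have e3 : br P.1 (exA P.2 Q) = (expR (P.2 / 2) * (W.2 / 2)) *: br P.1 y.1.
  by rewrite br_pv pv_exA e1 !brZr scalerA -br_pv.
rewrite e3 /exp_adA e1 e2 !scalerDr !scalerA.
have -> : expR P.2 * (2^-1 * expR (- (P.2 / 2))) = expR (P.2 / 2) / 2.
  by rewrite mulrCA -expRD (_ : P.2 + - (P.2 / 2) = P.2 / 2) 1?mulrC//; field.
rewrite (mulrC 2^-1) -!addrA; congr (_ + _).
rewrite [RHS]addrC -!addrA; congr (_ + _).
Qed.

Lemma mx_entry m (M : 'M[R]_(n, m)) i j : M i j = ((delta_mx 0 i : E) *m M) 0 j.
Proof. by rewrite -rowE mxE. Qed.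

Lemma to_chart_entry x y j : tc (x + y) 0 j = tc x 0 j + tc y 0 j.
Proof. by rewrite to_chartD mxE. Qed.

Lemma to_chart_entryZ a x j : tc (a *: x) 0 j = a * tc x 0 j.
Proof. by rewrite to_chartZ mxE. Qed.

Lemma to_chart_entryN x j : tc (- x) 0 j = - tc x 0 j.
Proof. by rewrite to_chartN mxE. Qed.

Lemma pullM_derive p w : is_dmx p w pullM (- (pullM p *m thetaM (w *m pullM p))).
Proof.
move=> i j; apply: is_derive_line.
pose y := oc (delta_mx 0 i).
have -> : (fun h => pullM (p + h *: w) i j) = fun h =>
    expR (- ((oc p).2 / 2) + h * (- ((oc w).2 / 2))) * tc (pv y.1, 0) 0 j
  + expR (- (oc p).2 + h * (- (oc w).2)) * tc (pz y.1 - 2^-1 *: br (oc p).1 y.1, 0) 0 j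
  + h * expR (- (oc p).2 + h * (- (oc w).2)) * tc (- 2^-1 *: br (oc w).1 y.1, 0) 0 j
  + tc (0, y.2) 0 j.
  apply/funext => h; rewrite mx_entry mul_pullM of_chartD of_chartZ pullS_affine.
  by rewrite !to_chart_entry !to_chart_entryZ.
apply: (is_derive_eq (is_derive_exp_comb _ _ _ _ _ _ _ _)).
rewrite [RHS]mxE [X in _ = - X]mx_entry mulmxA mul_thetaM !mul_pullM !to_chartK -/y.
rewrite theta_pull !to_chart_entry to_chart_entryN !to_chart_entryZ; ring.
Qed.

Lemma pushM_derive p w : is_dmx p w pushM (thetaM (w *m pullM p) *m pushM p).
Proof.
move=> i j; apply: is_derive_line.
pose y := oc (delta_mx 0 i).
(* Here the linear factor goes with the rate of v, not of z, hence the other order of the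
   exponentials. *)
have -> : (fun h => pushM (p + h *: w) i j) = fun h =>
    expR ((oc p).2 + h * (oc w).2) * tc (pz y.1, 0) 0 j
  + expR ((oc p).2 / 2 + h * ((oc w).2 / 2)) * tc (pv y.1 + 2^-1 *: br (oc p).1 y.1, 0) 0 j
  + h * expR ((oc p).2 / 2 + h * ((oc w).2 / 2)) * tc (2^-1 *: br (oc w).1 y.1, 0) 0 j
  + tc (0, y.2) 0 j.
  apply/funext => h; rewrite mx_entry mul_pushM of_chartD of_chartZ pushS_affine.
  rewrite !to_chart_entry !to_chart_entryZ; ring.
apply: (is_derive_eq (is_derive_exp_comb _ _ _ _ _ _ _ _)).
rewrite [RHS]mx_entry mulmxA mul_pushM mul_thetaM !mul_pullM !to_chartK -/y.
rewrite push_theta !to_chart_entry !to_chart_entryZ; ring.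
Qed.

Lemma nablaE x y : nabla H x y = gamma H x y + theta H x y.
Proof. by rewrite /gamma subrK. Qed.

Lemma nablaPl a w w' y : nabla H (a *: w + w') y = a *: nabla H w y + nabla H w' y.
Proof. by rewrite nablaDl nablaZl. Qed.

Lemma gammaDr w x y : gamma H w (x + y) = gamma H w x + gamma H w y.
Proof. by have := gammaPr w 1 x y; rewrite !scale1r. Qed.

Lemma thetaDr w x y : theta H w (x + y) = theta H w x + theta H w y.
Proof. by have := thetaPr w 1 x y; rewrite !scale1r. Qed.

Lemma gammaBl w w' y : gamma H (w - w') y = gamma H w y - gamma H w' y.
Proof. by have := gammaPl (-1) w' w y; rewrite !scaleN1r addrC => ->; rewrite addrC. Qed.

(** After substitution of gamma + theta for nabla, the terms in theta alone cancel by
    [theta_bracket], and [solv_bracket_theta] splits the bracket. *)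
Lemma curvature_gamma w x y : curvature H w x y =
  theta H w (gamma H x y) - gamma H x (theta H w y) - gamma H (theta H w x) y
  - (theta H x (gamma H w y) - gamma H w (theta H x y) - gamma H (theta H x w) y)
  + gamma H w (gamma H x y) - gamma H x (gamma H w y).
Proof.
rewrite /curvature !nablaE !gammaDr !thetaDr -theta_bracket.
rewrite (solv_bracket_theta H w x) gammaBl.
apply: (si_ext (H := H)) => u; rewrite !(siDl, siNl); ring.
Qed.

Lemma curv_mx_curvature w x y :
  curv_mx thetaM gammaM w x y = tc (curvature H (oc w) (oc x) (oc y)).
Proof.
rewrite /curv_mx !(mul_gammaM, mul_thetaM) !to_chartK curvature_gamma.
by rewrite !(to_chartD, to_chartN).
Qed.

Lemma of_chart_delta i : oc (delta_mx 0 i) = tnth (frame H) i.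
Proof.
rewrite /of_chart (bigD1 i)//= mxE !eqxx scale1r big1 ?addr0// => j ji.
by rewrite mxE (negbTE ji) andbF scale0r.
Qed.

Lemma curvature_linear x y : linear (fun w => curvature H w x y).
Proof.
move=> a w w'; rewrite /curvature (nablaPl a w w').
have -> : solv_bracket H (a *: w + w') x = a *: solv_bracket H w x + solv_bracket H w' x.
  rewrite !solv_bracket_theta thetaPl thetaPr.
  apply: (si_ext (H := H)) => u; rewrite !(siDl, siNl, siZl); ring.
rewrite !nablaPl nablaDr nablaZr.
apply: (si_ext (H := H)) => u; rewrite !(siDl, siNl, siZl); ring.
Qed.

Lemma rescale_DR_metric c :
  rescale c (DR_metric H) = fun p => pullM p *m (c *: frame_gram H) *m (pullM p)^T.
Proof.
by apply/funext => p; rewrite /rescale DR_metricE -scalemxAr -scalemxAl.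
Qed.

(** The factor c disappears on the right because the Koszul identity is homogeneous in the
    metric. *)
Theorem ricci_DR c p : 0 < c -> ricci (rescale c (DR_metric H)) p =
  - ((\dim v)%:R / 4 + (\dim z)%:R) *: DR_metric H p.
Proof.
move=> c0; have [u [ou uv]] := orthonormal_basis ip v.
have [e [oe ez]] := orthonormal_basis ip z.
have cu : c \is a GRing.unit by rewrite unitfE gt_eqF.
apply/matrixP => j h; rewrite rescale_DR_metric.
pose K := c *: frame_gram H; pose Kinv := c^-1 *: invmx (frame_gram H).
have KK : K *m Kinv = 1%:M.
  by rewrite -scalemxAl -scalemxAr scalerA divrr// scale1r mulmxV// frame_gram_unit.
have Ks : K^T = K by rewrite linearZ /= frame_gram_sym.
have kfE (x y : E) : (x *m K *m y^T) 0 0 = c * si (oc x) (oc y).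
  by rewrite -scalemxAr -scalemxAl mxE form_gram.
rewrite (ricci_left_invariant thetaM_linear gammaM_linear Ks KK pullM_pushM
  pullM_derive pushM_derive); last first.
  move=> x y w; rewrite !kfE !mul_gammaM !mul_thetaM !to_chartK.
  by rewrite mulrCA gamma_koszul; ring.
under eq_bigr => i _ do rewrite curv_mx_curvature mxE of_chart_delta.
rewrite (trace_frame oe ez ou uv (curvature_linear _ _)) (ricci_trace oe ez ou uv).
rewrite -form_gram [RHS]mxE; congr (_ * _).
rewrite [RHS]mx_entry DR_metricE !mulmxA.
rewrite trmx_mul trmx_delta !mulmxA -colE.
by rewrite mxE.
Qed.

Corollary einstein_DR c k : 0 < c ->
  einstein k (rescale c (DR_metric H)) <->
  k * c = - ((\dim v)%:R / 4 + (\dim z)%:R).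
Proof.
move=> c0; split=> [/(_ 0)|kc p]; rewrite ricci_DR// /rescale scalerA; last by rewrite kc.
have G0 : DR_metric H 0 != 0.
  have [Bu Au] := mulmx1_unit (pullM_pushM 0).
  have : DR_metric H 0 \in unitmx.
    by rewrite DR_metricE !unitmx_mul unitmx_tr Bu frame_gram_unit.
  rewrite unitmxE unitfE; apply: contraNneq => ->.
  have det_0 N : (0 < N)%N -> \det (0 : 'M[R]_N) = 0.
    by case: N => // N _; exact: det0.
  by rewrite det_0// /dimS addn1.
move=> /eqP; rewrite -subr_eq0 -scalerBl scaler_eq0 (negbTE G0) orbF subr_eq0.
by move=> /eqP.
Qed.

End chart.

(** * Length of curves *)

Section speed.
Variable R : realType.
Notation mu := (@lebesgue_measure R).

Lemma continuous_primitive (N : R -> R) : continuous N ->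
  exists F : R -> R, (forall x : R, 0 <= x <= 1 -> is_derive x 1 F (N x)) /\
    F 1 - F 0 = \int[mu]_(t in `[0, 1]) N t.
Proof.
(* The primitive starts at -1 and integrability is taken up to 2, so that 0 and 1 are interior
   points with two-sided derivatives. *)
move=> cN; pose F x := \int[mu]_(t in `[-1, x]) N t; exists F.
have iN : mu.-integrable `[-1, 2] (EFin \o N).
  apply: continuous_compact_integrable; first exact: segment_compact.
  by apply: continuous_subspaceT.
have dF (x : R) : -1 < x < 2 -> is_derive x 1 F (N x).
  move=> /andP[x1 x2].
  have [d1 d2] := @continuous_FTC1 R N (BLeft (-1)) x 2 x2 iN x1 (cN x).
  by apply: DeriveDef; [exact: d1|rewrite -derive1E].
have d01 (x : R) : 0 <= x <= 1 -> is_derive x 1 F (N x).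
  by move=> /andP[x0 x1]; apply: dF; apply/andP; split; lra.
split=> //.
have cF (x : R) : 0 <= x <= 1 -> {for x, continuous F}.
  by move=> /d01[+ _] => /derivable1_diffP/differentiable_continuous.
have := @continuous_FTC2 R N F 0 1 ltr01 (continuous_subspaceT cN).
rewrite /Rintegral => ->//.
- split.
  + by move=> x; rewrite in_itv/= => /andP[x0 x1]; have [] : is_derive x 1 F (N x);
      first by apply: d01; rewrite !ltW.
  + by apply: cvg_at_right_filter; apply: cF; rewrite lexx ler01.
  + by apply: cvg_at_left_filter; apply: cF; rewrite lexx ler01.
- move=> x; rewrite in_itv/= => /andP[x0 x1]; rewrite derive1E.
  by apply: derive_val; apply: d01; rewrite !ltW.
Qed.

Lemma derive_ge0_le (g dg : R -> R) x y :
  (forall s : R, 0 <= s <= 1 -> is_derive s 1 g (dg s)) ->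
  (forall s : R, 0 <= s <= 1 -> 0 <= dg s) ->
  0 <= x -> x <= y -> y <= 1 -> g x <= g y.
Proof.
move=> d p x0 xy y1.
have cg : {within `[0, 1], continuous g}.
  apply: continuous_in_subspaceT => s; rewrite inE/= in_itv/= => s01.
  by have [+ _] := d s s01 => /derivable1_diffP/differentiable_continuous.
apply: (@ger0_derive1_ndecr R g 0 1) => //.
- move=> s; rewrite in_itv/= => /andP[s0 s1].
  by have [] : is_derive s 1 g (dg s) by apply: d; rewrite !ltW.
- move=> s; rewrite in_itv/= => /andP[s0 s1].
  have D : is_derive s 1 g (dg s) by apply: d; rewrite !ltW.
  by rewrite derive1E derive_val p// !ltW.
Qed.

(** K F + f and K F - f have nonnegative derivatives, so they are nondecreasing; [df] is never
    integrated. *)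
Lemma speed_bound (f df N F : R -> R) (K x y : R) :
  (forall s : R, 0 <= s <= 1 -> is_derive s 1 f (df s)) ->
  (forall s : R, 0 <= s <= 1 -> is_derive s 1 F (N s)) ->
  (forall s : R, 0 <= s <= 1 -> `|df s| <= K * N s) ->
  0 <= x -> x <= y -> y <= 1 -> `|f y - f x| <= K * (F y - F x).
Proof.
move=> d dF b x0 xy y1; rewrite ler_norml; apply/andP; split.
  have := @derive_ge0_le (fun s => K * F s + f s) (fun s => K * N s + df s) x y.
  move=> /(_ _ _ x0 xy y1) H.
  suff : K * F x + f x <= K * F y + f y by lra.
  apply: H => s s01; last by have := b s s01; rewrite ler_norml => /andP[]; lra.
  exact: is_deriveD (is_deriveZ K (dF s s01)) (d s s01).
have := @derive_ge0_le (fun s => K * F s - f s) (fun s => K * N s - df s) x y.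
move=> /(_ _ _ x0 xy y1) H.
suff : K * F x - f x <= K * F y - f y by lra.
apply: H => s s01; last by have := b s s01; rewrite ler_norml => /andP[]; lra.
exact: is_deriveB (is_deriveZ K (dF s s01)) (d s s01).
Qed.

End speed.

Section inner_norm.
Variables (R : realType) (L : vectType R) (ip : {dot L for idfun}).
Implicit Types x y : L.

Definition nrm x : R := Num.sqrt (ip x x).

Lemma nrm_ge0 x : 0 <= nrm x. Proof. exact: sqrtr_ge0. Qed.
Lemma nrm_sqr x : nrm x ^+ 2 = ip x x. Proof. by rewrite sqr_sqrtr// ip_ge0. Qed.

Lemma ip_le_nrm x y : `|ip x y| <= nrm x * nrm y.
Proof.
rewrite -sqrtrM ?ip_ge0// -sqrtr_sqr ler_sqrt ?mulr_ge0 ?ip_ge0//.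
exact: cauchy_schwarz.
Qed.

(** Tested against itself, a displacement becomes the increment of a real function, to which
    [speed_bound] applies. *)
Lemma nrm_dual x (K : R) : 0 <= K -> `|ip x x| <= K * nrm x -> nrm x <= K.
Proof.
move=> K0; rewrite ger0_norm ?ip_ge0// -nrm_sqr expr2.
have [x0|] := eqVneq (nrm x) 0; first by rewrite x0.
by move=> x0; rewrite ler_pM2r// lt_neqAle eq_sym x0 nrm_ge0.
Qed.

Lemma nrmZ a x : nrm (a *: x) = `|a| * nrm x.
Proof.
by rewrite /nrm ipZl ipZr mulrA -expr2 sqrtrM ?sqr_ge0// sqrtr_sqr.
Qed.

Lemma ler_nrmD x y : nrm (x + y) <= nrm x + nrm y.
Proof.
have h := nrm_ge0 x; have h' := nrm_ge0 y.
apply: nrm_dual; first exact: addr_ge0.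
rewrite {1}ipDl mulrDl (le_trans (ler_normD _ _))// lerD// ip_le_nrm//.
Qed.

End inner_norm.

Lemma continuous_sumR (R : realType) m (f : 'I_m -> R -> R) :
  (forall i, continuous (f i)) -> continuous (fun s => \sum_i f i s).
Proof.
move=> cf; have -> : (fun s => \sum_i f i s) = \sum_i f i.
  by apply/funext => s; rewrite fct_sumE.
elim/big_ind: _ => [s|f1 f2 c1 c2 s|i _]; last exact: cf.
- exact: cvg_cst.
- by apply: continuousD; [exact: c1|exact: c2].
Qed.

(** * Displacement along curves of bounded length *)

Section length.
Variables (R : realType) (L : vectType R) (H : generalized_heisenberg L).

Notation br := (gh_bracket H).
Notation ip := (gh_inner H).
Notation v := (gh_v H).
Notation z := (gh_z H).
Notation pv := (proj_v H).
Notation pz := (proj_z H).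
Notation si := (solv_inner H).
Notation n := (dimS H).
Notation E := 'rV[R]_n.
Notation oc := (of_chart H).
Notation nr := (nrm ip).
Hint Extern 0 (is_true (proj_v _ _ \in _)) => apply: pv_in : core.
Hint Extern 0 (is_true (proj_z _ _ \in _)) => apply: pz_in : core.

(** With B = [X, Y], the square of |B| is <J_B X, Y> on the v components, and J_B scales norms by
    |B|. *)
Lemma nrm_br X Y : nr (br X Y) <= nr (pv X) * nr (pv Y).
Proof.
set B := br X Y; have Bz : B \in z by exact: br_in.
apply: nrm_dual; first by rewrite mulr_ge0// nrm_ge0.
rewrite {2}/B ip_br// (le_trans (ip_le_nrm _ _ _))//.
have -> : nr (gh_J H B (pv X)) = nr B * nr (pv X).
  by rewrite /nrm J_norm// sqrtrM// ip_ge0.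
by rewrite -mulrA mulrC.
Qed.

Definition height (p : E) : R := (oc p).2.

(* If a curve of length l from p to q reaches height T, then going up to T and
   down again costs at least 2 T - height p - height q, while a displacement in
   v (resp. z) below height T is at most expR (T / 2) (resp. expR T) times as
   long as its length. *)
Definition displacement_bound (p q : E) (l : R) := exists T : R,
  [/\ height p <= T, height q <= T, 2 * T - height p - height q <= l,
   nr (pv ((oc q).1 - (oc p).1)) <= expR (T / 2) * l &
   nr (pz ((oc q).1 - (oc p).1) - 2^-1 *: br (oc p).1 ((oc q).1 - (oc p).1))
     <= expR T * (l + l ^+ 2 / 2)].

(** Moving the base point of the correction term from p to q adds half the bracket of the two
    displacements; the cross term l l' of (l + l')^2 / 2 pays for it, which is why the bound in z is
    quadratic. *)
Lemma displacement_bound_cat p q q' l l' : 0 <= l -> 0 <= l' ->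
  displacement_bound p q l -> displacement_bound q q' l' ->
  displacement_bound p q' (l + l').
Proof.
move=> l0 l'0 [T [p1 q1 T1 v1 z1]] [T' [q2 q'2 T2 v2 z2]].
exists (Num.max T T'); set M := Num.max T T'.
have TM : T <= M by rewrite le_max lexx.
have T'M : T' <= M by rewrite le_max lexx orbT.
have eh (s : R) : s <= M -> expR (s / 2) <= expR (M / 2) by rewrite ler_expR; lra.
have e1 (s : R) : s <= M -> expR s <= expR M by rewrite ler_expR.
have d : (oc q').1 - (oc p).1 = ((oc q).1 - (oc p).1) + ((oc q').1 - (oc q).1).
  by rewrite [RHS]addrC addrA subrK.
move: v1 z1 v2 z2; rewrite d; set D := (oc q).1 - _; set D' := (oc q').1 - _.
move=> v1 z1 v2 z2.
have ev : nr (pv D) <= expR (M / 2) * l.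
  by rewrite (le_trans v1)// ler_wpM2r// eh.
have ev' : nr (pv D') <= expR (M / 2) * l'.
  by rewrite (le_trans v2)// ler_wpM2r// eh.
split.
- exact: le_trans TM.
- exact: le_trans T'M.
- by rewrite /M; case: (leP T T') => _; lra.
- rewrite pvD (le_trans (ler_nrmD _ _ _))// mulrDr lerD//.
have ez : nr (pz D - 2^-1 *: br (oc p).1 D) <= expR M * (l + l ^+ 2 / 2).
  by rewrite (le_trans z1)// ler_wpM2r ?e1// addr_ge0// divr_ge0// sqr_ge0.
have ez' : nr (pz D' - 2^-1 *: br (oc q).1 D') <= expR M * (l' + l' ^+ 2 / 2).
  by rewrite (le_trans z2)// ler_wpM2r ?e1// addr_ge0// divr_ge0// sqr_ge0.
have eb : nr (br D D') <= expR M * (l * l').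
  rewrite (le_trans (nrm_br _ _))//.
  have -> : expR M * (l * l') = (expR (M / 2) * l) * (expR (M / 2) * l').
    by rewrite mulrACA -expRD -splitr.
  by rewrite ler_pM// nrm_ge0.
have -> : pz (D + D') - 2^-1 *: br (oc p).1 (D + D') =
    (pz D - 2^-1 *: br (oc p).1 D) + (pz D' - 2^-1 *: br (oc q).1 D')
    + 2^-1 *: br D D'.
  have -> : br (oc q).1 D' = br (oc p).1 D' + br D D'.
    by rewrite -brDl /D addrC subrK.
  rewrite [2^-1 *: (br _ D' + _)]scalerDr opprD (addrA (pz D')).
  by rewrite -[RHS]addrA subrK pzD brDr scalerDr opprD addrACA.
rewrite (le_trans (ler_nrmD _ _ _))//.
have := ler_nrmD ip (pz D - 2^-1 *: br (oc p).1 D) (pz D' - 2^-1 *: br (oc q).1 D').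
rewrite nrmZ ger0_norm//.
move: ez ez' eb; set e := expR M.
have -> : e * (l + l' + (l + l') ^+ 2 / 2) =
    e * (l + l ^+ 2 / 2) + e * (l' + l' ^+ 2 / 2) + e * (l * l') by field.
move=> h1 h2 h3 h4; rewrite (le_trans (lerD h4 (lexx _)))//.
rewrite lerD ?lerD//; have := nrm_ge0 ip (br D D'); lra.
Qed.

Section scaled.
Variable c : R.
Hypothesis c0 : 0 < c.
Notation G := (rescale c (DR_metric H)).
Let a := Num.sqrt c.
Let a0 : 0 < a. Proof. by rewrite sqrtr_gt0. Qed.

Lemma metric_normE p u : metric_norm G p u =
  a * Num.sqrt (si (pullS H (oc p) (oc u)) (pullS H (oc p) (oc u))).
Proof.
rewrite /metric_norm rescale_DR_metric.
have -> : (u *m (pullM p *m (c *: frame_gram H) *m (pullM p)^T) *m u^T) 0 0 =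
    c * si (pullS H (oc p) (oc u)) (pullS H (oc p) (oc u)).
  rewrite -scalemxAr -scalemxAl -scalemxAr -scalemxAl mxE; congr (_ * _).
  rewrite !mulmxA; set x := u *m pullM p.
  by rewrite -[_ *m u^T]mulmxA -trmx_mul -/x form_gram /x mul_pullM to_chartK.
by rewrite sqrtrM// ltW.
Qed.

Lemma metric_norm_ge0 p u : 0 <= metric_norm G p u.
Proof. exact: sqrtr_ge0. Qed.

Lemma pv_pullS P y : pv (pullS H P y).1 = expR (- P.2 / 2) *: pv y.1.
Proof.
have nb : - (2^-1 *: br P.1 y.1) \in z by rewrite memvN memvZ// br_in.
by rewrite /= pv_exA pvD (pv_z nb) addr0.
Qed.

Lemma pz_pullS P y : pz (pullS H P y).1 = expR (- P.2) *: (pz y.1 - 2^-1 *: br P.1 y.1).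
Proof.
have nb : - (2^-1 *: br P.1 y.1) \in z by rewrite memvN memvZ// br_in.
by rewrite /= pz_exA pzD (pz_id nb).
Qed.

(** Pulled back to the identity, the components in v, z and A are orthogonal, and the pull-back
    scales v by exp (- height / 2) and z by exp (- height). *)
Lemma metric_norm_bounds p u : let N := metric_norm G p u / a in
  [/\ `|(oc u).2| <= N, nr (pv (oc u).1) <= expR (height p / 2) * N &
   nr (pz (oc u).1 - 2^-1 *: br (oc p).1 (oc u).1) <= expR (height p) * N].
Proof.
rewrite /= metric_normE mulrAC divff ?gt_eqF// mul1r.
set y := pullS _ _ _; rewrite siE.
have [h1 h2] := (ip_ge0 ip (pv y.1), ip_ge0 ip (pz y.1)).
have h3 := sqr_ge0 y.2; have -> : y.2 * y.2 = y.2 ^+ 2 by rewrite expr2.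
have ePos t (X : L) : nr X = expR t * nr (expR (- t) *: X).
  by rewrite nrmZ ger0_norm ?expR_ge0// mulrA -expRD subrr expR0 mul1r.
split.
- rewrite -[(oc u).2]/(y.2) -sqrtr_sqr ler_sqrt ?addr_ge0//.
  by rewrite lerDr addr_ge0.
- rewrite (ePos (height p / 2)) -mulNr -(pv_pullS (oc p) (oc u)).
  rewrite ler_wpM2l ?expR_ge0// ler_sqrt ?addr_ge0//.
  by rewrite -addrA lerDl addr_ge0.
- rewrite (ePos (height p)) -(pz_pullS (oc p) (oc u)).
  rewrite ler_wpM2l ?expR_ge0// ler_sqrt ?addr_ge0//.
  by rewrite addrAC lerDr addr_ge0.
Qed.

Lemma derive_functional (g : R -> E) (phi : E -> R) s :
  (forall b x y, phi (b *: x + y) = b * phi x + phi y) ->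
  derivable g s 1 -> is_derive s 1 (fun s => phi (g s)) (phi (derive1 g s)).
Proof.
move=> linphi dg.
have phi0 : phi 0 = 0 by have := linphi (-1) 0 0; rewrite scaleN1r oppr0 addr0 mulN1r addNr.
have phiE x : phi x = \sum_i x 0 i * phi (delta_mx 0 i).
  rewrite {1}[x]row_sum_delta.
  elim/big_rec2: _ => // i y1 y2 _ <-; by rewrite linphi.
have -> : (fun s => phi (g s)) =
    \sum_(i < n) (phi (delta_mx 0 i) \*: (fun s => g s 0 i)).
  apply/funext => t; rewrite phiE fct_sumE; apply: eq_bigr => i _; exact: mulrC.
have D i : is_derive s 1 (fun s => g s 0 i) (derive1 g s 0 i).
  apply: DeriveDef; first exact: (derivable_mxP g s 1).1 dg 0 i.
  by rewrite derive1E derive_mx// mxE.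
have DZ i := is_deriveZ (phi (delta_mx 0 i)) (D i).
apply: (is_derive_eq (is_derive_sum DZ)).
rewrite phiE; apply: eq_bigr => i _; exact: mulrC.
Qed.

Lemma continuous_functional (g : R -> E) (phi : E -> R) :
  (forall b x y, phi (b *: x + y) = b * phi x + phi y) ->
  continuous g -> continuous (fun s => phi (g s)).
Proof.
move=> linphi cg.
have phi0 : phi 0 = 0 by have := linphi (-1) 0 0; rewrite scaleN1r oppr0 addr0 mulN1r addNr.
have phiE x : phi x = \sum_i x 0 i * phi (delta_mx 0 i).
  rewrite {1}[x]row_sum_delta.
  elim/big_rec2: _ => // i y1 y2 _ <-; by rewrite linphi.
under eq_fun => s do rewrite phiE.
apply: continuous_sumR => i s; apply: cvgMr_tmp.
apply: (@continuous_comp _ _ _ g (fun x : E => x 0 i)); first exact: cg.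
exact: coord_continuous.
Qed.

Lemma continuous_speed (g : R -> E) : C1_curve g ->
  continuous (fun s => metric_norm G (g s) (derive1 g s)).
Proof.
move=> [dg cg'].
have cg : continuous g.
  by move=> s; have := dg s => /derivable1_diffP/differentiable_continuous.
have [u [ou uv]] := orthonormal_basis ip v.
have [e [oe ez]] := orthonormal_basis ip z.
pose vc (w : L) (x : E) := ip (oc x).1 w.
have vcP w b x y : vc w (b *: x + y) = b * vc w x + vc w y.
  by rewrite /vc of_chartD of_chartZ /= ipDl ipZl.
pose bc i j (x : E) := ip (br (oc x).1 (u i)) (e j).
have bcP i j b x y : bc i j (b *: x + y) = b * bc i j x + bc i j y.
  by rewrite /bc of_chartD of_chartZ /= brDl brZl ipDl ipZl.
have hP b x y : height (b *: x + y) = b * height x + height y.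
  by rewrite /height of_chartD of_chartZ.
(* In orthonormal coordinates the speed is an explicit expression in linear functionals of the point
   and of the velocity. *)
have E1 x y : metric_norm G x y = a * Num.sqrt (
    \sum_i (expR (- height x / 2) * vc (u i) y) ^+ 2
    + \sum_j (expR (- height x) * (vc (e j) y
        - 2^-1 * \sum_i (vc (u i) y * bc i j x))) ^+ 2
    + height y ^+ 2).
  rewrite metric_normE siE pv_pullS pz_pullS; congr (_ * Num.sqrt (_ + _ + _)).
  - rewrite {1}(orthonormal_parseval _ ou uv) ?memvZ//.
    apply: eq_bigr => i _; rewrite ipZl ipZr (ipC ip (u i)) -expr2; congr ((_ * _) ^+ 2).
    by rewrite /vc (ip_split H (oc y).1) (pz_v (uv i)) ip0r addr0 (pv_id (uv i)).
  - have zz : pz (oc y).1 - 2^-1 *: br (oc x).1 (oc y).1 \in z.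
      by rewrite memvB// memvZ// br_in.
    rewrite {1}(orthonormal_parseval _ oe ez) ?memvZ//.
    apply: eq_bigr => j _; rewrite ipZl ipZr (ipC ip (e j)) -expr2; congr ((_ * _) ^+ 2).
    rewrite ipDl ipNl ipZl; congr (_ - _ * _).
      by rewrite /vc (ip_split H (oc y).1) (pv_z (ez j)) ip0r add0r (pz_id (ez j)).
    rewrite br_pv {1}(orthonormal_expand ou uv (pv_in H (oc y).1)).
    rewrite linear_sumr ip_suml; apply: eq_bigr => i _.
    rewrite brZr ipZl /vc /bc; congr (_ * ip _ _).
      by rewrite (ip_split H (oc y).1) (pz_v (uv i)) ip0r addr0 (pv_id (uv i)).
    by rewrite [RHS]br_pv (pv_id (uv i)).
have cv w := continuous_functional (vcP w) cg.
have cv' w := continuous_functional (vcP w) cg'.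
have cb i j := continuous_functional (bcP i j) cg.
have ch := continuous_functional hP cg.
have ch' := continuous_functional hP cg'.
have csqr (f : R -> R) : continuous f -> continuous (fun s => f s ^+ 2).
  by move=> cf s; under eq_fun do rewrite expr2; apply: continuousM; exact: cf.
have cexp (f : R -> R) : continuous f -> continuous (fun s => expR (f s)).
  by move=> cf s; apply: continuous_comp; [exact: cf|exact: continuous_expR].
under eq_fun do rewrite E1.
have cM (f1 f2 : R -> R) : continuous f1 -> continuous f2 -> continuous (fun s => f1 s * f2 s).
  by move=> c1 c2 s; apply: cvgM; [exact: c1|exact: c2].
have cD (f1 f2 : R -> R) : continuous f1 -> continuous f2 -> continuous (fun s => f1 s + f2 s).
  by move=> c1 c2 s; apply: cvgD; [exact: c1|exact: c2].
have cN (f1 : R -> R) : continuous f1 -> continuous (fun s => - f1 s).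
  by move=> c1 s; apply: cvgN; exact: c1.
have cC (k : R) : continuous (fun _ : R => k) by move=> s; exact: cvg_cst.
have cQ : continuous (fun s : R =>
    \sum_i (expR (- height (g s) / 2) * vc (u i) (derive1 g s)) ^+ 2
    + \sum_j (expR (- height (g s)) * (vc (e j) (derive1 g s)
        - 2^-1 * \sum_i (vc (u i) (derive1 g s) * bc i j (g s)))) ^+ 2
    + height (derive1 g s) ^+ 2).
  apply/cD; [apply/cD|exact: csqr].
    apply: continuous_sumR => i; apply/csqr; apply/cM => //.
    by apply/cexp; apply/cM => //; exact: cN.
  apply: continuous_sumR => j; apply/csqr; apply/cM => //.
    by apply/cexp; exact: cN.
  apply/cD => //; apply/cN; apply/cM => //.
  by apply: continuous_sumR => i; exact: cM.
move=> s; apply: cvgMl_tmp.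
exact: (continuous_comp (cQ s) (@sqrt_continuous _ _)).
Qed.

Lemma curve_length_ge0 p q l : curve_length G p q l -> 0 <= l.
Proof.
elim=> [g _|p' q' q'' l1 l2 _ h1 _ h2]; last exact: addr_ge0.
by apply: Rintegral_ge0 => s _; exact: metric_norm_ge0.
Qed.

Lemma displacement_bound_arc (g : R -> E) : C1_curve g ->
  displacement_bound (g 0) (g 1)
    ((\int[@lebesgue_measure R]_(t in `[0, 1]) metric_norm G (g t) (derive1 g t)) / a).
Proof.
move=> g1; have [dg cg'] := g1.
have cg : continuous g.
  by move=> s; have := dg s => /derivable1_diffP/differentiable_continuous.
pose N s := metric_norm G (g s) (derive1 g s) / a.
have [F [dF F01]] := continuous_primitive (continuous_speed g1).
rewrite -F01 {F01}.
have N0 s : 0 <= N s by rewrite divr_ge0 ?metric_norm_ge0// ltW.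
pose F' s := F s / a.
have dF' (s : R) : 0 <= s <= 1 -> is_derive s 1 F' (N s).
  move=> s01; rewrite /F' (_ : (fun s => F s / a) = a^-1 \*: F); last first.
    by apply/funext => x; rewrite mulrC.
  by rewrite /N mulrC; have := dF s s01 => D; exact: is_deriveZ.
have -> : (F 1 - F 0) / a = F' 1 - F' 0 by rewrite mulrBl.
have F'le (x y : R) : 0 <= x -> x <= y -> y <= 1 -> F' x <= F' y.
  by move=> *; apply: (derive_ge0_le dF').
have hP b x y : height (b *: x + y) = b * height x + height y.
  by rewrite /height of_chartD of_chartZ.
have dh (s : R) : 0 <= s <= 1 -> is_derive s 1 (fun s => height (g s)) (height (derive1 g s)).
  by move=> _; apply: (derive_functional hP).
have Nb s := metric_norm_bounds (g s) (derive1 g s).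
have hb (x y : R) : 0 <= x -> x <= y -> y <= 1 ->
    `|height (g y) - height (g x)| <= 1 * (F' y - F' x).
  apply: (speed_bound dh dF') => s _; rewrite mul1r.
  by have [] := Nb s.
(* The maximal height T is attained at m; adding the height variations before and after m gives the
   bound on 2 T. *)
have [m m01 mM] := @EVT_max R (fun s => height (g s)) 0 1 ler01
  (continuous_subspaceT (continuous_functional hP cg)).
move: m01; rewrite in_itv/= => /andP[m0 m1].
pose T := height (g m).
have hT (s : R) : 0 <= s <= 1 -> height (g s) <= T.
  by move=> s01; apply: mM; rewrite in_itv.
set l := F' 1 - F' 0.
have l0 : 0 <= l by rewrite subr_ge0 F'le ?ler01.
have le01 : 0 <= (0 : R) <= 1 by apply/andP; split; lra.
have le11 : 0 <= (1 : R) <= 1 by apply/andP; split; lra.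
pose vf (w : L) (x : E) := ip (pv (oc x).1) w.
have vfP w b x y : vf w (b *: x + y) = b * vf w x + vf w y.
  by rewrite /vf of_chartD of_chartZ /= pvD pvZ ipDl ipZl.
have eT (s t : R) : s <= t -> expR s <= expR t :> R by rewrite ler_expR.
have vb (s : R) : 0 <= s <= 1 -> nr (pv ((oc (g s)).1 - (oc (g 0)).1)) <= expR (T / 2) * l.
  move=> /andP[s0 s1]; set w := pv _.
  apply: nrm_dual; first by rewrite mulr_ge0// expR_ge0.
  have := @speed_bound R (fun s => vf w (g s)) (fun s => vf w (derive1 g s)) N F'
    (expR (T / 2) * nr w) 0 s.
  move=> /(_ _ dF' _ (lexx _) s0 s1) B.
  have -> : ip w w = vf w (g s) - vf w (g 0).
    by rewrite {1}/w /vf -scaleN1r pvD pvZ scaleN1r ipDl ipNl.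
  apply: (le_trans (B _ _)).
  - by move=> x _; apply: (derive_functional (vfP w)).
  - move=> x x01; rewrite (le_trans (ip_le_nrm _ _ _))// mulrAC ler_wpM2r ?nrm_ge0//.
    have [_ b _] := Nb x; rewrite (le_trans b)// ler_wpM2r ?N0// eT//.
    by have := hT x x01; lra.
  - rewrite mulrAC ler_wpM2r ?nrm_ge0// ler_wpM2l ?expR_ge0//.
    by rewrite lerB// F'le.
exists T; split; [exact: hT|exact: hT| |exact: vb|].
  have := hb 0 m (lexx _) m0 m1; have := hb m 1 m0 m1 (lexx _).
  rewrite !ler_norml => /andP[+ _] /andP[_ +].
  by rewrite -/T /l; lra.
set w := _ - _.
apply: nrm_dual.
  by rewrite mulr_ge0 ?expR_ge0// addr_ge0// divr_ge0// sqr_ge0.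
(* The correction is frozen at the starting point, which makes [zf] linear. Along the curve it
   differs from the true one by half a bracket with the displacement so far, hence the extra l / 2
   in the speed. *)
pose zf (x : E) := ip (pz (oc x).1 - 2^-1 *: br (oc (g 0)).1 (oc x).1) w.
have zfP b x y : zf (b *: x + y) = b * zf x + zf y.
  rewrite /zf of_chartD of_chartZ /= pzD pzZ brDr brZr !(ipDl, ipNl, ipZl); ring.
have -> : ip w w = zf (g 1) - zf (g 0).
  have pzN X : pz (- X) = - pz X by exact: linearN.
  have brN X Y : br X (- Y) = - br X Y by exact: linearNr.
  rewrite {1}/w pzD pzN brDr brN /zf !(ipDl, ipNl, ipZl); ring.
have := @speed_bound R (fun s => zf (g s)) (fun s => zf (derive1 g s)) N F'
    (expR T * (1 + l / 2) * nr w) 0 1.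
move=> /(_ _ dF' _ (lexx _) ler01 (lexx _)) B.
apply: (le_trans (B _ _)).
- by move=> x _; apply: (derive_functional zfP).
- move=> x x01; set U := derive1 g x.
  have -> : zf U = ip (pz (oc U).1 - 2^-1 *: br (oc (g x)).1 (oc U).1
      + 2^-1 *: br ((oc (g x)).1 - (oc (g 0)).1) (oc U).1) w.
    by rewrite /zf brDl brNl !(ipDl, ipNl, ipZl); ring.
  rewrite (le_trans (ip_le_nrm _ _ _))// mulrAC ler_wpM2r ?nrm_ge0//.
  rewrite (le_trans (ler_nrmD _ _ _))//.
  have [_ b1 b2] := Nb x.
  have hx := hT x x01.
  have b3 : nr (br ((oc (g x)).1 - (oc (g 0)).1) (oc U).1) <= expR T * l * N x.
    rewrite (le_trans (nrm_br _ _))//.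
    have -> : expR T * l * N x = (expR (T / 2) * l) * (expR (T / 2) * N x).
      by rewrite [RHS]mulrACA -expRD -splitr mulrA.
    rewrite ler_pM ?nrm_ge0//; first exact: vb.
    rewrite (le_trans b1)// ler_wpM2r ?N0// eT//; lra.
  have b4 : nr (pz (oc U).1 - 2^-1 *: br (oc (g x)).1 (oc U).1) <= expR T * N x.
    by rewrite (le_trans b2)// ler_wpM2r ?N0// eT.
  rewrite nrmZ ger0_norm//.
  have -> : expR T * (1 + l / 2) * N x = expR T * N x + 2^-1 * (expR T * l * N x) by field.
  by rewrite lerD// ler_wpM2l.
- rewrite -/l mulrAC ler_wpM2r ?nrm_ge0//.
  have -> : expR T * (1 + l / 2) * l = expR T * (l + l ^+ 2 / 2) by field.
  by [].
Qed.

Lemma curve_length_displacement p q l : curve_length G p q l ->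
  displacement_bound p q (l / a).
Proof.
elim=> [g g1|p' q' q'' l1 l2 c1 h1 c2 h2]; first exact: displacement_bound_arc.
rewrite mulrDl; apply: displacement_bound_cat h1 h2.
  by rewrite divr_ge0 ?(curve_length_ge0 c1)// ltW.
by rewrite divr_ge0 ?(curve_length_ge0 c2)// ltW.
Qed.

End scaled.

End length.

(** * Volumes of balls *)

Section coordinates.
Variables (R : realType) (L : vectType R) (H : generalized_heisenberg L).

Notation br := (gh_bracket H).
Notation ip := (gh_inner H).
Notation v := (gh_v H).
Notation z := (gh_z H).
Notation pv := (proj_v H).
Notation pz := (proj_z H).
Notation S := (solv L).
Notation si := (solv_inner H).
Notation n := (dimS H).
Notation E := 'rV[R]_n.
Notation oc := (of_chart H).
Notation nr := (nrm ip).
Hint Extern 0 (is_true (proj_v _ _ \in _)) => apply: pv_in : core.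
Hint Extern 0 (is_true (proj_z _ _ \in _)) => apply: pz_in : core.

Definition idx_v (i : 'I_(\dim v)) : 'I_n := lshift 1 (lshift (\dim z) i).
Definition idx_z (j : 'I_(\dim z)) : 'I_n := lshift 1 (rshift (\dim v) j).
Definition idx_A : 'I_n := rshift (\dim v + \dim z) ord0.

Lemma idxP (P : 'I_n -> Prop) : (forall i, P (idx_v i)) -> (forall j, P (idx_z j)) ->
  P idx_A -> forall i, P i.
Proof.
move=> Pv Pz PA i; case: (split_ordP (i : 'I_(\dim v + \dim z + 1))) => [j ->|j ->].
  by case: (split_ordP j) => k ->; [exact: Pv|exact: Pz].
by rewrite (ord1 j); exact: PA.
Qed.

Lemma sum_idx (V : nmodType) (f : 'I_n -> V) : \sum_i f i =
  \sum_i f (idx_v i) + \sum_j f (idx_z j) + f idx_A.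
Proof. by rewrite /dimS big_split_ord /= big_split_ord /= big_ord1. Qed.

Lemma frame_v i : tnth (frame H) (idx_v i) = (tnth (vbasis v) i, 0).
Proof. by rewrite /frame /idx_v !tnth_lshift tnth_map. Qed.

Lemma frame_z j : tnth (frame H) (idx_z j) = (tnth (vbasis z) j, 0).
Proof. by rewrite /frame /idx_z tnth_lshift tnth_rshift tnth_map. Qed.

Lemma frame_A : tnth (frame H) idx_A = (0, 1).
Proof. by rewrite /frame /idx_A tnth_rshift. Qed.

Lemma of_chartE (x : E) : oc x =
  (\sum_i x 0 (idx_v i) *: tnth (vbasis v) i + \sum_j x 0 (idx_z j) *: tnth (vbasis z) j,
   x 0 idx_A).
Proof.
rewrite /of_chart sum_idx frame_A.
under eq_bigr => i _ do rewrite frame_v.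
under [X in _ + X + _]eq_bigr => i _ do rewrite frame_z.
have suml N (c : 'I_N -> R) (w : 'I_N -> L) :
    \sum_i c i *: ((w i, 0) : S) = (\sum_i c i *: w i, 0).
  elim/big_rec2: _ => // i y1 y2 _ ->; congr (_, _) => /=.
  by rewrite scaler0 addr0.
rewrite !suml; congr (_, _) => /=; first by rewrite scaler0 addr0.
by rewrite !add0r; exact: mulr1.
Qed.

Lemma heightE (x : E) : height x = x 0 idx_A.
Proof. by rewrite /height of_chartE. Qed.

Lemma sum_vbasis_in (U : {vspace L}) (c : 'I_(\dim U) -> R) :
  \sum_i c i *: tnth (vbasis U) i \in U.
Proof. by apply: memv_suml => i _; rewrite memvZ// vbasis_mem// mem_tnth. Qed.

Lemma pv_of_chart (x : E) : pv (oc x).1 = \sum_i x 0 (idx_v i) *: tnth (vbasis v) i.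
Proof. by rewrite of_chartE pvE ?sum_vbasis_in. Qed.

Lemma pz_of_chart (x : E) : pz (oc x).1 = \sum_i x 0 (idx_z i) *: tnth (vbasis z) i.
Proof. by rewrite of_chartE pzE ?sum_vbasis_in. Qed.

Lemma coord_vbasis_sum (U : {vspace L}) (c : 'I_(\dim U) -> R) j :
  coord (vbasis U) j (\sum_i c i *: tnth (vbasis U) i) = c j.
Proof.
under eq_bigr do rewrite (tnth_nth 0).
by rewrite coord_sum_free// (basis_free (vbasisP U)).
Qed.

Lemma coordinate_v (x : E) i : x 0 (idx_v i) = coord (vbasis v) i (pv (oc x).1).
Proof. by rewrite pv_of_chart coord_vbasis_sum. Qed.

Lemma coordinate_z (x : E) i : x 0 (idx_z i) = coord (vbasis z) i (pz (oc x).1).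
Proof. by rewrite pz_of_chart coord_vbasis_sum. Qed.

Lemma vbasis_expand (U : {vspace L}) X : X \in U ->
  X = \sum_i coord (vbasis U) i X *: tnth (vbasis U) i.
Proof.
move=> XU; rewrite [LHS](coord_vbasis XU); apply: eq_bigr => i _.
by rewrite (tnth_nth 0).
Qed.

(** [vbasis] is an arbitrary basis, so its coordinates are controlled only up to a constant, read
    off from an orthonormal basis. *)
Lemma coord_bound (U : {vspace L}) : exists2 C : R, 0 < C &
  forall X i, X \in U -> `|coord (vbasis U) i X| <= C * nr X.
Proof.
have [e [oe eU]] := orthonormal_basis ip U.
pose C := 1 + \sum_i \sum_j `|coord (vbasis U) i (e j)|.
have C0 i : 0 <= \sum_j `|coord (vbasis U) i (e j)| by rewrite sumr_ge0.
exists C; first by rewrite ltr_wpDr// sumr_ge0.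
move=> X i XU; rewrite {1}(orthonormal_expand oe eU XU) linear_sum /=.
rewrite (le_trans (ler_norm_sum _ _ _))//.
apply: (@le_trans _ _ ((\sum_j `|coord (vbasis U) i (e j)|) * nr X)).
  rewrite mulr_suml; apply: ler_sum => j _; rewrite linearZ /= normrM mulrC.
  rewrite ler_wpM2l// (le_trans (ip_le_nrm _ _ _))//.
  by rewrite {2}/nrm oe eqxx sqrtr1 mulr1.
rewrite ler_wpM2r ?nrm_ge0//.
apply: (@le_trans _ _ (\sum_i \sum_j `|coord (vbasis U) i (e j)|)).
  by rewrite [leRHS](bigD1 i)//= lerDl sumr_ge0.
by rewrite /C lerDr.
Qed.

Lemma row_mx_idx (a : 'rV[R]_(\dim v)) (b : 'rV[R]_(\dim z)) (s : 'rV[R]_1) :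
  let x : E := row_mx (row_mx a b) s in
  [/\ forall i, x 0 (idx_v i) = a 0 i, forall j, x 0 (idx_z j) = b 0 j &
   x 0 idx_A = s 0 0].
Proof.
split=> [i|j|]; rewrite /idx_v /idx_z /idx_A.
- by rewrite !row_mxEl.
- by rewrite row_mxEl row_mxEr.
- by rewrite row_mxEr.
Qed.

(** Along v, z and A the matrix is block triangular with scalar diagonal blocks exp (- t / 2), exp
    (- t) and 1; the bracket enters only the block [Q]. *)
Lemma det_pullM (p : E) :
  \det (pullM p) = expR (- ((\dim v)%:R / 2 + (\dim z)%:R) * height p).
Proof.
pose t := height p.
pose Q : 'M[R]_(\dim v, \dim z) := \matrix_(i, j)
  (- (expR (- t) / 2) * coord (vbasis z) j (br (oc p).1 (tnth (vbasis v) i))).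
pose B : 'M[R]_n := block_mx (block_mx (expR (- t / 2))%:M Q 0 (expR (- t))%:M) 0 0 1%:M.
have -> : pullM p = B.
  apply: mx_eq_row => x; rewrite mul_pullM.
  apply: (can_inj (of_chartK (H := H))); rewrite to_chartK.
  pose a : 'rV[R]_(\dim v) := \row_i x 0 (idx_v i).
  pose b : 'rV[R]_(\dim z) := \row_i x 0 (idx_z i).
  pose s : 'rV[R]_1 := (x 0 idx_A)%:M.
  have xE : x = row_mx (row_mx a b) s :> E.
    apply/rowP; apply: idxP => [i|j|]; have [e1 e2 e3] := row_mx_idx a b s.
    - by rewrite e1 mxE.
    - by rewrite e2 mxE.
    - by rewrite e3 mxE eqxx mulr1n.
  have xB : x *m B = row_mx (row_mx (expR (- t / 2) *: a) (a *m Q + expR (- t) *: b)) s.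
    rewrite xE /B mul_row_block mul_row_block !mulmx0 !addr0 add0r mulmx1 !mul_mx_scalar.
    by [].
  have [f1 f2 f3] := row_mx_idx (expR (- t / 2) *: a) (a *m Q + expR (- t) *: b) s.
  have x1 : (oc x).1 = \sum_i a 0 i *: tnth (vbasis v) i + \sum_j b 0 j *: tnth (vbasis z) j.
    by rewrite of_chartE /=; congr (_ + _); apply: eq_bigr => i _; rewrite mxE.
  rewrite xB [RHS]of_chartE f3 [s 0 0]mxE eqxx mulr1n.
  congr (_, _); last by rewrite of_chartE.
  under eq_bigr => i _ do rewrite f1 mxE -scalerA.
  under [X in _ = _ + X]eq_bigr => i _ do rewrite f2 mxE [X in _ + X]mxE scalerDl -scalerA.
  rewrite big_split /= -!scaler_sumr.
  rewrite -[LHS](gh_split H) pv_pullS pz_pullS; congr (_ + _).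
    congr (_ *: _); rewrite pv_of_chart; apply: eq_bigr => i _; by rewrite mxE.
  rewrite addrC scalerDr pz_of_chart; congr (_ + _).
    by congr (_ *: _); apply: eq_bigr => i _; rewrite mxE.
  have -> : br (oc p).1 (oc x).1 = \sum_i a 0 i *: br (oc p).1 (tnth (vbasis v) i).
    rewrite br_pv (pv_of_chart x) linear_sumr; apply: eq_bigr => i _.
    rewrite brZr [in RHS]br_pv mxE; congr (_ *: br _ _); rewrite pv_id//.
    by rewrite vbasis_mem// mem_tnth.
  under [in RHS]eq_bigr => j _ do rewrite mxE scaler_suml.
  rewrite [RHS]exchange_big /= scaler_sumr -sumrN scaler_sumr; apply: eq_bigr => i _.
  rewrite {1}(vbasis_expand (br_in H (oc p).1 (tnth (vbasis v) i))).
  rewrite !scaler_sumr -sumrN scaler_sumr; apply: eq_bigr => j _.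
  by rewrite !mxE -scaleNr !scalerA; congr (_ *: _); rewrite -/t; ring.
rewrite /B det_ublock det_ublock !det_scalar expr1n mulr1 -!expRM_natl -expRD.
by congr expR; rewrite -/t; field.
Qed.

(** The frame in orthonormal coordinates: the Gram matrix is M M^T, so its determinant is a
    square. *)
Let M (e : 'I_(\dim z) -> L) (u : 'I_(\dim v) -> L) : 'M[R]_n :=
  row_mx (row_mx (\matrix_(i, j) si (tnth (frame H) i) (u j, 0))
                 (\matrix_(i, j) si (tnth (frame H) i) (e j, 0)))
         (\matrix_(i, j) si (tnth (frame H) i) (0, 1)).

Lemma det_frame_gram_gt0 : 0 < \det (frame_gram H).
Proof.
have [u [ou uv]] := orthonormal_basis ip v.
have [e [oe ez]] := orthonormal_basis ip z.
have gE : frame_gram H = M e u *m (M e u)^T.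
  apply/matrixP => i j; rewrite /M !tr_row_mx mul_row_col mul_row_col !mxE.
  rewrite big_ord1 {1}(solv_orthonormal_expand oe ez ou uv (tnth (frame H) i)).
  have siS N (f : 'I_N -> S) w : si (\sum_i f i) w = \sum_i si (f i) w.
    elim/big_rec2: _ => [|l y1 y2 _ <-]; last by rewrite siDl.
    by rewrite /solv_inner /= ip0l mul0r addr0.
  rewrite !siDl !siS siZl !mxE; congr (_ + _ + _ * _); last by rewrite siC.
    by apply: eq_bigr => l _; rewrite siZl !mxE; congr (_ * _); rewrite siC.
  by apply: eq_bigr => l _; rewrite siZl !mxE; congr (_ * _); rewrite siC.
have : \det (frame_gram H) != 0 by rewrite -unitfE -unitmxE frame_gram_unit.
by rewrite lt0r => -> /=; rewrite gE det_mulmx det_tr -expr2 sqr_ge0.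
Qed.

Lemma sqrt_det_DR (c : R) : 0 < c -> exists2 k : R, 0 < k &
  forall p, Num.sqrt (\det (rescale c (DR_metric H) p)) =
    k * expR (- ((\dim v)%:R / 2 + (\dim z)%:R) * height p).
Proof.
move=> c0; exists (Num.sqrt (\det (c *: frame_gram H))).
  by rewrite sqrtr_gt0 detZ mulr_gt0 ?exprn_gt0 ?det_frame_gram_gt0.
move=> p; rewrite rescale_DR_metric !det_mulmx det_tr mulrAC -expr2.
rewrite sqrtrM ?sqr_ge0// sqrtr_sqr det_pullM ger0_norm ?expR_ge0//.
by rewrite mulrC.
Qed.

End coordinates.

(** * Integrals over sets that need not be measurable *)

Section integral_bounds.
Context d (T : measurableType d) (R : realType).
Variable mu : {measure set T -> \bar R}.
Local Open Scope ereal_scope.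
Import HBNNSimple.

(* The integral of a nonnegative function is defined as a supremum over the
   simple functions below it, so that it is monotone without measurability. *)
Lemma ge0_integral_le (A B : set T) (f g : T -> \bar R) :
  (forall x, 0 <= f x) -> (forall x, 0 <= g x) ->
  (forall x, (f \_ A) x <= (g \_ B) x) ->
  \int[mu]_(x in A) f x <= \int[mu]_(x in B) g x.
Proof.
move=> f0 g0 fg; rewrite !ge0_integralE//.
apply: ge_ereal_sup => _ [h/= hf] <-; apply: ereal_sup_ubound; exists h => //.
by move=> x; exact: le_trans (hf x) (fg x).
Qed.

Lemma ge0_integral_ge_cst (A B : set T) (f : T -> \bar R) (m : R) :
  measurable B -> (0 <= m)%R -> (forall x, 0 <= f x) -> B `<=` A ->
  (forall x, B x -> m%:E <= f x) -> m%:E * mu B <= \int[mu]_(x in A) f x.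
Proof.
move=> mB m0 f0 BA mf; rewrite -integral_cst//.
apply: ge0_integral_le => // x.
rewrite /patch; case: ifPn => [/set_mem Bx|_].
  by rewrite mem_set; [exact: mf|exact: BA].
by case: ifPn => // _; exact: f0.
Qed.

Lemma ge0_integral_le_cover N (B : 'I_N -> set T) (M : 'I_N -> R)
    (A : set T) (f : T -> \bar R) :
  (forall i, measurable (B i)) -> (forall i, (0 <= M i)%R) -> (forall x, 0 <= f x) ->
  (forall x, A x -> exists i, B i x /\ f x <= (M i)%:E) ->
  \int[mu]_(x in A) f x <= \sum_(i < N) (M i)%:E * mu (B i).
Proof.
move=> mB M0 f0 cover.
have -> : \sum_(i < N) (M i)%:E * mu (B i) =
    \int[mu]_x \sum_(i < N) ((M i)%:E * (\1_(B i) x)%:E).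
  rewrite ge0_integral_sum//.
  - apply: eq_bigr => i _; rewrite ge0_integralZl ?lee_fin//.
    + by rewrite integral_indic// setIT.
    + by apply/measurable_EFinP; exact: measurable_indic.
  - move=> i; apply: measurable_funeM; apply/measurable_EFinP.
    exact: measurable_indic.
  - by move=> i x _; rewrite mule_ge0// lee_fin.
apply: ge0_integral_le => // [x|x].
  by apply: sume_ge0 => i _; rewrite mule_ge0// lee_fin.
rewrite [leRHS]patchT ?in_setT//.
have s0 (P : pred 'I_N) : 0 <= \sum_(i < N | P i) (M i)%:E * (\1_(B i) x)%:E.
  by apply: sume_ge0 => i _; rewrite mule_ge0// lee_fin.
rewrite /patch; case: ifPn => [/set_mem Ax|_]; last exact: (s0 xpredT).
have [i [Bi fM]] := cover _ Ax.
rewrite (bigD1 i)//= indicE mem_set// mule1 (le_trans fM)//.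
by rewrite leeDl.
Qed.

End integral_bounds.

Section boxes.
Variable R : realType.
Notation mR := (measurableTypeR R).

Definition tbox n (l u : 'I_n -> R) : set (n.-tuple mR) :=
  [set t | forall i, l i <= tnth t i <= u i].

Lemma measurable_tbox n (l u : 'I_n -> R) : measurable (tbox l u).
Proof.
have -> : tbox l u = \bigcap_(i in [set: 'I_n]) ((fun t => tnth t i) @^-1` `[l i, u i]).
  apply/seteqP; split => [t lut i _ /=|t lut i]; first by rewrite in_itv/=; exact: lut.
  by have /= := lut i I; rewrite in_itv.
apply: fin_bigcap_measurable => [|i _]; first exact: finite_finset.
by rewrite -[X in measurable X]setTI; apply: measurable_tnth.
Qed.

Lemma lebesgue_tbox n (l u : 'I_n -> R) : (forall i, l i <= u i) ->
  lebesgue_tuple R n (tbox l u) = (\prod_(i < n) (u i - l i))%:E.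
Proof.
elim: n l u => [|n IH] l u lu.
  have -> : tbox l u = setT by apply/seteqP; split => // t _ [].
  by rewrite big_ord0 /= diracT.
rewrite /= /lebesgue_step /pushforward.
have -> : @tcons R n @^-1` tbox l u = `[l ord0, u ord0] `*`
    tbox (fun i => l (lift ord0 i)) (fun i => u (lift ord0 i)).
  apply/seteqP; split => [[x t] /= h|[x t] /= [h0 h] i].
    split; first by have := h ord0; rewrite /= in_itv/= (tnth_nth 0).
    move=> i; have := h (lift ord0 i); rewrite !(tnth_nth 0) /=.
    by [].
  case: (unliftP ord0 i) => [j ->|->].
    by have := h j; rewrite !(tnth_nth 0).
  by move: h0; rewrite /= in_itv/= (tnth_nth 0).
rewrite product_measure1E//; last exact: measurable_tbox.
rewrite IH; last by move=> i; exact: lu.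
rewrite big_ord_recl EFinM; congr (_ * _)%E.
(* [lebesgue_measure_itv] distinguishes cases; on a degenerate interval its value 0 agrees with u -
   l. *)
apply: (eq_trans (lebesgue_measure_itv `[l ord0, u ord0])); rewrite /= lte_fin; case: ltP => // h.
by rewrite (le_anti (_ : l ord0 <= u ord0 <= l ord0)) ?subrr// lu h.
Qed.

End boxes.

Section line.
Variables (R : realType) (n : nat) (p w : 'rV[R]_n).

Lemma is_derive_line_entry i s :
  is_derive (s : R) 1 (fun s => (p + s *: w) 0 i) (w 0 i).
Proof.
have -> : (fun s => (p + s *: w) 0 i) = cst (p 0 i) + (w 0 i \*: id).
  by apply/funext => t; rewrite !fctE !mxE mulrC.
apply: is_derive_eq; rewrite add0r; exact: mulr1.
Qed.

Lemma derivable_line s : derivable (fun s : R => p + s *: w) s 1.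
Proof. by apply/derivable_mxP => i j; rewrite (ord1 i); have [] := is_derive_line_entry j s. Qed.

Lemma derive1_line s : derive1 (fun s : R => p + s *: w) s = w.
Proof.
rewrite derive1E derive_mx; last exact: derivable_line.
apply/matrixP => i j; rewrite mxE (ord1 i).
by apply: derive_val; exact: is_derive_line_entry.
Qed.

Lemma C1_line : C1_curve (fun s : R => p + s *: w).
Proof.
split; first exact: derivable_line.
have -> : derive1 (fun s : R => p + s *: w) = cst w by apply/funext => s; exact: derive1_line.
by move=> s; exact: cvg_cst.
Qed.

End line.

Section distance.
Variables (R : realType) (n : nat) (G : 'rV[R]_n -> 'M[R]_n).
Hypothesis length_ge0 : forall p q l, curve_length G p q l -> 0 <= l.

Lemma curve_exists p q : [set l | curve_length G p q l] !=set0.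
Proof.
have := length_arc G (C1_line p (q - p)); rewrite scale0r addr0 scale1r addrC subrK.
by move=> h; eexists; exact: h.
Qed.

Lemma has_inf_length p q : has_inf [set l | curve_length G p q l].
Proof.
by split; [exact: curve_exists|exists 0 => l; exact: length_ge0].
Qed.

Lemma dist_le_length p q l : curve_length G p q l -> riemannian_dist G p q <= l.
Proof. by move=> h; apply: ge_inf => //; exact: (has_inf_length p q).2. Qed.

Lemma dist_lt_length p q r : riemannian_dist G p q < r ->
  exists2 l, curve_length G p q l & l < r.
Proof. by move=> /inf_lt; apply; exact: curve_exists. Qed.

Lemma dist_triangle p q q' :
  riemannian_dist G p q' <= riemannian_dist G p q + riemannian_dist G q q'.
Proof.
apply/ler_addgt0Pr => e e0.
have [l1 c1 h1] := @dist_lt_length p q (riemannian_dist G p q + e / 2)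
  ltac:(by rewrite ltrDl divr_gt0).
have [l2 c2 h2] := @dist_lt_length q q' (riemannian_dist G q q' + e / 2)
  ltac:(by rewrite ltrDl divr_gt0).
have := dist_le_length (length_cat c1 c2); lra.
Qed.

End distance.

(** * Balls centered at the origin *)

Section ball.
Variables (R : realType) (L : vectType R) (H : generalized_heisenberg L).

Notation ip := (gh_inner H).
Notation v := (gh_v H).
Notation z := (gh_z H).
Notation n := (dimS H).
Notation E := 'rV[R]_n.
Notation oc := (of_chart H).
Notation nr := (nrm ip).
Variable c : R.
Hypothesis c0 : 0 < c.
Notation G := (rescale c (DR_metric H)).
Let a := Num.sqrt c.
Let a0 : 0 < a. Proof. by rewrite sqrtr_gt0. Qed.

Lemma line_length (p w : E) (N : R) :
  (forall s, metric_norm G (p + s *: w) w = N) -> curve_length G p (p + w) N.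
Proof.
move=> h; have := length_arc G (C1_line p w); rewrite scale0r addr0 scale1r.
under eq_Rintegral => s _ do rewrite derive1_line h.
rewrite Rintegral_cst; last exact: measurable_itv.
rewrite (_ : fine _ = 1) ?mulr1//.
have := lebesgue_measure_itv `[0 : R, 1]; rewrite /= lte_fin ltr01 oppr0 adde0.
exact: congr1.
Qed.

(** Along the ray s w the correction [s w, w] vanishes, so the speed is constant. *)
Lemma horizontal_length (w : E) : height w = 0 -> curve_length G 0 w (a * nr (oc w).1).
Proof.
move=> w0; rewrite -{1}[w]add0r; apply: line_length => s.
rewrite add0r metric_normE//; congr (_ * Num.sqrt _).
rewrite /pullS /solv_inner /= of_chartZ -[(oc w).2]/(height w) w0 mulr0 addr0 /=.
have w2 : (oc w).2 = 0 by exact: w0.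
by rewrite w2 scaler0 oppr0 exA0 brZl gh_alternating !scaler0 subr0.
Qed.

Lemma vertical_length (p w : E) : (oc w).1 = 0 ->
  curve_length G p (p + w) (a * `|height w|).
Proof.
move=> w0; apply: line_length => s.
rewrite metric_normE//; congr (_ * _).
rewrite /pullS /solv_inner /= w0 br0r scaler0 subr0 -(scale0r (0 : L)) exAZ scale0r.
by rewrite ip0l add0r -expr2 sqrtr_sqr.
Qed.

Let k := \dim v.
Let m := \dim z.
Let h0 : R := k%:R / 2 + m%:R.

Lemma ler_nrm_sum N (f : 'I_N -> L) : nr (\sum_i f i) <= \sum_i nr (f i).
Proof.
elim/big_rec2: _ => [|i y1 y2 _ le]; first by rewrite /nrm ip0l sqrtr0.
by rewrite (le_trans (ler_nrmD _ _ _))// lerD2l.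
Qed.

Lemma nrm_of_chart_le (x : E) : (forall i, `|x 0 i| <= 1) ->
  nr (oc x).1 <= \sum_i nr (tnth (frame H) i).1.
Proof.
move=> x1; have -> : (oc x).1 = \sum_i x 0 i *: (tnth (frame H) i).1.
  rewrite /of_chart; elim/big_rec2: _ => // i y1 y2 _ <-.
  by [].
rewrite (le_trans (ler_nrm_sum _))//; apply: ler_sum => i _.
by rewrite nrmZ ler_piMl ?nrm_ge0.
Qed.

(** Follow a ray at height 0, then a vertical line; the ray has bounded length because the
    coordinates in v and z are at most 1. *)
Lemma dist_origin_le (x : E) : (forall i, i != idx_A H -> `|x 0 i| <= 1) ->
  riemannian_dist G 0 x <=
  a * (\sum_i nr (tnth (frame H) i).1 + `|height x|).
Proof.
move=> x1; pose e : E := delta_mx 0 (idx_A H).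
have oe : oc e = (0, 1) by rewrite /e of_chart_delta frame_A.
pose w : E := x - height x *: e.
have wA : w 0 (idx_A H) = 0 by rewrite /w !mxE !eqxx mulr1 heightE subrr.
have hw : height w = 0 by rewrite heightE.
have xw : x = w + height x *: e by rewrite /w subrK.
have w1 i : `|w 0 i| <= 1.
  have [->|iA] := eqVneq i (idx_A H); first by rewrite wA normr0.
  by rewrite /w !mxE (negbTE iA) andbF mulr0 subr0 x1.
have v0 : (oc (height x *: e)).1 = 0 by rewrite of_chartZ oe /= scaler0.
have len := length_cat (horizontal_length hw) (vertical_length w v0).
rewrite -xw in len.
have -> : `|height x| = `|height (height x *: e)|.
  by rewrite {2}/height of_chartZ oe /=; congr `|_|; exact/esym/mulr1.
rewrite (le_trans (dist_le_length (@curve_length_ge0 _ _ H c) len))// mulrDr lerD2r.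
by rewrite ler_wpM2l ?(ltW a0)// nrm_of_chart_le.
Qed.

Lemma volume_density : exists2 K : R, 0 < K & forall p : E,
  Num.sqrt (\det (G p)) = K * expR (- h0 * height p).
Proof. exact: sqrt_det_DR. Qed.

Lemma h0_ge0 : 0 <= h0. Proof. by rewrite addr_ge0// divr_ge0. Qed.

Lemma ball_volume_ge : exists K r0 : R, 0 < K /\ forall r, r0 <= r ->
  ((K * expR (h0 / a * r))%:E <= volume G (closed_geodesic_ball G 0%R r))%E.
Proof.
have [K K0 KE] := volume_density.
set C := \sum_i nr (tnth (frame H) i).1.
exists (K * expR (- (h0 * (C + 1)))), (a * (C + 1)); split.
  by rewrite mulr_gt0// expR_gt0.
(* The ray costs at most a C, so heights down to - rho are within reach. The choice of the threshold
   gives rho >= 1, hence |height| <= rho on the whole box, and the density is least at its top, at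
   height 1 - rho. *)
move=> r r0; pose rho := r / a - C.
have rho1 : 1 <= rho.
  by rewrite /rho lerBrDr ler_pdivlMr// mulrC addrC.
pose l i := if i == idx_A H then - rho else 0.
pose u i := if i == idx_A H then - rho + 1 else 1.
have lu i : u i - l i = 1.
  by rewrite /u /l; case: ifP => _; rewrite ?subr0// opprK addrAC addNr add0r.
have lu' i : l i <= u i by rewrite -subr_ge0 lu.
have := @ge0_integral_ge_cst _ _ R (lebesgue_tuple R n)
  (@row_of_tuple R n @^-1` closed_geodesic_ball G 0 r) (tbox l u)
  (fun t => (Num.sqrt (\det (G (row_of_tuple t))))%:E)
  (K * expR (h0 * (rho - 1))).
have -> : (lebesgue_tuple R n : {measure set _ -> \bar R}) (tbox l u) = 1%E.
  apply: (eq_trans (lebesgue_tbox lu')); congr EFin.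
  by apply: big1 => i _; exact: lu.
rewrite mule1.
have -> : expR (h0 * (rho - 1)) = expR (- (h0 * (C + 1))) * expR (h0 / a * r).
  rewrite -expRD; congr expR; rewrite /rho; field.
  by rewrite gt_eqF.
rewrite mulrA; apply.
- exact: measurable_tbox.
- by rewrite mulr_ge0// ?mulr_ge0 ?expR_ge0// ltW.
- by move=> t; rewrite lee_fin sqrtr_ge0.
- move=> t bt; rewrite /= /closed_geodesic_ball /=.
  have tA := bt (idx_A H); rewrite /l /u eqxx in tA.
  have hE : height (row_of_tuple t : E) = tnth t (idx_A H) by rewrite heightE mxE.
  apply: (le_trans (dist_origin_le _)).
    move=> i iA; rewrite mxE; have := bt i; rewrite /l /u (negbTE iA) => /andP[t0 t1].
    by rewrite ger0_norm.
  rewrite hE -/C; have : `|tnth t (idx_A H)| <= rho.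
    by rewrite ler_norml; move: tA => /andP[]; lra.
  move=> le; rewrite (le_trans (ler_wpM2l (ltW a0) (lerD (lexx C) le)))//.
  by rewrite /rho addrC subrK mulrC divfK ?gt_eqF.
- move=> t bt; rewrite lee_fin KE -mulrA -expRD ler_pM2l// ler_expR.
  have tA := bt (idx_A H); rewrite /l /u eqxx in tA.
  have hE : height (row_of_tuple t : E) = tnth t (idx_A H) by rewrite heightE mxE.
  rewrite hE.
  have -> : - (h0 * (C + 1)) + h0 / a * r = h0 * (rho - 1).
    by rewrite /rho; field; rewrite gt_eqF.
  rewrite mulNr -mulrN ler_wpM2l ?h0_ge0//.
  by move: tA => /andP[]; lra.
Qed.

Definition block (A B C : R) : 'I_n -> R := fun i =>
  (row_mx (row_mx (const_mx A : 'rV[R]_(\dim v)) (const_mx B : 'rV[R]_(\dim z)))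
    (const_mx C : 'rV[R]_1) : E) 0 i.

Lemma blockE A B C : [/\ forall i, block A B C (idx_v i) = A,
  forall j, block A B C (idx_z j) = B & block A B C (idx_A H) = C].
Proof.
rewrite /block; have [e1 e2 e3] := @row_mx_idx _ _ H (const_mx A) (const_mx B) (const_mx C).
by split=> [i|j|]; rewrite ?e1 ?e2 ?e3 mxE.
Qed.

Lemma prod_idx (f : 'I_n -> R) : \prod_i f i =
  (\prod_i f (idx_v i)) * (\prod_j f (idx_z j)) * f (idx_A H).
Proof. by rewrite /dimS big_split_ord /= big_split_ord /= big_ord1. Qed.

Lemma ball_coordinates : exists2 C : R, 0 < C & forall (r : R) (x : E), 0 <= r ->
  closed_geodesic_ball G 0 r x -> let rho := (r + 1) / a in
  [/\ - rho <= height x <= rho,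
   forall i, `|x 0 (idx_v i)| <= C * (expR ((rho + height x) / 4) * rho) &
   forall j, `|x 0 (idx_z j)| <=
     C * (expR ((rho + height x) / 2) * (rho + rho ^+ 2 / 2))].
Proof.
have [C1 C10 C1b] := coord_bound H v; have [C2 C20 C2b] := coord_bound H z.
exists (C1 + C2); first exact: addr_gt0.
move=> r x r0 xr rho; rewrite /closed_geodesic_ball /= in xr.
(* The infimum need not be attained: a curve of length below r + 1 is used, whence the shift in
   [rho]. *)
have [l cl lr] := @dist_lt_length _ _ G 0 x (r + 1)
  (ltac:(by rewrite (le_lt_trans xr)// ltrDl)).
have l0 := @curve_length_ge0 _ _ H c _ _ _ cl.
have lrho : l / a <= rho by rewrite ler_pM2r ?invr_gt0// ltW.
have la0 : 0 <= l / a by rewrite divr_ge0// ltW.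
have rho0 : 0 <= rho := le_trans la0 lrho.
have [T []] := curve_length_displacement c0 cl.
have h00 : height (0 : E) = 0 by rewrite heightE mxE.
have of0 : oc 0 = 0 := of_chart0 H.
rewrite h00 of0 /= subr0 br0l scaler0 !subr0 => T0 Tx Tl vb zb.
(* [Tl] reads 2 T - height x <= l / a, the cost of going up to T and coming back. *)
have Trho : T / 2 <= (rho + height x) / 4 by lra.
have Trho' : T <= (rho + height x) / 2 by lra.
split.
- by apply/andP; split; lra.
- move=> i; rewrite coordinate_v (le_trans (C1b _ _ (pv_in H _)))//.
  apply: ler_pM; [exact: ltW|exact: nrm_ge0|by rewrite lerDl ltW|].
  by rewrite (le_trans vb)// ler_pM ?expR_ge0// ?ler_expR.
- move=> i; rewrite coordinate_z (le_trans (C2b _ _ (pz_in H _)))//.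
  apply: ler_pM; [exact: ltW|exact: nrm_ge0|by rewrite lerDr ltW|].
  rewrite (le_trans zb)// ler_pM ?expR_ge0// ?ler_expR//.
    by rewrite addr_ge0// divr_ge0// sqr_ge0.
  by rewrite lerD// ler_pM2r// ler_sqr.
Qed.

(** Slice j of the ball has heights between - rho + j and - rho + j + 1. [M j] is the density at its
    bottom, and [al j], [be j] are the coordinate bounds at its top. *)
Lemma ball_volume_le : exists (K : R) (D : nat), 0 < K /\ forall r, 0 <= r ->
  (volume G (closed_geodesic_ball G 0%R r) <=
   (K * (1 + r) ^+ D * expR (h0 / a * r))%:E)%E.
Proof.
have [k0 k00 KE] := volume_density.
have [C C0 Cb] := ball_coordinates.
pose W : R := (2 / a + 1) * k0 * (2 * C / a) ^+ k
  * (2 * C * (a^-1 + (a ^+ 2)^-1 / 2)) ^+ m * expR (h0 / a + h0 / 2).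
(* The degree is k from the factors rho in v, 2 m from those quadratic in rho in z, and 1 from the
   number of slices. *)
exists W, (k + 2 * m + 1)%N; split.
  rewrite /W !mulr_gt0// ?expR_gt0// ?exprn_gt0 ?mulr_gt0// ?addr_gt0 ?invr_gt0//.
    by rewrite mulr_gt0 ?invr_gt0.
  by rewrite divr_gt0// invr_gt0 exprn_gt0.
move=> r r0; pose rho := (r + 1) / a.
have rho0 : 0 < rho by rewrite divr_gt0// addrC ltr_pwDl.
pose N := (Num.truncn (2 * rho)).+1.
pose al (j : nat) := C * (expR ((j%:R + 1) / 4) * rho).
pose be (j : nat) := C * (expR ((j%:R + 1) / 2) * (rho + rho ^+ 2 / 2)).
have rho2 : 0 <= rho + rho ^+ 2 / 2 by rewrite addr_ge0 ?ltW// divr_gt0 ?exprn_gt0.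
have al0 j : 0 <= al j by rewrite /al mulr_ge0 ?(ltW C0)// mulr_ge0 ?expR_ge0// ltW.
have be0 j : 0 <= be j by rewrite /be mulr_ge0 ?(ltW C0)// mulr_ge0 ?expR_ge0.
pose l (j : 'I_N) := block (- al j) (- be j) (- rho + j%:R).
pose u (j : 'I_N) := block (al j) (be j) (- rho + j%:R + 1).
pose M (j : 'I_N) := k0 * expR (h0 * rho - h0 * j%:R).
have M0 j : 0 <= M j by rewrite mulr_ge0 ?expR_ge0// ltW.
have lu j i : l j i <= u j i.
  have [l1 l2 l3] := blockE (- al j) (- be j) (- rho + j%:R).
  have [u1 u2 u3] := blockE (al j) (be j) (- rho + j%:R + 1).
  elim/(@idxP _ _ H): i => [i|i|].
  - by rewrite /l /u l1 u1 ge0_cp.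
  - by rewrite /l /u l2 u2 ge0_cp.
  - by rewrite /l /u l3 u3 lerDl.
apply: (le_trans (@ge0_integral_le_cover _ _ R (lebesgue_tuple R n) N
  (fun j => tbox (l j) (u j)) M _ _ _ M0 _ _)).
- by move=> j; exact: measurable_tbox.
- by move=> t; rewrite lee_fin sqrtr_ge0.
- move=> t tr; have [hx vx zx] := Cb r _ r0 tr.
  set x := row_of_tuple t in hx vx zx.
  have tx i : tnth t i = x 0 i by rewrite mxE.
  have hr0 : 0 <= height x + rho by move: hx => /andP[]; rewrite -/rho; lra.
  have hr2 : height x + rho <= 2 * rho by move: hx => /andP[]; rewrite -/rho; lra.
  pose j := Num.truncn (height x + rho).
  have /andP[j1 j2] := truncn_itv hr0; rewrite -/j in j1 j2.
  have jN : (j < N)%N by rewrite ltnS le_truncn.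
  have j3 : height x + rho <= j%:R + 1 by rewrite natr1 ltW.
  exists (Ordinal jN); split.
    have [l1 l2 l3] := blockE (- al j) (- be j) (- rho + j%:R).
    have [u1 u2 u3] := blockE (al j) (be j) (- rho + j%:R + 1).
    apply: (@idxP _ _ H) => [i|i|].
    - rewrite /l /u l1 u1 tx -ler_norml (le_trans (vx i))// ler_pM2l//.
      by rewrite ler_pM2r// ler_expR; rewrite -/rho; lra.
    - rewrite /l /u l2 u2 tx -ler_norml (le_trans (zx i))// ler_pM2l//.
      by rewrite ler_wpM2r// ler_expR; rewrite -/rho; lra.
    - by rewrite /l /u l3 u3 tx -heightE; apply/andP; split; lra.
  rewrite lee_fin KE /M /= ler_pM2l// ler_expR mulNr -mulrBr -mulrN.
  by rewrite ler_wpM2l ?h0_ge0//; lra.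
have -> : (\sum_(j < N) (M j)%:E *
    (lebesgue_tuple R n : {measure set _ -> \bar R}) (tbox (l j) (u j)) =
    (\sum_(j < N) M j * ((2 * al j) ^+ k * (2 * be j) ^+ m))%:E)%E.
  rewrite -sumEFin; apply: eq_bigr => j _; rewrite [RHS]EFinM; congr (_ * _)%E.
  apply: (eq_trans (lebesgue_tbox (lu j))); congr EFin.
  have [l1 l2 l3] := blockE (- al j) (- be j) (- rho + j%:R).
  have [u1 u2 u3] := blockE (al j) (be j) (- rho + j%:R + 1).
  rewrite prod_idx /l /u l3 u3 (_ : _ + 1 - _ = 1) ?mulr1; last by ring.
  under eq_bigr => i _ do rewrite l1 u1 opprK -mulr2n -mulr_natl.
  under [X in _ * X]eq_bigr => i _ do rewrite l2 u2 opprK -mulr2n -mulr_natl.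
  by rewrite !prodr_const !card_ord.
rewrite lee_fin.
pose T0 := k0 * (2 * C * rho) ^+ k * (2 * C * (rho + rho ^+ 2 / 2)) ^+ m
  * expR (h0 * rho + h0 / 2).
have T00 : 0 <= T0.
  by do ?[exact: rho2|exact: expR_ge0|exact: ler0n|exact: ltW|apply: exprn_ge0|apply: mulr_ge0].
(* The box grows like exp ((k/4 + m/2) j) = exp (h0 j / 2) while the density decays like exp (- h0
   j): the lowest slice has the largest bound. *)
have term (j : 'I_N) : M j * ((2 * al j) ^+ k * (2 * be j) ^+ m) <= T0.
  have -> : M j * ((2 * al j) ^+ k * (2 * be j) ^+ m) =
    k0 * (2 * C * rho) ^+ k * (2 * C * (rho + rho ^+ 2 / 2)) ^+ m
    * expR (h0 * rho + h0 / 2 - h0 * j%:R / 2).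
    have -> : 2 * al j = expR ((j%:R + 1) / 4) * (2 * C * rho) by rewrite /al; ring.
    have -> : 2 * be j = expR ((j%:R + 1) / 2) * (2 * C * (rho + rho ^+ 2 / 2)).
      by rewrite /be; ring.
    have -> : expR (h0 * rho + h0 / 2 - h0 * j%:R / 2) = expR (h0 * rho - h0 * j%:R)
      * expR ((j%:R + 1) / 4) ^+ k * expR ((j%:R + 1) / 2) ^+ m.
      rewrite -!expRM_natl -!expRD; congr expR; rewrite /h0; by field.
    rewrite /M !exprMn; ring.
  apply: ler_wpM2l.
    by do ?[exact: rho2|exact: ler0n|exact: ltW|apply: exprn_ge0|apply: mulr_ge0].
  by rewrite ler_expR gerBl mulr_ge0// mulr_ge0// h0_ge0.
apply: (@le_trans _ _ (N%:R * T0)).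
  rewrite mulr_natl -[X in T0 *+ X]card_ord -sumr_const.
  by apply: ler_sum => j _; exact: term.
have s1 : 1 <= 1 + r by rewrite lerDl.
have rhoE : rho = (1 + r) / a by rewrite /rho addrC.
have NB : N%:R <= (2 / a + 1) * (1 + r).
  have h : (Num.truncn (2 * rho))%:R <= 2 * rho by rewrite truncn_le mulr_ge0// ltW.
  rewrite (_ : N%:R = (Num.truncn (2 * rho))%:R + 1); last by rewrite natr1.
  rewrite [leRHS]mulrDl mul1r lerD//.
  by rewrite (le_trans h)// rhoE mulrA mulrAC.
have rB : rho + rho ^+ 2 / 2 <= (a^-1 + (a ^+ 2)^-1 / 2) * (1 + r) ^+ 2.
  have e : (a^-1 + (a ^+ 2)^-1 / 2) * (1 + r) ^+ 2 = (1 + r) ^+ 2 / a + rho ^+ 2 / 2.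
    by rewrite rhoE; field; rewrite gt_eqF.
  rewrite e lerD2r rhoE ler_pM2r ?invr_gt0// expr2 ler_peMr//.
  by rewrite (le_trans _ s1).
have T0B : T0 <= k0 * (2 * C / a) ^+ k
  * (2 * C * (a^-1 + (a ^+ 2)^-1 / 2)) ^+ m * expR (h0 / a + h0 / 2)
  * (1 + r) ^+ (k + 2 * m) * expR (h0 / a * r).
  rewrite /T0.
  have -> : expR (h0 * rho + h0 / 2) = expR (h0 / a + h0 / 2) * expR (h0 / a * r).
    by rewrite -expRD; congr expR; rewrite rhoE; field; rewrite gt_eqF.
  have p1 : (2 * C * rho) ^+ k = (2 * C / a) ^+ k * (1 + r) ^+ k.
    by rewrite -exprMn rhoE; congr (_ ^+ _); ring.
  have p2 : (2 * C * (rho + rho ^+ 2 / 2)) ^+ m <=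
      (2 * C * (a^-1 + (a ^+ 2)^-1 / 2)) ^+ m * (1 + r) ^+ (2 * m).
    rewrite exprM -exprMn lerXn2r ?nnegrE//.
    - by do ?[exact: rho2|exact: ler0n|exact: ltW|apply: mulr_ge0].
    - do ?[exact: ler0n|exact: ltW|apply: exprn_ge0|apply: mulr_ge0].
      + by rewrite addr_ge0 ?divr_ge0 ?invr_ge0 ?exprn_ge0 ?(ltW a0).
      + by rewrite (le_trans _ s1).
    - by rewrite -[leRHS]mulrA ler_wpM2l// mulr_ge0// ltW.
  pose F := k0 * (2 * C / a) ^+ k * (1 + r) ^+ k * expR (h0 / a + h0 / 2) * expR (h0 / a * r).
  have F0 : 0 <= F.
    do ?[exact: expR_ge0|exact: ler0n|exact: ltW|apply: exprn_ge0|apply: mulr_ge0].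
    - by rewrite invr_ge0 ltW.
    - by rewrite (le_trans _ s1).
  have := ler_wpM2l F0 p2; rewrite p1 exprD /F; congr (_ <= _); ring.
apply: (le_trans (ler_pM _ T00 NB T0B)) => //.
by rewrite /W !exprD expr1 le_eqVlt; apply/orP; left; apply/eqP; ring.
Qed.

End ball.

(** * Volume entropy *)

Section growth.
Variable R : realType.

Lemma cvg_invr_pinfty (f : R -> R) : f x @[x --> +oo] --> +oo ->
  (f x)^-1 @[x --> +oo] --> (0 : R).
Proof.
move=> foo; apply/gtr0_cvgV0 => //.
by move/cvgryPgt: foo => /(_ 0).
Qed.

Lemma sqrtr_pinfty : Num.sqrt x @[x --> (+oo : set_system R)] --> +oo.
Proof.
apply/cvgryPge => A; near=> x.
have Ax : A ^+ 2 <= x by near: x; apply: nbhs_pinfty_ge; rewrite num_real.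
by rewrite (le_trans (ler_norm A))// -sqrtr_sqr ler_wsqrtr.
Unshelve. all: by end_near. Qed.

Lemma exponential_growth (f : R -> \bar R) (Q K1 K2 s r0 : R) (D : nat) :
  0 < K1 -> 0 < K2 -> 0 <= s ->
  (forall r, r0 <= r -> ((K1 * expR (Q * r))%:E <= f r)%E) ->
  (forall r, r0 <= r -> (f r <= (K2 * (s + r) ^+ D * expR (Q * r))%:E)%E) ->
  ((r^-1)%:E * lne (f r))%E @[r --> +oo] --> Q%:E.
Proof.
move=> K10 K20 s0 lo up.
pose lower (r : R) : R := ln K1 * r^-1 + Q.
pose upper (r : R) : R := ln K2 * r^-1
  + D%:R * 2 * Num.sqrt (s + 1) * (Num.sqrt r)^-1 + Q.
have V1 : r^-1 @[r --> (+oo : set_system R)] --> (0 : R).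
  by apply: (@cvg_invr_pinfty id); exact: cvg_id.
have V2 : (Num.sqrt r)^-1 @[r --> (+oo : set_system R)] --> (0 : R).
  exact/cvg_invr_pinfty/sqrtr_pinfty.
have M (b : R) (g : R -> R) : g r @[r --> +oo] --> 0 -> b * g r @[r --> +oo] --> 0.
  by move=> g0; rewrite -[X in _ --> X](mulr0 b); exact: cvgMl_tmp.
have lowC : lower r @[r --> +oo] --> Q.
  rewrite -[X in _ --> X]add0r.
  by apply: cvgD; [exact: M|exact: cvg_cst].
have upC : upper r @[r --> +oo] --> Q.
  rewrite -[X in _ --> X]add0r -[X in X + Q](addr0 0).
  by apply: cvgD; [apply: cvgD; exact: M|exact: cvg_cst].
have lowE : (lower r)%:E @[r --> +oo] --> Q%:E by apply: cvg_EFin lowC; exact: nearW.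
have upE : (upper r)%:E @[r --> +oo] --> Q%:E by apply: cvg_EFin upC; exact: nearW.
apply: (squeeze_cvge _ lowE upE); near=> r.
have r1 : 1 <= r by near: r; exact: nbhs_pinfty_ge.
have r00 : r0 <= r by near: r; apply: nbhs_pinfty_ge; rewrite num_real.
have r_gt0 : 0 < r by exact: lt_le_trans r1.
have sr : 0 < s + r by rewrite ltr_wpDl.
have l0 : 0 < K1 * expR (Q * r) by rewrite mulr_gt0 ?expR_gt0.
have u0 : 0 < K2 * (s + r) ^+ D * expR (Q * r).
  by rewrite !mulr_gt0 ?expR_gt0 ?exprn_gt0.
have f0 : (0 <= f r)%E by apply: le_trans (lo _ r00); rewrite lee_fin ltW.
have inD (x : \bar R) : (0 <= x)%E -> x \in `[0%E, +oo%E].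
  by move=> x0; rewrite in_itv/= x0 leey.
(* The bound ln t < t at t = sqrt (s + r), with s + r <= (s + 1) r, makes the polynomial factor
   contribute O(1 / sqrt r) after division by r. *)
have lnD : ln (s + r) <= 2 * Num.sqrt (s + 1) * Num.sqrt r.
  have sq0 : 0 < Num.sqrt (s + r) by rewrite sqrtr_gt0.
  have -> : ln (s + r) = 2 * ln (Num.sqrt (s + r)).
    by rewrite -{1}(sqr_sqrtr (ltW sr)) lnXn// mulr_natl.
  rewrite -mulrA ler_pM2l// -sqrtrM ?addr_ge0//.
  rewrite (le_trans (ltW (ln_sublinear sq0)))// ler_wsqrtr//.
  by rewrite mulrDl mul1r lerD2r ler_peMr.
have lnr : (lne (f r) <= (ln K2 + D%:R * ln (s + r) + Q * r)%:E)%E.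
  have -> : ln K2 + D%:R * ln (s + r) + Q * r = ln (K2 * (s + r) ^+ D * expR (Q * r)).
    rewrite !lnM ?posrE ?mulr_gt0 ?exprn_gt0 ?expR_gt0// expRK lnXn//.
    by rewrite mulr_natl.
  by rewrite -lne_EFin// lee_lne ?up// inD// lee_fin ltW.
have lnl : ((ln K1 + Q * r)%:E <= lne (f r))%E.
  have -> : ln K1 + Q * r = ln (K1 * expR (Q * r)).
    by rewrite lnM ?posrE ?expR_gt0// expRK.
  by rewrite -lne_EFin// lee_lne ?lo// inD// lee_fin ltW.
have rV0 : (0 <= (r^-1)%:E)%E by rewrite lee_fin invr_ge0 ltW.
apply/andP; split.
- apply: le_trans (lee_wpmul2l rV0 lnl); rewrite -EFinM lee_fin /lower.
  by rewrite le_eqVlt; apply/orP; left; apply/eqP; field; rewrite gt_eqF.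
- apply: (le_trans (lee_wpmul2l rV0 lnr)); rewrite -EFinM lee_fin /upper.
  rewrite ler_pdivrMl//.
  have -> : r * (ln K2 / r + D%:R * 2 * Num.sqrt (s + 1) / Num.sqrt r + Q) =
     ln K2 + D%:R * (2 * Num.sqrt (s + 1) * Num.sqrt r) + Q * r.
    have q0 : 0 < Num.sqrt r by rewrite sqrtr_gt0.
    have := sqr_sqrtr (ltW r_gt0); move: q0; set q := Num.sqrt r => q0 <-.
    by field; rewrite gt_eqF.
  by rewrite lerD2r lerD2l ler_wpM2l.
Unshelve. all: by end_near. Qed.

End growth.

Section entropy.
Variables (R : realType) (L : vectType R) (H : generalized_heisenberg L) (c : R).
Hypothesis c0 : 0 < c.
Local Notation G := (rescale c (DR_metric H)).
Local Notation n := (dimS H).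
Local Notation k := (\dim (gh_v H)).
Local Notation m := (\dim (gh_z H)).

Lemma volume_le (A B : set 'rV[R]_n) : A `<=` B -> (volume G A <= volume G B)%E.
Proof.
move=> AB; rewrite /volume; apply: ge0_integral_le => x; rewrite ?lee_fin ?sqrtr_ge0//.
rewrite !patchE; case: ifPn => [|_].
  rewrite !inE /= => /AB xB; rewrite ifT ?inE//.
by case: ifPn => _; rewrite // lee_fin sqrtr_ge0.
Qed.

Lemma volume_entropy_DR :
  is_volume_entropy G ((k%:R / 2 + m%:R) / Num.sqrt c).
Proof.
move=> p.
have [K1 [r1 [K10 lo]]] := ball_volume_ge H c0.
have [K2 [D [K20 up]]] := ball_volume_le H c0.
have tri := @dist_triangle _ _ G (@curve_length_ge0 _ _ H c).
set Q := ((k%:R / 2 + m%:R) / Num.sqrt c) in lo up *.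
(* By the triangle inequality the balls at p and at 0 are nested up to a shift d of the radius,
   which only changes the constants. Both distances are bounded so that symmetry of the distance
   need not be proved. *)
pose d := Num.max 0 (Num.max (riemannian_dist G 0 p) (riemannian_dist G p 0)).
have d0 : 0 <= d by rewrite /d le_max lexx.
have dp : riemannian_dist G 0 p <= d by rewrite /d !le_max lexx !orbT.
have dp' : riemannian_dist G p 0 <= d by rewrite /d !le_max lexx !orbT.
have EG := @exponential_growth _ (fun r => volume G (closed_geodesic_ball G p r)) Q
  (K1 * expR (- (Q * d))) (K2 * expR (Q * d)) (1 + d) (`|r1| + d) D.
apply: EG; rewrite ?mulr_gt0 ?expR_gt0 ?addr_ge0// => r rr.
- have rd : r1 <= r - d by have := ler_norm r1; lra.
  have -> : K1 * expR (- (Q * d)) * expR (Q * r) = K1 * expR (Q * (r - d)).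
    by rewrite -mulrA -expRD; congr (_ * expR _); ring.
  apply: (le_trans (lo _ rd)); apply: volume_le => q /= qr.
  have := tri p 0 q; move: qr.
  by rewrite /closed_geodesic_ball/=; lra.
- have rd : 0 <= r + d by have := normr_ge0 r1; lra.
  have -> : K2 * expR (Q * d) * (1 + d + r) ^+ D * expR (Q * r) =
     K2 * (1 + (r + d)) ^+ D * expR (Q * (r + d)).
    by rewrite mulrDr expRD [1 + (r + d)]addrCA addrC -!addrA; ring.
  apply: le_trans (up _ rd); apply: volume_le => q /= qr.
  have := tri 0 p q; move: qr.
  by rewrite /closed_geodesic_ball/=; lra.
Qed.

End entropy.

(** Both sides are nonnegative, and the difference of their squares is (k - 2m)^2 times a positive
    factor. Thus 2 sqrt 2 / 3 is a lower bound for Q / (n - 1), attained exactly when k = 2m. *)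
Lemma entropy_value_iff (R : rcfType) (k m : nat) (c : R) :
  (0 < k)%N -> (0 < m)%N -> c * (k + m)%:R = k%:R / 4 + m%:R ->
  (k%:R / 2 + m%:R) / Num.sqrt c = 2 * Num.sqrt 2 / 3 * (k + m)%:R
  <-> k = (2 * m)%N.
Proof.
move=> k0 m0 cE.
have K0 : (0 : R) < k%:R by rewrite ltr0n.
have M0 : (0 : R) < m%:R by rewrite ltr0n.
have c0 : 0 < c.
  by rewrite -(@pmulr_lgt0 _ (k + m)%:R) ?cE ?natrD ?addr_gt0 ?divr_gt0 ?ltr0n.
have E : ((k%:R / 2 + m%:R) / Num.sqrt c == 2 * Num.sqrt 2 / 3 * (k + m)%:R) =
    ((k%:R - 2 * m%:R : R) ^+ 2 == 0).
  have lhs0 : 0 <= (k%:R / 2 + m%:R) / Num.sqrt c.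
    by rewrite divr_ge0 ?sqrtr_ge0// addr_ge0// divr_ge0.
  have rhs0 : 0 <= 2 * Num.sqrt 2 / 3 * (k + m)%:R :> R.
    by rewrite !mulr_ge0 ?sqrtr_ge0 ?invr_ge0.
  rewrite -(@eqrXn2 _ 2)//.
  rewrite !exprMn !exprVn !sqr_sqrtr ?(ltW c0)//.
  have -> : c^-1 = (k + m)%:R / (k%:R / 4 + m%:R).
    rewrite -cE invfM mulrCA mulfV ?mulr1//; by rewrite natrD gt_eqF// addr_gt0.
  rewrite natrD -subr_eq0.
  have -> : (k%:R / 2 + m%:R) ^+ 2 * ((k%:R + m%:R) / (k%:R / 4 + m%:R))
     - 2 ^+ 2 * 2 * 3 ^- 2 * (k%:R + m%:R) ^+ 2 =
    (k%:R - 2 * m%:R) ^+ 2 * ((k%:R + m%:R) / (9 * (k%:R + 4 * m%:R))) :> R.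
    by field; rewrite !gt_eqF//; lra.
  rewrite mulf_eq0 orbC gt_eqF//.
  by rewrite divr_gt0 ?mulr_gt0 ?addr_gt0 ?mulr_gt0.
split=> [/eqP|km]; last by apply/eqP; rewrite E km natrM subrr expr0n.
by rewrite E sqrf_eq0 subr_eq0 -natrM eqr_nat => /eqP.
Qed.

Theorem mainTheorem2 (R : realType) :
  (forall (L : vectType R) (H : generalized_heisenberg L),
    let k := \dim (gh_v H) in
    let m := \dim (gh_z H) in
    let n := (k + m + 1)%N in
    (exists2 c : R, 0 < c &
      einstein (- (n%:R - 1)) (rescale c (DR_metric H))) /\
    (forall c : R, 0 < c ->
      einstein (- (n%:R - 1)) (rescale c (DR_metric H)) ->
      exists2 Q : R, is_volume_entropy (rescale c (DR_metric H)) Q &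
        (Q = 2 * Num.sqrt 2 / 3 * (n%:R - 1) <->
         k = (2 * m)%N /\ m \in [:: 1; 2; 4; 8]%N))) /\
  (forall m : nat, m \in [:: 1; 2; 4; 8]%N ->
    exists (L : vectType R) (H : generalized_heisenberg L),
      \dim (gh_z H) = m /\ \dim (gh_v H) = (2 * m)%N).
Proof.
split=> [L H k m n|]; last exact: heisenberg_double_exists.
have k0 : (0 < k)%N by rewrite lt0n dimv_eq0 gh_v_neq0.
have m0 : (0 < m)%N := dim_z_gt0 H.
have K0 : (0 : R) < k%:R by rewrite ltr0n.
have M0 : (0 : R) < m%:R by rewrite ltr0n.
have nE : n%:R - 1 = (k + m)%:R :> R by rewrite /n natrD addrK.
have KM0 : (0 : R) < (k + m)%:R by rewrite natrD addr_gt0.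
rewrite nE; split=> [|c c0 /(einstein_DR H _ c0)].
  exists ((k%:R / 4 + m%:R) / (k + m)%:R); first by rewrite divr_gt0// addr_gt0// divr_gt0.
  apply/einstein_DR; first by rewrite divr_gt0// addr_gt0// divr_gt0.
  by rewrite mulNr mulrC divfK// gt_eqF.
rewrite mulNr => /oppr_inj; rewrite mulrC => cE.
exists ((k%:R / 2 + m%:R) / Num.sqrt c); first exact: volume_entropy_DR.
(* The entropy only forces k = 2m; the restriction on m then holds for every algebra with these
   dimensions. *)
rewrite entropy_value_iff//; split=> [km|[]//].
by split=> //; exact: heisenberg_double_dim.
Qed.
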